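(* If $w$ is a color lowerable colored word, then $P_{\mathrm m}(\pi_-(w))=C_-(P_{\mathrm m}(w))$ and $Q_{\mathrm m}(\pi_-(w))=Q_{\mathrm m}(w)$. Similarly, if $v$ is a color raisable colored word, then $P_{\mathrm m}(\pi_+(v))=C_+(P_{\mathrm m}(v))$ and $Q_{\mathrm m}(\pi_+(v))=Q_{\mathrm m}(v)$.
   Context: Alphabet: unbarred letters $1,2,\dots$ and barred $\bar1,\bar2,\dots$; natural order $\bar1<1<\bar2<2<\cdots$; $\alpha^*$ toggles the bar of a letter. Colored word $w=w_1\cdots w_n$; a subword $w_{k_1}\cdots w_{k_t}$ ($k_1<\dots<k_t$) has place word $\mathbf k$. Mixed insertion (natural order, ties broken by standardization: equal letters in words regarded increasing left to right; in tableaux equal unbarred letters increase left to right, equal barred letters bottom to top): starting from the empty tableau insert $w_1,\dots,w_n$; an unbarred letter goes into the first row, a barred one into the first column; inserting $\alpha$ into a row (column) replaces the least entry $\beta>\alpha$ there (bumping it) or appends $\alpha$ if none; a bumped unbarred letter is inserted into the next row, a bumped barred letter into the next column to the right, until nothing is bumped. $P_{\mathrm m}(w)$ is the final tableau; $Q_{\mathrm m}(w)$ is the standard Young tableau with $i$ in the cell added at step $i$. The southwest entry of a tableau is the bottom entry of its first column; $\mathrm{SW}(w)$ is the southwest entry of $P_{\mathrm m}(w)$. $w$ is color lowerable (raisable) if $\mathrm{SW}(w)$ is barred (unbarred). For a tableau $T$ with barred (unbarred) southwest entry, $C_-(T)$ ($C_+(T)$) removes (adds) the bar on that entry. Decreasing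 hook subwords: standardize $w$ (relabel occurrences of the smallest letter left to right by $1,\dots,c$ or $\bar1,\dots,\bar c$, then the next smallest, etc.) and replace each $\bar x$ by $-x$ to get an integer word $y$; a subword with place word $\mathbf k$ is a decreasing hook subword if $y_{k_1}>\cdots>y_{k_t}$. Let $\tau(w)$ be the maximum length of such, and $\eta$ the smallest letter of $w$ such that the subword of letters $\le\eta$ has a decreasing hook subword of length $\tau(w)$. A special subword is a decreasing hook subword of length $\tau(w)$ using only letters $\le\eta$. On the places $[n]$ define the poset with $i$ below $j$ iff $i<j$ and $y_i\le y_j$; special subwords are the maximum antichains of this poset restricted to the places of letters $\le\eta$, partially ordered by $A\le B$ iff every $a\in A$ is below or equal to some $b\in B$, a distributive lattice; the leftmost (rightmost) special subword is its minimum (maximum). For a place word $\mathbf k=k_1\cdots k_t$ with $w_{k_t}$ barred, $\pi_{\mathbf k}(w)$ is obtained from $w$ by putting $w_{k_t}^*$ in position $k_1$, $w_{k_1}$ in position $k_2$, ..., $w_{k_{t-1}}$ in position $k_t$, all other letters unchanged; $\pi_{\mathbf k}^{-1}$ is its inverse (defined on words with unbarred letter in position $k_1$). $\pi_-(w)=\pi_{\mathbf k}(w)$ with $\mathbf k$ the place word of the rightmost special subword of the color lowerable word $w$, and $\pi_+(v)=\pi^{-1}_{\mathbf k}(v)$ with $\mathbf k$ the place word of the leftmost special subword of the color raisable word $v$ (these are well defined: for color lowerable $w$ the last letter of its rightmost special subword is barred, and for color raisable $v$ the first letter of its leftmost special subword is unbarred). *)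

(* Defs.v *)
From mathcomp Require Import all_boot all_order all_algebra.

Set Implicit Arguments.
Unset Strict Implicit.
Unset Printing Implicit Defensive.

(** The pair [(x, true)] is the unbarred letter x + 1 and [(x, false)] the
    barred letter x + 1, so that the lexicographic order is the natural order
    of the alphabet: bar 1 < 1 < bar 2 < 2 < ... *)
Definition letter : Type := (nat *l bool)%type.

Definition barred (a : letter) : bool := ~~ a.2.
Definition add_bar (a : letter) : letter := (a.1, false).
Definition remove_bar (a : letter) : letter := (a.1, true).
Definition toggle_bar (a : letter) : letter := (a.1, ~~ a.2).

(** A letter of a word paired with its place in the word.  The lexicographic
    order is the order of the standardized word: equal letters, barred or not,
    increase from left to right. *)
Definition entry : Type := (letter *l nat)%type.

Definition entry_barred (x : entry) : bool := barred x.1.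

(** Tableaux are drawn in the English convention and stored as the sequence of
    their rows, from top to bottom; rows and columns are numbered from 0, and a
    cell is a pair (row, column). *)

Section Tableaux.

Variable T : Type.
Implicit Types (t : seq (seq T)) (x : T).

Definition row t (r : nat) : seq T := nth [::] t r.

Definition column t (c : nat) : seq T := pmap (fun s => onth s c) t.

(** Overwrites the given cell, or adds it at the end of its row. *)
Definition set_cell t (p : nat * nat) x : seq (seq T) :=
  set_nth [::] t p.1 (set_nth x (row t p.1) p.2 x).

Definition SW_entry t : option T := ohead (rev (column t 0)).

Definition SW_cell t : nat * nat := ((size (column t 0)).-1, 0).

End Tableaux.

Definition C_minus (t : seq (seq letter)) : seq (seq letter) :=
  if SW_entry t is Some a then set_cell t (SW_cell t) (remove_bar a) else t.

Definition C_plus (t : seq (seq letter)) : seq (seq letter) :=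
  if SW_entry t is Some a then set_cell t (SW_cell t) (add_bar a) else t.

(** The position in [s] of the least entry greater than [x], or [size s] if
    there is none. *)
Definition bump_pos (x : entry) (s : seq entry) : nat :=
  find (fun y => (x < y)%O && all (fun z => (x < z)%O ==> (y <= z)%O) s) s.

(** Inserts [x] into row [k] (if it is unbarred) or column [k] (if it is
    barred) of [t] and carries on with the bumped entries; returns the resulting
    tableau and the new cell.  Every bump strictly increases the entry being
    inserted, so there are at most as many bumps as entries in [t]; this number
    is the [fuel] supplied in [insert]. *)
Fixpoint insert_rec (fuel : nat) (t : seq (seq entry)) (x : entry) (k : nat) :
    seq (seq entry) * (nat * nat) :=
  let line := if entry_barred x then column t k else row t k in
  let j := bump_pos x line in
  let p := if entry_barred x then (j, k) else (k, j) in
  let t' := set_cell t p x in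
  match onth line j, fuel with
  | Some y, m.+1 => insert_rec m t' y (if entry_barred y then p.2 else p.1).+1
  | _, _ => (t', p)
  end.

Definition insert (t : seq (seq entry)) (x : entry) :
    seq (seq entry) * (nat * nat) :=
  insert_rec (size (flatten t)) t x 0.

(** [x.2.+1] is the number of the step at which [x] is inserted. *)
Definition mixed_step (PQ : seq (seq entry) * seq (seq nat)) (x : entry) :
    seq (seq entry) * seq (seq nat) :=
  let: (t, p) := insert PQ.1 x in (t, set_cell PQ.2 p x.2.+1).

Definition mixed_insertion (w : seq letter) :
    seq (seq entry) * seq (seq nat) :=
  foldl mixed_step ([::], [::]) (zip w (iota 0 (size w))).

(** In [Pm w], equal unbarred letters were inserted as entries increasing from
    left to right, and equal barred letters as entries increasing from top to
    bottom (a word [:: a; a] with [a] barred gives one column). *)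
Definition Pm (w : seq letter) : seq (seq letter) :=
  map (map (fun x : entry => x.1)) (mixed_insertion w).1.

Definition Qm (w : seq letter) : seq (seq nat) := (mixed_insertion w).2.

Definition SW (w : seq letter) : option letter := SW_entry (Pm w).

Definition color_lowerable (w : seq letter) : bool :=
  if SW w is Some a then barred a else false.

Definition color_raisable (w : seq letter) : bool :=
  if SW w is Some a then ~~ barred a else false.

Section Words.

Variables (n : nat) (w : n.-tuple letter).
Implicit Types (i j : 'I_n) (A B : {set 'I_n}).

Definition entry_at i : entry := (tnth w i, val i).

(** The rank, from 1 to n, given to the place [i] by standardization. *)
Definition std_rank i : nat := #|[set j | (entry_at j <= entry_at i)%O]|.

(** The integer word y of the standardization of [w]. *)
Definition signed_std i : int :=
  if barred (tnth w i) then (- Posz (std_rank i))%R else Posz (std_rank i).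

(** A subword is given by its set [A] of places; [enum A] lists them from left
    to right and is its place word. *)
Definition decreasing_hook A : bool :=
  sorted (fun i j => (signed_std j < signed_std i)%R) (enum A).

Definition tau : nat := \max_(A : {set 'I_n} | decreasing_hook A) #|A|.

(** Standardizing the subword of letters at most [a] gives these letters the
    same labels as standardizing [w]. *)
Definition longest_hook_upto (a : letter) A : bool :=
  [&& decreasing_hook A, #|A| == tau & [forall i in A, (tnth w i <= a)%O]].

(** [None] only for the empty word. *)
Definition eta : option letter :=
  ohead (sort <=%O [seq a <- w | [exists A, longest_hook_upto a A]]).

Definition special A : bool :=
  if eta is Some a then longest_hook_upto a A else false.

Definition below i j : bool := (i < j) && (signed_std i <= signed_std j)%R.

Definition special_le A B : bool :=
  [forall a in A, exists b in B, (a == b) || below a b].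

Definition is_leftmost A : bool :=
  special A && [forall B, special B ==> special_le A B].

Definition is_rightmost A : bool :=
  special A && [forall B, special B ==> special_le B A].

(** The place words; the default [set0] is used only if there is no minimum,
    resp. maximum, and then [pi_minus w] and [pi_plus w] below are [w]. *)
Definition leftmost : seq 'I_n := enum (odflt set0 [pick A | is_leftmost A]).
Definition rightmost : seq 'I_n := enum (odflt set0 [pick A | is_rightmost A]).

(** [prev k] and [next k] are cyclic on [k] and fix the other places; the bar
    is toggled on the letter that moves from the last place of [k] to the
    first one, resp. from the first one to the last one. *)
Definition pi_places (k : seq 'I_n) : n.-tuple letter :=
  [tuple if ohead k == Some i then toggle_bar (tnth w (prev k i))
         else tnth w (prev k i) | i < n].

Definition pi_places_inv (k : seq 'I_n) : n.-tuple letter :=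
  [tuple if ohead k == Some (next k i) then toggle_bar (tnth w (next k i))
         else tnth w (next k i) | i < n].

Definition pi_minus : n.-tuple letter := pi_places rightmost.
Definition pi_plus : n.-tuple letter := pi_places_inv leftmost.

End Words.

Lemma pi_placesK n (w : n.-tuple letter) (k : seq 'I_n) :
  uniq k -> pi_places_inv (pi_places w k) k = w.
Proof.
have tbK a : toggle_bar (toggle_bar a) = a.
  by case: a => x b; rewrite /toggle_bar /= negbK.
move=> Uk; apply: eq_from_tnth => i; rewrite !tnth_mktuple prev_next //.
by case: eqP => _; rewrite ?tbK.
Qed.

Lemma pi_places_invK n (w : n.-tuple letter) (k : seq 'I_n) :
  uniq k -> pi_places (pi_places_inv w k) k = w.
Proof.
have tbK a : toggle_bar (toggle_bar a) = a.
  by case: a => x b; rewrite /toggle_bar /= negbK.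
move=> Uk; apply: eq_from_tnth => i; rewrite !tnth_mktuple next_prev //.
by case: eqP => _; rewrite ?tbK.
Qed.

(* Main.v *)
(** For a set of places X cut out by the order of places or by the order of
    standardized letters, the mixed tableau of the subword of w on X has the same
    shape as the Robinson-Schensted tableau of the integer word of that subword:
    both families of shapes obey Fomin's local growth rules.  Hence the shapes of
    the prefixes determine Q_m, and the shapes of the subwords of the k smallest
    letters determine the cell of each letter in P_m; the southwest entry is the
    letter at which the number of rows reaches its final value.

    In an integer word, moving each letter of the rightmost longest decreasing
    subword to the place of the next one, and the last one to the end, does not
    change the Knuth class.  It suffices to see this for the reading word of a
    tableau, where the subword is found greedily with one letter in each row, and
    to check that the move is compatible with elementary Knuth relations.  Applied
    to the integer word of w and to its inverse (places listed by increasing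
    letters), this shows that pi_- changes none of the above shapes, while it
    removes the bar of the southwest letter.  For pi_+ one compares v with the word
    that is rotated back to v, and reverses and complements both orders. *)

Require Import Defs.
From mathcomp Require Import all_boot all_order ssralg ssrnum ssrint zify.

Set Implicit Arguments.
Unset Strict Implicit.
Unset Printing Implicit Defensive.
Import Order.TTheory.

(** * Row insertion and Knuth equivalence *)

(** Everything hinges on a coincidence of signs. Let q be the rank of the southwest letter. Among
    the q smallest letters, a barred southwest letter is standardized to the least integer, -q;
    without its bar it becomes the greatest, q. So in the inverse word its place is listed first
    before the rotation and last after it, and the rotation there is exactly the Knuth-preserving
    move. In the word itself the move agrees with the rotation except for the extreme letter, which
    a restriction to smaller letters discards.

    Both words are needed because Knuth equivalence survives restriction to an interval of letters,
    not of places. The word controls the m smallest letters for m < q. The inverse word controls the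
    prefixes, and also m >= q, since letters of larger rank have integers outside [-q, q] and only
    extend it at both ends.

    The remaining obstacle is ties: standardization must commute with the rotation, so no moved
    letter may pass an equal one. Extremality of the subword excludes this, because such a passage
    would give a longer or a more extreme subword. *)

Fixpoint ins (x : nat) (R : seq nat) : seq nat * seq nat :=
  if R is y :: R' then
    if x < y then (x :: R', [:: y])
    else (y :: (ins x R').1, (ins x R').2)
  else ([:: x], [::]).

(** Insertion is organized by rows: the letters bumped from one row form, in order, the word that is
    inserted into the rows below. Statements about tableaux thus reduce to inductions over a single
    row. *)
Fixpoint run (R w : seq nat) : seq nat * seq nat :=
  if w is x :: w' then
    ((run (ins x R).1 w').1, (ins x R).2 ++ (run (ins x R).1 w').2)
  else (R, [::]).

(** A nonempty word leaves at least one letter in its row, so the bumped word is shorter and the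
    length of the word is enough fuel. *)
Fixpoint schensted_rec (k : nat) (w : seq nat) : seq (seq nat) :=
  if k is k'.+1 then
    if w is [::] then [::] else (run [::] w).1 :: schensted_rec k' (run [::] w).2
  else [::].

Definition schensted (w : seq nat) := schensted_rec (size w) w.

Lemma size_ins x R : size (ins x R).1 + size (ins x R).2 = (size R).+1.
Proof. by elim: R => //= y R; case: ifP => _ /=; lia. Qed.

Lemma size_run R w : size (run R w).1 + size (run R w).2 = size R + size w.
Proof.
elim: w R => [|x w IH] R /=; first by rewrite addn0.
by rewrite size_cat; have := IH (ins x R).1; have := size_ins x R; lia.
Qed.

Lemma size_ins_ge x R : size R <= size (ins x R).1.
Proof. by elim: R => //= y R; case: ifP => _ /=; lia. Qed.

Lemma size_ins_gt0 x R : 0 < size (ins x R).1.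
Proof. by case: R => //= y R; case: ifP. Qed.

Lemma size_run_ge R w : size R <= size (run R w).1.
Proof.
elim: w R => [|x w IH] R //=.
exact: leq_trans (size_ins_ge x R) (IH _).
Qed.

Lemma size_run_gt0 x w R : 0 < size (run R (x :: w)).1.
Proof. exact: leq_trans (size_ins_gt0 x R) (size_run_ge _ _). Qed.

Lemma schensted_rec_enough k w :
  size w <= k -> schensted_rec k w = schensted w.
Proof.
rewrite /schensted.
suff fuel m : size w <= m -> size w <= k -> schensted_rec k w = schensted_rec m w.
  by move=> wk; apply: fuel.
elim: k m w => [|k IH] [|m] [|x w] //= wm wk.
have bumped_le : size (run [::] (x :: w)).2 <= size w.
  by have := size_run [::] (x :: w); have := size_run_gt0 x w [::]; move=> /=; lia.
by congr (_ :: _); apply: IH; move: bumped_le => /=; lia.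
Qed.

Lemma schenstedE w : w != [::] ->
  schensted w = (run [::] w).1 :: schensted (run [::] w).2.
Proof.
case: w => // x w _; rewrite {1}/schensted /= schensted_rec_enough //.
by have := size_run [::] (x :: w); have := size_run_gt0 x w [::]; move=> /=; lia.
Qed.

Lemma run_cat R u v :
  run R (u ++ v) =
    ((run (run R u).1 v).1, (run R u).2 ++ (run (run R u).1 v).2).
Proof.
elim: u R => [|x u IH] R /=; first by case: (run R v).
by rewrite IH /= catA.
Qed.

Lemma perm_ins x R : perm_eq ((ins x R).2 ++ (ins x R).1) (x :: R).
Proof.
apply/permP => p; elim: R => [|y R] /=; first by lia.
by case: ifP => _ /=; rewrite !count_cat /=; lia.
Qed.

Lemma perm_run R w : perm_eq ((run R w).2 ++ (run R w).1) (R ++ w).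
Proof.
apply/permP => p; elim: w R => [|x w IH] R /=; first by rewrite cats0.
have /permP/(_ p) := perm_ins x R; have := IH (ins x R).1.
by rewrite !count_cat /=; lia.
Qed.

Lemma ins_sorted x R : sorted leq R -> sorted leq (ins x R).1.
Proof.
elim: R => //= y R IH pyR; case: ltnP => [xy|yx] /=.
  by case: R pyR {IH} => //= z R /andP[yz ->]; rewrite andbT; lia.
case: R pyR IH => [|z R] /=; first by rewrite yx.
move=> /andP[yz pz] /(_ pz); case: ltnP => /= xz; first by move->; rewrite yx.
by move=> ->; rewrite yz.
Qed.

Lemma run_sorted R w : sorted leq R -> sorted leq (run R w).1.
Proof. by elim: w R => //= x w IH R sR; apply/IH/ins_sorted. Qed.

(** Knuth's elementary relations, oriented so that every word can be rewritten
    into the reading word of its insertion tableau. *)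
Inductive knuth_step : seq nat -> seq nat -> Prop :=
| knuth_yzx l r x y z : x < y -> y <= z ->
    knuth_step (l ++ [:: y; z; x] ++ r) (l ++ [:: y; x; z] ++ r)
| knuth_xzy l r x y z : x <= y -> y < z ->
    knuth_step (l ++ [:: x; z; y] ++ r) (l ++ [:: z; x; y] ++ r).

Inductive knuth_red (u : seq nat) : seq nat -> Prop :=
| knuth_red_refl : knuth_red u u
| knuth_red_step v w : knuth_step u v -> knuth_red v w -> knuth_red u w.

Inductive knuth : seq nat -> seq nat -> Prop :=
| knuth_of_step u v : knuth_step u v -> knuth u v
| knuth_refl u : knuth u u
| knuth_sym u v : knuth u v -> knuth v u
| knuth_trans v u w : knuth u v -> knuth v w -> knuth u w.

#[local] Hint Resolve knuth_refl knuth_red_refl : core.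

Lemma knuth_red_trans v u w : knuth_red u v -> knuth_red v w -> knuth_red u w.
Proof.
move=> uv; elim: uv w => // u1 v1 w1 s _ IH w /IH.
exact: knuth_red_step s.
Qed.

Lemma knuth_red_knuth u v : knuth_red u v -> knuth u v.
Proof.
by elim=> // u1 v1 w1 /knuth_of_step uv _; apply: knuth_trans.
Qed.

Lemma knuth_step_context l r u v :
  knuth_step u v -> knuth_step (l ++ u ++ r) (l ++ v ++ r).
Proof.
by case=> l1 r1 x y z H1 H2; rewrite -!catA !(catA l l1); constructor.
Qed.

Lemma knuth_red_context l r u v :
  knuth_red u v -> knuth_red (l ++ u ++ r) (l ++ v ++ r).
Proof.
elim=> // u1 v1 w1 /(knuth_step_context l r) s _; exact: knuth_red_step s.
Qed.

Lemma knuth_context l r u v : knuth u v -> knuth (l ++ u ++ r) (l ++ v ++ r).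
Proof.
elim=> // {u v}.
- by move=> u v s; apply/knuth_of_step/knuth_step_context.
- by move=> u v _ /knuth_sym.
by move=> v u w _ uv _; apply: knuth_trans.
Qed.

Lemma knuth_yzx3 x y z : x < y -> y <= z -> knuth [:: y; z; x] [:: y; x; z].
Proof. by move=> xy yz; apply: knuth_of_step; apply: (knuth_yzx [::] [::]). Qed.

Lemma knuth_xzy3 x y z : x <= y -> y < z -> knuth [:: x; z; y] [:: z; x; y].
Proof. by move=> xy yz; apply: knuth_of_step; apply: (knuth_xzy [::] [::]). Qed.

Lemma knuth_perm u v : knuth u v -> perm_eq u v.
Proof.
elim=> {u v} //; last 2 first.
- by move=> u v _; rewrite perm_sym.
- by move=> v u w _ uv _; apply: perm_trans.
move=> u v [] l r x y z _ _; rewrite perm_cat2l perm_cat2r;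
  by apply/permP => p /=; lia.
Qed.

Lemma knuth_red_perm u v : knuth_red u v -> perm_eq u v.
Proof. by move/knuth_red_knuth/knuth_perm. Qed.

Lemma ins_bumped x R : (ins x R).2 = [::] \/ exists y, (ins x R).2 = [:: y].
Proof.
elim: R => [|y R IH] /=; first by left.
by case: ifP => _ /=; [right; exists y | exact: IH].
Qed.

Lemma ins_bumped_gt x y R : y \in (ins x R).2 -> x < y /\ y \in R.
Proof.
elim: R => //= z R IH; case: ifP => [xz|_] /=.
  by rewrite !inE => /eqP->; rewrite eqxx.
by move=> /IH [xy yR]; rewrite inE yR orbT.
Qed.

Lemma mem_ins x R : x \in (ins x R).1.
Proof.
by elim: R => [|y R IH] /=; rewrite ?inE //; case: ifP => _; rewrite inE ?eqxx ?IH ?orbT.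
Qed.

Lemma ins_bumped_exists x y R : y \in R -> x < y ->
  exists2 z, (ins x R).2 = [:: z] & x < z.
Proof.
elim: R => //= a R IH; rewrite inE; case: (ltnP x a) => [xa|ax] /=; first by move=> _ _; exists a.
by move=> /orP[/eqP-> |yR] xy; [move: xy; rewrite ltnNge ax | exact: IH yR xy].
Qed.

Lemma ins_bumped_le x y z R : sorted leq R ->
  (ins x R).2 = [:: z] -> y \in R -> x < y -> z <= y.
Proof.
elim: R => //= a R IH pa; case: (ltnP x a) => [xa|ax] /=.
  move=> [<-]; rewrite inE => /orP[/eqP-> //|yR] _.
  by move: (order_path_min leq_trans pa) => /allP/(_ _ yR).
move=> bz; rewrite inE => /orP[/eqP->|yR] xy; first by move: xy; rewrite ltnNge ax.
exact: IH (path_sorted pa) bz yR xy.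
Qed.

(** Half of the row bumping lemma. What [z] bumps exceeds [z], so it is not the freshly inserted
    [y]; it was in [R] already and bounds what [y] bumps. *)
Lemma ins_bumped_mono y z R : sorted leq R -> y <= z ->
  forall z', (ins z (ins y R).1).2 = [:: z'] ->
  exists2 y', (ins y R).2 = [:: y'] & y' <= z'.
Proof.
move=> sR yz z' bz'.
have [zz' z'R] : z < z' /\ z' \in (ins y R).1 by apply: ins_bumped_gt; rewrite bz' inE.
have z'R2 : z' \in R.
  have : z' \in y :: R by rewrite -(perm_mem (perm_ins y R)) mem_cat z'R orbT.
  by rewrite inE => /orP[/eqP zy|//]; move: zz'; rewrite zy ltnNge yz.
have [y' by' yy'] := ins_bumped_exists z'R2 (leq_ltn_trans yz zz').
by exists y' => //; apply: (ins_bumped_le sR by' z'R2); lia.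
Qed.

(** The other half: the freshly inserted [z] is itself available to [y], whence the upper bound. *)
Lemma ins_bumped_anti y z R : sorted leq R -> y < z ->
  exists2 y', (ins y (ins z R).1).2 = [:: y'] & y < y' <= z.
Proof.
move=> sR yz; have [y' by' yy'] := ins_bumped_exists (mem_ins z R) yz.
exists y' => //; rewrite yy'.
exact: ins_bumped_le (ins_sorted z sR) by' (mem_ins z R) yz.
Qed.

(** A Knuth move on the inserted letters induces at most a Knuth move on the bumped ones. Once the
    row entries not exceeding [x] are stripped off, [x] bumps the first entry [a] or what replaced
    it, and comparing [a] with [y] decides which relation appears. *)
Lemma run_knuth_yzx R x y z : sorted leq R -> x < y -> y <= z ->
  (run R [:: y; z; x]).1 = (run R [:: y; x; z]).1 /\
  knuth (run R [:: y; z; x]).2 (run R [:: y; x; z]).2.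
Proof.
move=> sR xy yz; elim: R sR => [|a R IH] sR.
  rewrite /=; do !case: ltnP => ? /=; try lia.
  by split.
have sR' := path_sorted sR.
have aR : forall b, b \in R -> a <= b.
  by move: (order_path_min leq_trans sR) => /allP.
case: (leqP a x) => ax.
  have -> : forall u v w, a <= u -> a <= v -> a <= w ->
     run (a :: R) [:: u; v; w] = (a :: (run R [:: u; v; w]).1, (run R [:: u; v; w]).2).
    by move=> u v w ? ? ? /=; do !(case: ltnP => ? /=; try lia).
  2-4: lia.
  have -> : forall u v w, a <= u -> a <= v -> a <= w ->
     run (a :: R) [:: u; v; w] = (a :: (run R [:: u; v; w]).1, (run R [:: u; v; w]).2).
    by move=> u v w ? ? ? /=; do !(case: ltnP => ? /=; try lia).
  2-4: lia.
  by have [/= -> ?] := IH sR'; split.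
case: (leqP a y) => ay.
  have -> : run (a :: R) [:: y; z; x] =
    (x :: (ins z (ins y R).1).1, (ins y R).2 ++ (ins z (ins y R).1).2 ++ [:: a]).
    by rewrite /=; do !(case: ltnP => ? /=; try lia); rewrite ?cats0.
  have -> : run (a :: R) [:: y; x; z] =
    (x :: (ins z (ins y R).1).1, (ins y R).2 ++ [:: a] ++ (ins z (ins y R).1).2).
    by rewrite /=; do !(case: ltnP => ? /=; try lia); rewrite ?cats0.
  split=> //=; case: (ins_bumped z (ins y R).1) => [->|[z' bz']] //=.
  have [y' by' y'z'] := ins_bumped_mono sR' yz bz'; rewrite by' bz' /=.
  have [yy' y'R] : y < y' /\ y' \in R by apply: ins_bumped_gt; rewrite by' inE.
  by apply: knuth_yzx3; lia.
have -> : run (a :: R) [:: y; z; x] =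
    (x :: (ins z R).1, [:: a] ++ (ins z R).2 ++ [:: y]).
  by rewrite /=; do !(case: ltnP => ? /=; try lia); rewrite ?cats0.
have -> : run (a :: R) [:: y; x; z] =
    (x :: (ins z R).1, [:: a; y] ++ (ins z R).2).
  by rewrite /=; do !(case: ltnP => ? /=; try lia); rewrite ?cats0.
split=> //=; case: (ins_bumped z R) => [->|[z' bz']] //=.
rewrite bz' /=; have [zz' z'R] : z < z' /\ z' \in R.
  by apply: ins_bumped_gt; rewrite bz' inE.
apply: knuth_yzx3 => //.
exact: aR.
Qed.

(** The kind of relation can change: if [z] too is below the first entry [a], and [h] is the next
    entry, the bumped words are a h z and a z h, a relation of the other kind. Hence both kinds must
    be carried through the rows together. *)
Lemma run_knuth_xzy R x y z : sorted leq R -> x <= y -> y < z ->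
  (run R [:: x; z; y]).1 = (run R [:: z; x; y]).1 /\
  knuth (run R [:: x; z; y]).2 (run R [:: z; x; y]).2.
Proof.
move=> sR xy yz; elim: R sR => [|a R IH] sR.
  rewrite /=; do !case: ltnP => ? /=; try lia.
  by split.
have sR' := path_sorted sR.
have aR : forall b, b \in R -> a <= b.
  by move: (order_path_min leq_trans sR) => /allP.
case: (leqP a x) => ax.
  have runa : forall u v w, a <= u -> a <= v -> a <= w ->
     run (a :: R) [:: u; v; w] = (a :: (run R [:: u; v; w]).1, (run R [:: u; v; w]).2).
    by move=> u v w ? ? ? /=; do !(case: ltnP => ? /=; try lia).
  rewrite (runa x z y) ?(runa z x y); try lia.
  by have [/= -> ?] := IH sR'; split.
case: (leqP a z) => az.
  have -> : run (a :: R) [:: x; z; y] =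
    (x :: (ins y (ins z R).1).1, a :: (ins z R).2 ++ (ins y (ins z R).1).2).
    by rewrite /=; do !(case: ltnP => ? /=; try lia); rewrite ?cats0.
  have -> : run (a :: R) [:: z; x; y] =
    (x :: (ins y (ins z R).1).1, (ins z R).2 ++ [:: a] ++ (ins y (ins z R).1).2).
    by rewrite /=; do !(case: ltnP => ? /=; try lia); rewrite ?cats0.
  split=> //=; case: (ins_bumped z R) => [->|[z' bz']] //=.
  have [y' by' /andP[yy' y'z]] := ins_bumped_anti sR' yz; rewrite by' bz' /=.
  have [zz' z'R] : z < z' /\ z' \in R by apply: ins_bumped_gt; rewrite bz' inE.
  have /ins_bumped_gt[_ y'R] : y' \in (ins y (ins z R).1).2 by rewrite by' inE.
  have := perm_mem (perm_ins z R) y'; rewrite mem_cat y'R orbT inE => /esym y'zR.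
  have ay' : a <= y' by case/orP: y'zR => [/eqP-> //|/aR].
  by apply: knuth_xzy3; lia.
case: R sR aR {IH} sR' => [|h R] sR aR sR'.
  rewrite /=; do !(case: ltnP => ? /=; try lia).
  by split.
have ah : a <= h by apply: aR; rewrite inE eqxx.
rewrite /=; do !(case: ltnP => ? /=; try lia).
split=> //; apply: knuth_yzx3 => //; lia.
Qed.

Lemma run_knuth R u v : sorted leq R -> knuth u v ->
  (run R u).1 = (run R v).1 /\ knuth (run R u).2 (run R v).2.
Proof.
move=> sR uv; elim: uv R sR => {u v}; last 3 first.
- by [].
- by move=> u v _ IH R sR; have [-> uv] := IH R sR; split=> //; apply: knuth_sym.
- move=> v u w _ IH1 _ IH2 R sR; have [-> uv] := IH1 R sR; have [-> vw] := IH2 R sR.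
  by split=> //; apply: knuth_trans uv vw.
have ctx l r a b R : sorted leq R ->
   (forall R, sorted leq R -> (run R a).1 = (run R b).1 /\
                     knuth (run R a).2 (run R b).2) ->
   (run R (l ++ a ++ r)).1 = (run R (l ++ b ++ r)).1 /\
   knuth (run R (l ++ a ++ r)).2 (run R (l ++ b ++ r)).2.
  move=> sR ab; rewrite !run_cat /=.
  have [-> kab] := ab _ (run_sorted l sR); split=> //.
  exact: knuth_context.
by move=> u v [] l r x y z H1 H2 R sR; apply: ctx => // R' sR';
  [apply: run_knuth_yzx | apply: run_knuth_xzy].
Qed.

Lemma schensted_knuth u v : knuth u v -> schensted u = schensted v.
Proof.
have [k] := ubnP (size u); elim: k u v => // k IH u v uk uv.
have suv := perm_size (knuth_perm uv).
case: u v uk uv suv => [|x u] [|y v] // uk uv _.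
rewrite (@schenstedE (x :: u)) // (@schenstedE (y :: v)) //; have [-> uv2] := run_knuth (R := [::]) isT uv.
congr (_ :: _); apply: IH uv2.
by have := size_run [::] (x :: u); have := size_run_gt0 x u [::]; move: uk => /=; lia.
Qed.

(** * Reading words of insertion tableaux and symmetries of the Knuth relations *)

Definition rowword (T : seq (seq nat)) := flatten (rev T).

Lemma rowword_cons R T : rowword (R :: T) = rowword T ++ R.
Proof. by rewrite /rowword rev_cons -cats1 flatten_cat /= cats0. Qed.

Lemma knuth_red_slide a x R : sorted leq (a :: R) -> x < a ->
  knuth_red (a :: rcons R x) (a :: x :: R).
Proof.
elim: R a => [|r R IH] a //= /andP[ar sR] xa.
apply: (@knuth_red_trans (a :: r :: x :: R)).
  have := knuth_red_context [:: a] [::] (IH r sR (leq_trans xa ar)).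
  by rewrite !cats0.
apply: knuth_red_step (knuth_red_refl _).
by apply: (knuth_yzx [::]).
Qed.

(** The new letter slides left by moves of the first kind until it stands just after the entry it
    bumps; that entry then travels to the front by moves of the second kind. *)
Lemma ins_knuth_red x R : sorted leq R ->
  knuth_red (rcons R x) ((ins x R).2 ++ (ins x R).1).
Proof.
elim: R => //= a R IH sR; case: ltnP => xa /=; first exact: knuth_red_slide.
have sR' := path_sorted sR.
apply: (@knuth_red_trans (a :: (ins x R).2 ++ (ins x R).1)).
  by have := knuth_red_context [:: a] [::] (IH sR'); rewrite !cats0.
case: (ins_bumped x R) => [->|[y by_]] //; rewrite by_ /=.
have [xy _] : x < y /\ y \in R by apply: ins_bumped_gt; rewrite by_ inE.
case: R sR {IH sR'} by_ => //= r R /andP[ar pR]; case: ltnP => xr /=.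
  case=> <-; apply: knuth_red_step (knuth_red_refl _).
  by apply: (knuth_xzy [::]).
move=> by_; apply: knuth_red_step (knuth_red_refl _).
by apply: (knuth_xzy [::]); lia.
Qed.

Lemma run_knuth_red R w : sorted leq R ->
  knuth_red (R ++ w) ((run R w).2 ++ (run R w).1).
Proof.
elim: w R => [|x w IH] R sR /=; first by rewrite cats0.
rewrite -cat_rcons -catA.
apply: knuth_red_trans.
  exact: (knuth_red_context [::] w (ins_knuth_red x sR)).
have := knuth_red_context (ins x R).2 [::] (IH _ (ins_sorted x sR)).
by rewrite !cats0 -!catA.
Qed.

Lemma schensted_knuth_red w : knuth_red w (rowword (schensted w)).
Proof.
have [k] := ubnP (size w); elim: k w => // k IH [|x w] // wk.
rewrite schenstedE // rowword_cons.
apply: knuth_red_trans (run_knuth_red (x :: w) (isT : sorted leq [::])) _.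
rewrite -[_ ++ _]cat0s -[rowword _ ++ _]cat0s.
apply: (knuth_red_context [::]); apply: IH.
by have := size_run [::] (x :: w); have := size_run_gt0 x w [::]; move: wk => /=; lia.
Qed.

(** Only [x] and [z] trade places. If both survive the restriction, convexity keeps the witness [y]
    as well; otherwise the two words become equal. *)
Lemma knuth_filter (p : pred nat) u v :
  (forall x y z, x <= y <= z -> p x -> p z -> p y) ->
  knuth u v -> knuth (filter p u) (filter p v).
Proof.
move=> pconv; elim=> {u v}; last 3 first.
- by [].
- by move=> u v _; apply: knuth_sym.
- by move=> v u w _ uv _; apply: knuth_trans.
move=> u v [] l r x y z H1 H2; rewrite !filter_cat; apply: knuth_context => /=.
  case px: (p x); case pz: (p z) => //.
  rewrite (pconv x y z) //; last by lia.
  by apply: knuth_yzx3.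
case px: (p x); case pz: (p z) => //.
rewrite (pconv x y z) //; last by lia.
by apply: knuth_xzy3.
Qed.

(** Reversal exchanges the two kinds of relation, whose weak and strict inequalities sit on opposite
    sides; distinct letters make all of them strict. *)
Lemma knuth_rev u v : uniq u -> knuth u v -> knuth (rev u) (rev v).
Proof.
move=> Uu uv; elim: uv Uu => {u v}; last 3 first.
- by [].
- move=> u v /knuth_perm/perm_uniq uv IH; rewrite -uv => /IH; exact: knuth_sym.
- move=> v u w /knuth_perm/perm_uniq uv IH1 _ IH2 Uu.
  by apply: knuth_trans (IH1 Uu) (IH2 _); rewrite -uv.
move=> u v [] l r x y z H1 H2; rewrite !rev_cat -!catA cat_uniq => /and3P[_ _].
  rewrite cat_uniq => /andP[U3 _]; apply: knuth_context.
  apply: knuth_xzy3; first lia.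
  by move: U3; rewrite /= !inE; lia.
rewrite cat_uniq => /andP[U3 _]; apply: knuth_context.
apply: knuth_yzx3; last lia.
by move: U3; rewrite /= !inE; lia.
Qed.

(** Turning a word by 180 degrees exchanges rightmost and leftmost decreasing subwords, which is how
    the results on the former are carried over to the latter. *)
Lemma knuth_revneg N u v : all (fun x => x <= N) u -> knuth u v ->
  knuth (rev (map (subn N) u)) (rev (map (subn N) v)).
Proof.
move=> uN uv; elim: uv uN => {u v}; last 3 first.
- by [].
- move=> u v /knuth_perm/perm_all uv IH; rewrite -uv => /IH; exact: knuth_sym.
- move=> v u w /knuth_perm/perm_all uv IH1 _ IH2 Uu.
  by apply: knuth_trans (IH1 Uu) (IH2 _); rewrite -uv.
move=> u v [] l r x y z H1 H2; rewrite !map_cat !rev_cat -!catA !all_cat => /and3P[_ N3 _];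
  apply: knuth_context; apply/knuth_sym.
  by apply: knuth_xzy3; move: N3 => /=; lia.
by apply: knuth_yzx3; move: N3 => /=; lia.
Qed.

Lemma subseq_cat_split (T : eqType) (b l r : seq T) : subseq b (l ++ r) ->
  exists b1 b2, [/\ b = b1 ++ b2, subseq b1 l & subseq b2 r].
Proof.
case/subseqP => m sm ->; exists (mask (take (size l) m) l), (mask (drop (size l) m) r).
split; try exact: mask_subseq.
rewrite -mask_cat ?cat_take_drop // size_take_min; move: sm; rewrite size_cat; lia.
Qed.

Lemma map_cat_inv (T1 T2 : Type) (f : T1 -> T2) s u v : map f s = u ++ v ->
  exists s1 s2, [/\ s = s1 ++ s2, map f s1 = u & map f s2 = v].
Proof.
move=> E; exists (take (size u) s), (drop (size u) s); split.
- by rewrite cat_take_drop.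
- by rewrite map_take E take_size_cat.
by rewrite map_drop E drop_size_cat.
Qed.

Definition dec := pairwise gtn.

Lemma dec_catP u v : reflect
  [/\ dec u, dec v & forall x y, x \in u -> y \in v -> y < x] (dec (u ++ v)).
Proof.
rewrite /dec pairwise_cat; apply: (iffP and3P) => [[/allrelP uv du dv]|[du dv uv]].
  by split=> // x y xu yv; apply: uv.
by split=> //; apply/allrelP => x y xu yv; apply: uv.
Qed.

Lemma dec_consP x v : reflect
  (dec v /\ forall y, y \in v -> y < x) (dec (x :: v)).
Proof.
rewrite /dec /=; apply: (iffP andP) => [[/allP xv dv]|[dv xv]]; split=> //.
exact/allP.
Qed.

(** * Moving the letters of the rightmost longest decreasing subword *)

(** A decreasing subword is recorded by marks on the letters, so that it splits along with the word
    into a Knuth triple and its context. *)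
Definition mword := seq (nat * bool).
Definition letters (mw : mword) := [seq p.1 | p <- mw].
Definition marked (mw : mword) := [seq p.1 | p <- mw & p.2].

(** At most one letter ever waits. The waiting list starts empty for a whole word, so the place of
    the first mark is then closed up instead of refilled. *)
Definition hold (h : seq nat) (mw : mword) :=
  if marked mw is x :: s then [:: last x s] else h.

Fixpoint shout (h : seq nat) (mw : mword) : seq nat :=
  if mw is p :: mw' then
    if p.2 then h ++ shout [:: p.1] mw' else p.1 :: shout h mw'
  else [::].

(** Every marked letter moves to the place of the next marked letter, the last
    one moves to the end of the word; [h] is waiting to be put in the place of
    the first one. *)
Definition shift h mw := shout h mw ++ hold h mw.

Lemma letters_cat u v : letters (u ++ v) = letters u ++ letters v.
Proof. exact: map_cat. Qed.

Lemma marked_cat u v : marked (u ++ v) = marked u ++ marked v.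
Proof. by rewrite /marked filter_cat map_cat. Qed.

Lemma marked_subseq mw : subseq (marked mw) (letters mw).
Proof. exact/map_subseq/filter_subseq. Qed.

Lemma hold_cat h u v : hold h (u ++ v) = hold (hold h u) v.
Proof.
rewrite /hold marked_cat; case: (marked u) => //= x s.
by case: (marked v) => [|y s']; rewrite ?cats0 // last_cat.
Qed.

Lemma hold_cons h x b v : hold h ((x, b) :: v) = hold (if b then [:: x] else h) v.
Proof. by rewrite -cat1s hold_cat; case: b. Qed.

Lemma shout_cat h u v : shout h (u ++ v) = shout h u ++ shout (hold h u) v.
Proof.
elim: u h => [|[x b] u IH] h //=; rewrite hold_cons.
by case: b => /=; rewrite IH // catA.
Qed.

Lemma shift_cat h u v : shift h (u ++ v) = shout h u ++ shift (hold h u) v.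
Proof. by rewrite /shift shout_cat hold_cat catA. Qed.

Lemma hold_nilP mw :
  (marked mw = [::] /\ hold [::] mw = [::]) \/
  exists A h, marked mw = rcons A h /\ hold [::] mw = [:: h].
Proof.
rewrite /hold; case: (marked mw) => [|x s]; [by left | right].
by exists (belast x s), (last x s); rewrite -lastI.
Qed.

(** Of two longest decreasing subwords, the one farther right has the larger letters. The condition
    is phrased by letters because these, unlike places, can be compared before and after a Knuth
    move. *)
Definition rightmost_mark (mw : mword) :=
  [/\ uniq (letters mw), dec (marked mw) &
      forall b, subseq b (letters mw) -> dec b ->
        size b <= size (marked mw) /\
        (size b = size (marked mw) -> all2 leq b (marked mw))].

Lemma all2_cat_eqsize (T1 T2 : Type) (r : T1 -> T2 -> bool) s1 s2 t1 t2 :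
  size s1 = size t1 ->
  all2 r (s1 ++ s2) (t1 ++ t2) = all2 r s1 t1 && all2 r s2 t2.
Proof. by elim: s1 t1 => [|x s1 IH] [|y t1] //= [/IH->]; rewrite andbA. Qed.

Lemma all2_leq_trans u v w : all2 leq u v -> all2 leq v w -> all2 leq u w.
Proof.
elim: u v w => [|x u IH] [|y v] [|z w] //= /andP[xy uv] /andP[yz vw].
by rewrite (leq_trans xy yz) (IH v).
Qed.

Lemma all2_leq_refl u : all2 leq u u.
Proof. by elim: u => //= x u ->; rewrite leqnn. Qed.

Lemma letters3 mw l r a b c : letters mw = l ++ [:: a; b; c] ++ r ->
  exists ml mr ba bb bc,
    [/\ mw = ml ++ [:: (a, ba); (b, bb); (c, bc)] ++ mr,
        letters ml = l & letters mr = r].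
Proof.
case/map_cat_inv=> ml [m' [-> lml /map_cat_inv[mid [mr [-> lmid lmr]]]]].
case: mid lmid => [|[a' ba] [|[b' bb] [|[c' bc] []]]] //= [-> -> ->].
by exists ml, mr, ba, bb, bc.
Qed.

Lemma shift_context ml mr u v :
  hold (hold [::] ml) u = hold (hold [::] ml) v ->
  knuth (shout (hold [::] ml) u) (shout (hold [::] ml) v) ->
  knuth (shift [::] (ml ++ u ++ mr)) (shift [::] (ml ++ v ++ mr)).
Proof.
move=> huv suv; rewrite !shift_cat huv.
exact: knuth_context.
Qed.

Lemma subseq3 (a b c : nat) s : subseq s [:: a; b; c] ->
  exists ma mb mc : bool, s = nseq ma a ++ nseq mb b ++ nseq mc c.
Proof.
case/subseqP => [[|ma [|mb [|mc []]]]] // _ ->.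
by exists ma, mb, mc; case: ma; case: mb; case: mc.
Qed.

Lemma uniq3 (l r : seq nat) a b c : uniq (l ++ [:: a; b; c] ++ r) ->
  [/\ a != b, a != c & b != c].
Proof.
rewrite cat_uniq => /and3P[_ _]; rewrite cat_uniq => /andP[+ _].
by rewrite /= !inE negb_or => /and3P[/andP[-> ->] ->].
Qed.

Section Step.

Variable mw : mword.
Hypothesis RM : rightmost_mark mw.

Lemma mark_max b : subseq b (letters mw) -> dec b -> size b <= size (marked mw).
Proof. by case: RM => _ _ H sb db; case: (H b sb db). Qed.

Lemma mark_not_longer u v b w : marked mw = u ++ b ++ w ->
  subseq (u ++ v ++ w) (letters mw) -> dec (u ++ v ++ w) -> size v <= size b.
Proof. by move=> E sb db; move: (mark_max sb db); rewrite E !size_cat leq_add2l leq_add2r. Qed.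

Lemma mark_replace u a b w : marked mw = u ++ a :: w ->
  subseq (u ++ b :: w) (letters mw) -> dec (u ++ b :: w) -> b <= a.
Proof.
move=> E sb db; case: RM => _ _ /(_ _ sb db)[_].
rewrite E !size_cat /= => /(_ erefl).
by rewrite all2_cat_eqsize // => /andP[_ /= /andP[]].
Qed.

End Step.

Lemma perm_zxy (l r : seq nat) x y z :
  perm_eq (l ++ [:: z; x; y] ++ r) (l ++ [:: x; z; y] ++ r).
Proof. by rewrite perm_cat2l perm_cat2r; apply/permP => p /=; lia. Qed.

(** The marks travel with their letters, since [x] and [z] cannot both be marked. Extremality is
    what relates the waiting letter to [y] or [z] so that the shifted triples are again Knuth
    equivalent. *)
Lemma rightmost_step_xzy l r x y z mw : x <= y -> y < z ->
  letters mw = l ++ [:: x; z; y] ++ r -> rightmost_mark mw ->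
  exists2 mw', letters mw' = l ++ [:: z; x; y] ++ r /\ rightmost_mark mw' &
    knuth (shift [::] mw) (shift [::] mw').
Proof.
move=> xy0 yz E RM; have [U dA _] := RM.
have [ml [mr [bx [bz [by_ [Emw El Er]]]]]] := letters3 E.
have xy : x < y.
  by move: U; rewrite E => /uniq3[_ xney _]; rewrite ltn_neqAle xney.
have [zx yz' yx] : [/\ (z == x) = false, (y == z) = false & (y == x) = false] by split; clear -xy yz; lia.
have E' : letters (ml ++ [:: (z, bz); (x, bx); (y, by_)] ++ mr)
    = l ++ [:: z; x; y] ++ r.
  by rewrite !letters_cat El Er.
have Emk : marked mw = marked ml ++ marked [:: (x, bx); (z, bz); (y, by_)] ++ marked mr.
  by rewrite Emw !marked_cat.
have [nxz nxy] : ~~ (bx && bz) /\ ~~ (bx && by_).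
  have : dec (marked [:: (x, bx); (z, bz); (y, by_)]).
    by move: dA; rewrite Emk => /dec_catP[_ /dec_catP[]].
  by case: (bx) (bz) (by_) => [] [] []; rewrite /dec /= => d; split=> //; clear -xy yz d; lia.
have Emk' : marked (ml ++ [:: (z, bz); (x, bx); (y, by_)] ++ mr) = marked mw.
  rewrite Emk !marked_cat; congr (_ ++ _ ++ _).
  by move: nxz; case: (bx); case: (bz).
have sl : subseq (marked ml) l by rewrite -El marked_subseq.
have sr : subseq (marked mr) r by rewrite -Er marked_subseq.
exists (ml ++ [:: (z, bz); (x, bx); (y, by_)] ++ mr).
  split=> //; split; rewrite ?Emk' //.
    by rewrite E' (perm_uniq (perm_zxy _ _ _ _ _)) -E.
  rewrite E' => b /subseq_cat_split[b1 [b' [-> sb1 /subseq_cat_split[bm [b2 [-> sbm sb2]]]]]] db.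
  (* The only decreasing block created by the move is [z x]. Trading [x] for [y] brings it back into
     the old word and only enlarges its letters. *)
  have [E3|bmN] := eqVneq bm [:: z; x].
    subst bm.
    have db' : dec (b1 ++ [:: z; y] ++ b2).
      move: db => /dec_catP[d1 /dec_consP[/dec_consP[d2 x2] z2] d12].
      apply/dec_catP; split=> //.
        apply/dec_consP; split.
          by apply/dec_consP; split=> // t /x2 /ltn_trans; apply.
        move=> t; rewrite !inE => /orP[/eqP->//|t2].
        by apply: z2; rewrite inE t2 orbT.
      have zs s : s \in b1 -> z < s by move=> s1; apply: d12; rewrite //= inE eqxx.
      move=> s t s1; rewrite /= !inE => /or3P[/eqP->|/eqP->|t2]; first exact: zs.
        exact: ltn_trans yz (zs _ s1).
      by apply: d12; rewrite //= !inE t2 !orbT.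
    have sb' : subseq (b1 ++ [:: z; y] ++ b2) (letters mw).
      rewrite E; apply: cat_subseq => //; apply: cat_subseq => //.
      exact: subseq_cons.
    have [_ _ /(_ _ sb' db')[le1 le2]] := RM.
    have same : size (b1 ++ [:: z; x] ++ b2) = size (b1 ++ [:: z; y] ++ b2).
      by rewrite !size_cat.
    rewrite same; split=> // /le2; apply: all2_leq_trans.
    by rewrite !all2_cat_eqsize // !all2_leq_refl /= leqnn (ltnW xy).
  have [_ _ H] := RM; apply: H => //; rewrite E; apply: cat_subseq => //.
  apply: cat_subseq => //.
  have [ma [mb [mc Ebm]]] := subseq3 sbm.
  have : dec bm by case/dec_catP: db => _ /dec_catP[].
  move: bmN; rewrite Ebm; case: ma mb mc {Ebm} => [] [] [] //=; rewrite ?eqxx //;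
    move=> _; rewrite /dec /= ?zx /= ?yx /= ?yz' /= ?eqxx //; clear -xy yz; lia.
have [dl] : [/\ dec (marked ml), dec (marked [:: (x, bx); (z, bz); (y, by_)]), dec (marked mr)
   & (forall a b, a \in marked ml ->
        b \in marked [:: (x, bx); (z, bz); (y, by_)] ++ marked mr -> b < a) /\
     (forall a b, a \in marked [:: (x, bx); (z, bz); (y, by_)] -> b \in marked mr -> b < a)].
  by move: dA; rewrite Emk => /dec_catP[d1 /dec_catP[d2 d3 d23] d123].
move=> _ dr [lbr br].
(* Were all earlier marks above [y], the marked [x] could be replaced by the larger [y]. So the
   letter that moves into the place of [x] is at most [y]. *)
have notx : bx -> ~ (forall a, a \in marked ml -> y < a).
  move=> bx1 ya; move: nxz nxy; rewrite bx1 /= => /negPf bz0 /negPf by0.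
  rewrite bx1 bz0 by0 in Emk br; suff : y <= x by rewrite leqNgt xy.
  have xr b : b \in marked mr -> b < x by move=> ?; apply: br => //; rewrite inE.
  apply: (mark_replace RM Emk).
    rewrite E; apply: cat_subseq => //; rewrite -cat1s; apply: cat_subseq => //.
    by rewrite sub1seq !inE eqxx !orbT.
  apply/dec_catP; split=> // [|a b al].
    by apply/dec_consP; split=> // b /xr /ltn_trans; apply.
  by rewrite inE => /orP[/eqP->|/xr bx2]; [exact: ya | exact: ltn_trans bx2 (ltn_trans xy (ya _ al))].
(* Were all earlier marks above [z], an unmarked [z] could be added in front of the marked [y]. *)
have noty : by_ -> ~~ bz -> ~ (forall a, a \in marked ml -> z < a).
  move=> by1 /negPf bz0 za; move: nxy; rewrite by1 andbT => /negPf bx0.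
  rewrite bx0 bz0 by1 in Emk br; suff : size [:: z; y] <= size [:: y] by [].
  have yr b : b \in marked mr -> b < y by move=> ?; apply: br => //; rewrite inE.
  apply: (mark_not_longer RM Emk).
    rewrite E; apply: cat_subseq => //; apply: cat_subseq => //.
    exact: subseq_cons.
  apply/dec_catP; split=> // [|a b al].
    apply/dec_consP; split=> [|b]; first by apply/dec_consP; split.
    by rewrite inE => /orP[/eqP->//|/yr /ltn_trans]; apply.
  have za' := za _ al; rewrite /= !inE => /or3P[/eqP->//|/eqP->|/yr b_y].
    exact: ltn_trans yz za'.
  exact: ltn_trans b_y (ltn_trans yz za').
rewrite Emw; apply: shift_context.
  by rewrite !hold_cons; case: (bx) (bz) (by_) nxz nxy => [] [] [].
have [[A0 h0]|[A [h [Ah hh]]]] := hold_nilP ml.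
  rewrite h0; case: (bx) (bz) (by_) notx noty nxz nxy => [] [] [] //=.
  - by move=> _ /(_ isT isT)[]; rewrite A0.
  - by move=> *; apply: knuth_xzy3.
rewrite hh; have hl a : a \in marked ml -> h <= a.
  move: dl; rewrite Ah -cats1 => /dec_catP[_ _ lh].
  by rewrite mem_cat inE => /orP[/lh -/(_ h)|/eqP->//]; rewrite inE eqxx => /(_ isT)/ltnW.
have hA : h \in marked ml by rewrite Ah mem_rcons inE eqxx.
have hb b : b \in marked [:: (x, bx); (z, bz); (y, by_)] -> b < h.
  by move=> bb; apply: lbr => //; rewrite mem_cat bb.
case: (bx) (bz) (by_) notx noty nxz nxy hb => [] [] [] //= notx noty _ _ hb.
- apply: knuth_xzy3 => //.
  rewrite leqNgt; apply/negP => yh; apply: (notx isT) => a /hl; exact: leq_trans.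
- apply: knuth_xzy3; first exact: ltnW (ltn_trans xy yz).
  by apply: hb; rewrite inE eqxx.
- apply: knuth_xzy3; first exact: ltnW.
  by apply: (ltn_trans yz); apply: hb; rewrite inE eqxx.
- apply: knuth_xzy3.
    by apply/ltnW/(ltn_trans xy); apply: hb; rewrite inE eqxx.
  have hz : h != z.
    apply/eqP => hz; move: U; rewrite E cat_uniq => /and3P[_ /hasPn/(_ z)].
    rewrite !inE eqxx orbT => /(_ isT) /negP[]; rewrite -hz.
    exact: mem_subseq sl _ hA.
  rewrite ltn_neqAle hz leqNgt; apply/negP => zh.
  by apply: (noty isT isT) => a /hl; exact: leq_trans.
- by apply: knuth_xzy3.
Qed.

Lemma perm_yzx (l r : seq nat) x y z :
  perm_eq (l ++ [:: y; x; z] ++ r) (l ++ [:: y; z; x] ++ r).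
Proof. by rewrite perm_cat2l perm_cat2r; apply/permP => p /=; lia. Qed.

(** Here marks may have to jump: if [z] and [x] are both marked, they are no longer decreasing after
    the move, and [y] takes over the mark of [z]. The main work is to show that this smaller letter
    is still extremal in the new word. *)
Lemma rightmost_step_yzx l r x y z mw : x < y -> y <= z ->
  letters mw = l ++ [:: y; z; x] ++ r -> rightmost_mark mw ->
  exists2 mw', letters mw' = l ++ [:: y; x; z] ++ r /\ rightmost_mark mw' &
    knuth (shift [::] mw) (shift [::] mw').
Proof.
move=> xy yz0 E RM; have [U dA _] := RM.
have [ml [mr [by_ [bz [bx [Emw El Er]]]]]] := letters3 E.
have yz : y < z.
  by move: U; rewrite E => /uniq3[yz _ _]; rewrite ltn_neqAle yz.
have [zx yz' [yx xz' xy']] : [/\ (z == x) = false, (y == z) = false &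
   [/\ (y == x) = false, (x == z) = false & (x == y) = false]] by split; [lia|lia|split; lia].
have zy : (z == y) = false by rewrite eq_sym.
have Emk : marked mw = marked ml ++ marked [:: (y, by_); (z, bz); (x, bx)] ++ marked mr.
  by rewrite Emw !marked_cat.
have [dl] : [/\ dec (marked ml), dec (marked [:: (y, by_); (z, bz); (x, bx)]), dec (marked mr)
   & (forall a b, a \in marked ml ->
        b \in marked [:: (y, by_); (z, bz); (x, bx)] ++ marked mr -> b < a) /\
     (forall a b, a \in marked [:: (y, by_); (z, bz); (x, bx)] -> b \in marked mr -> b < a)].
  by move: dA; rewrite Emk => /dec_catP[d1 /dec_catP[d2 d3 d23] d123].
move=> d3 dr [lbr br].
have nyz : ~~ (by_ && bz).
  by move: d3; case: (bx) (bz) (by_) => [] [] []; rewrite /dec //=; lia.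
have sl : subseq (marked ml) l by rewrite -El marked_subseq.
have sr : subseq (marked mr) r by rewrite -Er marked_subseq.
have Ul : uniq l by move: U; rewrite E cat_uniq => /and3P[].
have Ulr a : a \in l -> a \notin [:: y; z; x] ++ r.
  move: U; rewrite E cat_uniq => /and3P[_ /hasPn H _] al; apply/negP => /H.
  by rewrite al.
have Umr a : a \in r -> a \notin [:: y; z; x].
  move: U; rewrite E cat_uniq => /and3P[_ _]; rewrite cat_uniq => /and3P[_ /hasPn H _] al.
  exact: H.
have nl a : a \in [:: y; z; x] -> a \notin l.
  by move=> a3; apply/negP => /Ulr; rewrite mem_cat a3.
have xnr : x \notin r by apply/negP => /Umr; rewrite !inE eqxx !orbT.
have znr : z \notin r by apply/negP => /Umr; rewrite !inE eqxx !orbT.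
have ynr : y \notin r by apply/negP => /Umr; rewrite !inE eqxx.
(* As before, some earlier mark must prevent [z] from replacing a marked [y] and, in [notx], prevent
   [y] from being added before a lone marked [x]. *)
have noty : by_ -> ~ (forall a, a \in marked ml -> z < a).
  move=> by1 za; move: nyz; rewrite by1 /= => /negPf bz0.
  rewrite bz0 by1 in Emk br; suff : z <= y by rewrite leqNgt yz.
  have Emk2 : marked mw = marked ml ++ y :: (marked [:: (x, bx)] ++ marked mr) by [].
  apply: (mark_replace RM Emk2).
    rewrite E; apply: cat_subseq => //; rewrite -cat_cons; apply: cat_subseq => //.
    by case: (bx); rewrite /= (eq_sym z) yz' eqxx /= ?eqxx.
  have d3' : dec (marked [:: (x, bx)] ++ marked mr).
    move: dA; rewrite Emk => /dec_catP[_ /dec_catP[_ _ _] _].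
    apply/dec_catP; split=> //; first by case: (bx).
    by move=> a b; case: (bx) br => br //; rewrite inE => /eqP-> bm; apply: br => //; rewrite !inE eqxx orbT.
  have yr b : b \in marked [:: (x, bx)] ++ marked mr -> b < y.
    rewrite mem_cat => /orP[|bm]; last by apply: br => //; rewrite inE eqxx.
    by case: (bx) => //; rewrite inE => /eqP->.
  apply/dec_catP; split=> // [|a b al].
    by apply/dec_consP; split=> // b /yr /ltn_trans; apply.
  rewrite inE => /orP[/eqP->|/yr b_y]; first exact: za.
  exact: ltn_trans b_y (ltn_trans yz (za _ al)).
have notx : bx -> ~~ by_ -> ~~ bz -> ~ (forall a, a \in marked ml -> y < a).
  move=> bx1 /negPf by0 /negPf bz0 ya.
  rewrite bx1 by0 bz0 in Emk br; suff : size [:: y; x] <= size [:: x] by [].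
  have xr b : b \in marked mr -> b < x by move=> ?; apply: br => //; rewrite inE.
  apply: (mark_not_longer RM Emk).
    rewrite E; apply: cat_subseq => //; apply: cat_subseq => //.
    by rewrite /= eqxx xz' eqxx.
  apply/dec_catP; split=> // [|a b al].
    apply/dec_consP; split=> [|b]; first by apply/dec_consP; split.
    by rewrite inE => /orP[/eqP->//|/xr /ltn_trans]; apply.
  have ya' := ya _ al; rewrite /= !inE => /or3P[/eqP->//|/eqP->|/xr b_x].
    exact: ltn_trans xy ya'.
  exact: ltn_trans b_x (ltn_trans xy ya').
pose zxm := bz && bx.
pose mw' := ml ++ [:: (y, zxm || by_); (x, bx); (z, bz && ~~ bx)] ++ mr.
have E' : letters mw' = l ++ [:: y; x; z] ++ r.
  by rewrite !letters_cat El Er.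
have Emk' : marked mw' = marked ml ++
    (if zxm then [:: y; x] else marked [:: (y, by_); (z, bz); (x, bx)]) ++ marked mr.
  rewrite !marked_cat /zxm; congr (_ ++ _ ++ _).
  by move: nyz; case: (bx) (bz) (by_) => [] [] [].
have d3' : dec (marked mw').
  move: dA; rewrite Emk Emk' /zxm; case: (bz) (bx) br lbr nyz => [] [] //.
  case: (by_) => //= br lbr _ _.
  apply/dec_catP; split=> //.
    apply/(dec_catP [:: y; x]); split=> //; first by rewrite /dec /= xy.
    move=> a b; rewrite !inE => /orP[]/eqP-> bm; last by apply: br => //; rewrite !inE eqxx orbT.
    by apply: (ltn_trans _ xy); apply: br => //; rewrite !inE eqxx orbT.
  move=> a b al; rewrite /= inE => /orP[/eqP->|].
    by apply: (ltn_trans yz); apply: lbr => //; rewrite inE eqxx.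
  by move=> bm; apply: lbr => //; rewrite /= inE bm orbT.
exists mw'.
  split=> //; split=> //.
    by rewrite E' (perm_uniq (perm_yzx _ _ _ _ _)) -E.
  have sz : size (marked mw') = size (marked mw).
    rewrite Emk Emk' /zxm !size_cat; case: (bz) (bx) nyz => [] [] //.
    by case: (by_).
  rewrite E' sz => b sb db.
  have sbE : subseq b (letters mw).
    move: sb db; rewrite E => /subseq_cat_split[b1 [b' [-> sb1 /subseq_cat_split[bm [b2 [-> sbm sb2]]]]]].
    case/dec_catP=> _ /dec_catP[dbm _ _] _.
    apply: cat_subseq => //; apply: cat_subseq => //.
    have [ma [mb [mc Ebm]]] := subseq3 sbm.
    move: dbm; rewrite Ebm; case: ma mb mc {Ebm} => [] [] [] //=;
      rewrite /dec /= ?zx /= ?zy /= ?yx /= ?yz' /= ?xz' /= ?xy' /= ?eqxx /= ?xz' ?eqxx //;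
      clear -xy yz; lia.
  have [_ _ /(_ _ sbE db)[le1 le2]] := RM; split=> // sbm.
  have {le1} le2 := le2 sbm.
  have [zxE|zxN] := boolP zxm; last by rewrite Emk' (negPf zxN) -Emk.
  have [Ez Ex] : bz = true /\ bx = true by move: zxE => /andP[].
  have by0 : by_ = false by move: nyz; rewrite Ez andbT => /negPf.
  rewrite Emk' zxE; rewrite Ez Ex by0 in Emk br lbr.
  have xr t : t \in marked mr -> t < x by move=> ?; apply: br; rewrite // !inE eqxx orbT.
  have zA t : t \in marked ml -> z < t by move=> ?; apply: lbr; rewrite //= inE eqxx.
  have dxr : dec (x :: marked mr) by apply/dec_consP; split.
  have dyxr : dec (y :: x :: marked mr).
    apply/dec_consP; split=> // t; rewrite inE => /orP[/eqP->//|/xr tx].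
    exact: ltn_trans tx xy.
  move: sbm; rewrite Emk !size_cat /= => sbm.
  have [b1 [c [d [b2 [Eb sb1]]]]] : exists b1 c d b2,
      b = b1 ++ c :: d :: b2 /\ size b1 = size (marked ml).
    have : size (drop (size (marked ml)) b) = (size (marked mr)).+2.
      by rewrite size_drop sbm addKn.
    case Ed : (drop _ b) => [|c [|d b2]] //= _.
    exists (take (size (marked ml)) b), c, d, b2; rewrite -Ed cat_take_drop; split=> //.
    by rewrite size_takel // sbm leq_addr.
  subst b; move: le2; rewrite Emk !all2_cat_eqsize //= => /and4P[le_b1 cz dx le_b2].
  (* Suppose the letter [c] compared with [y] exceeds it. In each case a decreasing subword that is
     too long arises: if [c] is [z], replace it by [y x]; if [c] is in [l], follow it by [y x] and
     the later marks; if [c] is in [r], put the earlier marks and [z] before it. *)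
  rewrite le_b1 dx le_b2 !andbT /= leqNgt; apply/negP => yc.
  have sb2 : size b2 = size (marked mr) by move: sbm => /eqP; rewrite size_cat /= sb1 eqn_add2l => /eqP[].
  have [db1 /dec_consP[/dec_consP[db2 d_b2] c_b2] b1c] := dec_catP _ _ db.
  have cd : d < c by apply: c_b2; rewrite inE eqxx.
  have too_long s : subseq s (letters mw) -> dec s ->
      size s = (size (marked mw)).+1 -> False.
    by move=> /(mark_max RM) H /H H1 H2; rewrite H2 ltnn in H1.
  have Umw' : uniq (l ++ [:: y; x; z] ++ r).
    by rewrite (perm_uniq (perm_yzx _ _ _ _ _)) -E.
  have [cz'|cnz] := eqVneq c z.
    subst c; move: sb.
    have El' : l ++ [:: y; x; z] ++ r = (l ++ [:: y; x]) ++ z :: r by rewrite -catA.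
    rewrite El' uniq_subseq_pivot -?El' // => /andP[/subseq_cat_split[u [v [Eb1 ul vyx]]] b2r].
    have Ev : v = [::].
      case: v vyx Eb1 => // t v vyx Eb1.
      have : t \in [:: y; x] by apply: (mem_subseq vyx); rewrite inE eqxx.
      have zt : z < t by apply: b1c; rewrite ?Eb1 ?mem_cat ?inE ?eqxx ?orbT.
      by rewrite !inE => /orP[]/eqP tE; move: zt; rewrite tE; clear -xy yz; lia.
    move: Eb1; rewrite Ev cats0 => Eb1; subst u.
    have dx' : d < x.
      rewrite ltn_neqAle dx andbT; apply/eqP => dxE.
      by move: xnr; rewrite -dxE (mem_subseq b2r) // inE eqxx.
    apply: (too_long (b1 ++ [:: y; x] ++ d :: b2)).
    - rewrite E; apply: cat_subseq => //; apply: cat_subseq => //.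
      by rewrite /= eqxx xz' eqxx.
    - have xdb t : t \in d :: b2 -> t < x.
        by rewrite inE => /orP[/eqP->//|/d_b2 td]; apply: ltn_trans dx'.
      apply/dec_catP; split=> //.
        apply/dec_consP; split; first by apply/dec_consP; split=> //; apply/dec_consP.
        by move=> t; rewrite inE => /orP[/eqP->//|/xdb tx]; apply: ltn_trans xy.
      move=> s t /b1c bz'; have zs := bz' z; move: zs; rewrite inE eqxx => /(_ isT) zs.
      rewrite /= inE => /orP[/eqP->|]; first exact: ltn_trans yz zs.
      rewrite inE => /orP[/eqP->|/xdb tx]; first exact: ltn_trans xy (ltn_trans yz zs).
      exact: ltn_trans tx (ltn_trans xy (ltn_trans yz zs)).
    - by rewrite Emk !size_cat /= sb1 sb2 !addnS.
  have {}cz : c < z by rewrite ltn_neqAle cnz.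
  have : c \in l ++ [:: y; x; z] ++ r.
    by apply: (mem_subseq sb); rewrite mem_cat inE eqxx orbT.
  rewrite mem_cat => /orP[cl|].
    have [l1 [l2 El12]] : exists l1 l2, l = l1 ++ c :: l2.
      by case/splitPr: cl => l1 l2; exists l1, l2.
    move: sb Umw'; rewrite {1 2}El12 -catA => sb Umw'.
    move: sb; rewrite (uniq_subseq_pivot _ _ Umw') => /andP[sb1' _].
    apply: (too_long ((b1 ++ [:: c]) ++ [:: y; x] ++ marked mr)).
    - rewrite E; apply: cat_subseq; first by rewrite El12 cat_subseq // /= eqxx sub0seq.
      by apply: cat_subseq; rewrite //= eqxx xz' eqxx.
    - have yxr t : t \in [:: y; x] ++ marked mr -> t < c.
        rewrite /= !inE => /or3P[/eqP->//|/eqP->|/xr tx]; first exact: ltn_trans xy yc.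
        exact: ltn_trans tx (ltn_trans xy yc).
      apply/dec_catP; split=> //.
        by apply/dec_catP; split=> // s t /b1c bs; rewrite inE => /eqP->; apply: bs; rewrite inE eqxx.
      move=> s t; rewrite mem_cat inE => /orP[/b1c bs|/eqP->] /yxr // tc.
      by apply: (ltn_trans tc); apply: bs; rewrite inE eqxx.
    - by rewrite Emk !size_cat /= sb1 addn1 addSn !addnS.
  rewrite mem_cat => /orP[|cr].
    by rewrite !inE => /or3P[]/eqP cE; move: yc cz; rewrite cE; clear -xy yz; lia.
  have [r1 [r2 Er12]] : exists r1 r2, r = r1 ++ c :: r2.
    by case/splitPr: cr => r1 r2; exists r1, r2.
  move: sb Umw'; rewrite {1 2}Er12 !catA => sb Umw'.
  move: sb; rewrite (uniq_subseq_pivot _ _ Umw') => /andP[_ sb2'].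
  apply: (too_long (marked ml ++ [:: z] ++ c :: d :: b2)).
  - rewrite E; apply: cat_subseq => //; apply: cat_subseq.
      by rewrite sub1seq !inE eqxx orbT.
    rewrite Er12; apply: subseq_trans (suffix_subseq _ _).
    by rewrite /= eqxx.
  - have zc t : t \in c :: d :: b2 -> t < z.
      by rewrite inE => /orP[/eqP->//|/c_b2 tc]; apply: ltn_trans cz.
    apply/dec_catP; split=> //.
      by apply/dec_consP; split=> //; apply/dec_consP; split=> //; apply/dec_consP.
    move=> s t /zA zs; rewrite /= inE => /orP[/eqP->//|/zc tz].
    exact: ltn_trans zs.
  - by rewrite Emk !size_cat /= sb2 !addnS.
rewrite Emw; apply: shift_context.
  by rewrite !hold_cons /zxm; case: (bx) (bz) (by_) nyz => [] [] [].
rewrite /zxm; have [[A0 h0]|[A [h [Ah hh]]]] := hold_nilP ml.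
  rewrite h0; case: (by_) (bz) (bx) notx noty nyz => [] [] [] //= notx noty _.
  - by case: (noty isT); rewrite A0.
  - by case: (noty isT); rewrite A0.
  - by apply: knuth_yzx3.
rewrite hh; have hl a : a \in marked ml -> h <= a.
  move: dl; rewrite Ah -cats1 => /dec_catP[_ _ lh].
  by rewrite mem_cat inE => /orP[/lh -/(_ h)|/eqP->//]; rewrite inE eqxx => /(_ isT)/ltnW.
have hA : h \in marked ml by rewrite Ah mem_rcons inE eqxx.
have hb b : b \in marked [:: (y, by_); (z, bz); (x, bx)] -> b < h.
  by move=> bb; apply: lbr => //; rewrite mem_cat bb.
have hz : h <= z -> h < z.
  rewrite leq_eqVlt => /orP[/eqP hz|//]; have := nl z.
  by rewrite !inE eqxx orbT -hz (mem_subseq sl hA) => /(_ isT).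
have hy : h <= y -> h < y.
  rewrite leq_eqVlt => /orP[/eqP hy|//]; have := nl y.
  by rewrite !inE eqxx -hy (mem_subseq sl hA) => /(_ isT).
have {noty} noty : by_ -> h <= z.
  by move=> /noty nz; rewrite leqNgt; apply/negP => zh; apply: nz => a /hl; apply: leq_trans.
have {notx} notx : bx -> ~~ by_ -> ~~ bz -> h < y.
  move=> bx1 by0 bz0; apply: hy; rewrite leqNgt; apply/negP => yh.
  by apply: (notx bx1 by0 bz0) => a /hl; apply: leq_trans.
case: (by_) (bz) (bx) notx noty nyz hb => [] [] [] //= notx noty _ hb.
- apply: knuth_yzx3; last exact: noty.
  by apply: hb; rewrite inE eqxx.
- apply: knuth_yzx3; last exact: noty.
  by apply: (ltn_trans xy); apply: hb; rewrite inE eqxx.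
- apply: knuth_xzy3 => //.
  by apply: hb; rewrite inE eqxx.
- apply: knuth_yzx3 => //.
  by apply: ltnW; apply: (ltn_trans yz); apply: hb; rewrite inE eqxx.
- by apply: knuth_yzx3 => //; apply: notx.
- by apply: knuth_yzx3.
Qed.

(** * Tableaux, and decreasing subwords of their reading words *)

Fixpoint dominates (R R2 : seq nat) : bool :=
  match R, R2 with
  | _, [::] => true
  | [::], _ => false
  | a :: R', b :: R2' => (a < b) && dominates R' R2'
  end.

Lemma dominates0 R : dominates R [::].
Proof. by case: R. Qed.

Lemma dominates_insl x R R2 : dominates R R2 -> dominates (ins x R).1 R2.
Proof.
elim: R R2 => [|a R IH] [|b R2] //=; rewrite ?dominates0 //.
case/andP=> ab d; case: ltnP => xa /=; first by rewrite (ltn_trans xa ab).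
by rewrite ab IH.
Qed.

(** A bumped letter lands weakly to the left of the column it came from, hence below a smaller
    letter. *)
Lemma dominates_ins x R R2 : dominates R R2 ->
  dominates (ins x R).1 (run R2 (ins x R).2).1.
Proof.
elim: R R2 => [|a R IH] [|b R2] //= d.
- case: ltnP => xa /=; first by rewrite xa dominates0.
  case: (ins_bumped x R) => [->|[y by_]] //; rewrite by_ /= dominates0 andbT.
  have [xy _] : x < y /\ y \in R by apply: ins_bumped_gt; rewrite by_ inE.
  exact: leq_ltn_trans xy.
case/andP: d => ab d; case: ltnP => xa /=; first by rewrite ab /= xa.
case: (ins_bumped x R) => [by_|[y by_]]; rewrite by_ /=.
  by rewrite ab dominates_insl.
have [xy _] : x < y /\ y \in R by apply: ins_bumped_gt; rewrite by_ inE.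
case: ltnP => yb /=; first by rewrite (leq_ltn_trans xa xy) dominates_insl.
by rewrite ab; move: (IH _ d); rewrite by_.
Qed.

Lemma dominates_run w R R2 : dominates R R2 ->
  dominates (run R w).1 (run R2 (run R w).2).1.
Proof.
elim: w R R2 => [|x w IH] R R2 //= d.
by rewrite run_cat /=; apply/IH/dominates_ins.
Qed.

Definition tableau (T : seq (seq nat)) :=
  [&& sorted dominates T, all (sorted leq) T & [::] \notin T].

Lemma schensted_tableau w : tableau (schensted w).
Proof.
have [k] := ubnP (size w); elim: k w => // k IH [|x w] // wk.
rewrite schenstedE //; set c := (run _ _).2.
have : size c < k.
  by have := size_run [::] (x :: w); have := size_run_gt0 x w [::]; move: wk; rewrite /c /=; lia.
have Rne : (run [::] (x :: w)).1 != [::].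
  by have := size_run_gt0 x w [::]; case: (run _ _).1.
move=> /IH /and3P[sT aT neT]; apply/and3P; split.
- move: sT (dominates_run (x :: w) (dominates0 [::])); rewrite -/c.
  move: (run [::] (x :: w)).1 => R; case: (c) => // y c'.
  by rewrite schenstedE //; case: (run [::] (y :: c')) => R2 c2 /= -> ->.
- by rewrite /= aT andbT; apply: run_sorted.
- by rewrite inE negb_or eq_sym Rne.
Qed.

Lemma dec_sorted_size b R : sorted leq R -> subseq b R -> dec b -> size b <= 1.
Proof.
move=> sR /(subseq_sorted leq_trans)/(_ sR).
by case: b => [|x [|y b]] //= /andP[xy _]; rewrite /dec /=; lia.
Qed.

Lemma dec_flatten_size b rs : all (sorted leq) rs ->
  subseq b (flatten rs) -> dec b -> size b <= size rs.
Proof.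
elim: rs b => [|R rs IH] b; first by move=> _; rewrite subseq0 => /eqP->.
rewrite /=.
move=> /andP[sR srs] /subseq_cat_split[b1 [b2 [-> s1 s2]]] /dec_catP[d1 d2 _].
rewrite size_cat -add1n; apply: leq_add; last exact: IH.
exact: dec_sorted_size sR s1 d1.
Qed.

Lemma heads_subseq rs : [::] \notin rs -> subseq (map (head 0) rs) (flatten rs).
Proof.
elim: rs => //= -[|a R] rs IH; rewrite inE //= => ne; rewrite eqxx.
by apply: subseq_trans (suffix_subseq _ _); apply: IH.
Qed.

Lemma heads_dec T : sorted dominates T -> [::] \notin T ->
  dec (map (head 0) (rev T)).
Proof.
move=> sT neT; rewrite /dec map_rev -(sorted_pairwise (rev_trans ltn_trans)) rev_sorted.
case: T sT neT => // R T; elim: T R => //= R2 T IH R /andP[d pT].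
rewrite !inE !negb_or => /and3P[neR neR2 neT]; apply/andP; split.
  by case: R R2 neR neR2 d {IH pT} => [|a R] [|b R2] //= _ _ /andP[].
by apply: IH; rewrite ?inE ?negb_or ?neR2.
Qed.

Definition unmarked (s : seq nat) : mword := [seq (x, false) | x <- s].

Lemma letters_unmarked s : letters (unmarked s) = s.
Proof. by elim: s => //= x s ->. Qed.

Lemma marked_unmarked s : marked (unmarked s) = [::].
Proof. by elim: s. Qed.

Lemma shout_unmarked h s m : shout h (unmarked s ++ m) = s ++ shout h m.
Proof. by elim: s => //= x s ->. Qed.

Lemma shift_unmarked h s m : shift h (unmarked s ++ m) = s ++ shift h m.
Proof. by rewrite /shift shout_unmarked hold_cat {2}/hold marked_unmarked catA. Qed.

Lemma shift_cons h a m : shift h ((a, true) :: m) = h ++ shift [:: a] m.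
Proof. by rewrite /shift hold_cons /= catA. Qed.

Lemma marked_nil m : marked m = [::] -> m = unmarked (letters m).
Proof. by elim: m => //= -[x []] // m IH /= /IH{1}->. Qed.

Lemma marked_cons m a s : marked m = a :: s ->
  exists p m', m = unmarked p ++ (a, true) :: m' /\ marked m' = s.
Proof.
elim: m => //= -[x []] m IH /=; first by case=> -> <-; exists [::], m.
by case/IH=> p [m' [-> <-]]; exists (x :: p), m'.
Qed.

Lemma marked1 m a : marked m = [:: a] ->
  exists p q, m = unmarked p ++ (a, true) :: unmarked q.
Proof.
by case/marked_cons=> p [m' [-> /marked_nil->]]; exists p, (letters m').
Qed.

Lemma ins_middle p a h q : all (fun x => x <= a) p -> a < h ->
  ins a (p ++ h :: q) = (p ++ a :: q, [:: h]).
Proof.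
by elim: p => [|x p IH] /= => [_ ->//|/andP[xa /IH{}IH] /IH ->]; rewrite ltnNge xa.
Qed.

(** From right to left this is the row insertion of [a] into [p ++ h :: q], which bumps [h]. *)
Lemma row_slide p a h q : sorted leq (p ++ a :: q) -> a < h ->
  all (fun x => h <= x) q -> knuth (h :: p ++ a :: q) (p ++ h :: rcons q a).
Proof.
move=> s ah hq.
have [sp pa] : sorted leq p /\ all (fun x => x <= a) p.
  move: s; rewrite (sorted_pairwise leq_trans) pairwise_cat -(sorted_pairwise leq_trans).
  case/and3P=> /allrelP pa ? _; split=> //; apply/allP => x xp.
  by apply: pa; rewrite ?inE ?eqxx.
have sq : sorted leq (p ++ h :: q).
  move: s; rewrite !(sorted_pairwise leq_trans) !pairwise_cat /=.
  case/and3P=> /allrelP pa' -> /andP[_ ->]; rewrite hq !andbT.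
  apply/allrelP => x y xp; rewrite inE => /orP[/eqP->|yq].
    by apply: leq_trans (ltnW ah); apply: pa' => //; rewrite inE eqxx.
  by apply: pa' => //; rewrite inE yq orbT.
have := ins_knuth_red a sq; rewrite ins_middle // rcons_cat /= => /knuth_red_knuth.
exact: knuth_sym.
Qed.

Lemma letters_cat_inv mw u v : letters mw = u ++ v ->
  exists m1 m2, [/\ mw = m1 ++ m2, letters m1 = u & letters m2 = v].
Proof. exact: map_cat_inv. Qed.

(** A decreasing subword meets each row at most once, so having as many marks as rows forces one
    mark in every row. A letter after [a] in [R] that is still below [h] could replace [a], against
    extremality. The list [h] carries the mark of the preceding row and is empty for the first. *)
Lemma greedy_row h R rs mw : sorted leq R -> all (sorted leq) rs ->
    letters mw = R ++ flatten rs -> uniq (letters mw) ->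
    size (marked mw) = (size rs).+1 -> dec (marked mw) ->
  (forall b, subseq b (letters mw) -> dec (h ++ b) ->
     size b = (size rs).+1 -> all2 leq b (marked mw)) ->
  exists p a q m', [/\ mw = unmarked p ++ (a, true) :: unmarked q ++ m',
    R = p ++ a :: q, letters m' = flatten rs, size (marked m') = size rs &
    dec (h ++ marked mw) -> all (fun x => ~~ all (fun y => x < y) h) q].
Proof.
move=> sR srs /letters_cat_inv[m1 [m' [E1 El1 El2]]] U sz d best.
have [s1 s2] : size (marked m1) <= 1 /\ size (marked m') <= size rs.
  move: d; rewrite E1 marked_cat => /dec_catP[d1 d2 _]; split.
    by apply: dec_sorted_size sR _ d1; rewrite -El1; apply: marked_subseq.
  by apply: dec_flatten_size srs _ d2; rewrite -El2; apply: marked_subseq.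
move: sz; rewrite E1 marked_cat size_cat => sz.
have [a Ea] : exists a, marked m1 = [:: a].
  by case: (marked m1) s1 sz => [|a []] // _ /=; [lia | exists a].
have [p [q Em1]] := marked1 Ea.
have ER : R = p ++ a :: q.
  by rewrite -El1 Em1 letters_cat /= -/(letters _) !letters_unmarked.
exists p, a, q, m'; split=> //; first by rewrite Em1 -catA.
  by move: sz; rewrite Ea /= add1n => -[].
rewrite Ea /= => dh; apply/allP => e eq; apply/negP => /allP eh.
have ae : a < e.
  rewrite ltn_neqAle; apply/andP; split.
    apply/eqP => ae; move: U; rewrite E1 letters_cat cat_uniq El1 ER => /and3P[+ _ _].
    by rewrite cat_uniq /= ae eq !andbF.
  move: sR; rewrite ER (sorted_pairwise leq_trans) pairwise_cat /=.
  by case/and4P=> _ _ /allP/(_ _ eq).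
have [dh1 /dec_consP[dm' am'] hm'] := dec_catP _ _ dh.
have : all2 leq (e :: marked m') (marked mw).
  apply: best.
  - rewrite E1 letters_cat -cat1s; apply: cat_subseq; last exact: marked_subseq.
    by rewrite sub1seq El1 ER mem_cat inE eq !orbT.
  - apply/dec_catP; split=> //.
      by apply/dec_consP; split=> // y /am' ya; apply: ltn_trans ae.
    move=> x y xh; rewrite inE => /orP[/eqP->|ym]; first exact: eh.
    by apply: hm' => //; rewrite inE ym orbT.
  - by move: sz; rewrite Ea.
by rewrite E1 marked_cat Ea /= leqNgt ae.
Qed.

(** Row by row: [h] takes the place of the mark [a], which is expelled to the end of its row and
    plays the role of [h] for the next one. *)
Lemma greedy_shift rs mw h : all (sorted leq) rs ->
    letters mw = flatten rs -> uniq (letters mw) -> size (marked mw) = size rs ->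
    dec (h :: marked mw) ->
  (forall b, subseq b (letters mw) -> dec (h :: b) ->
     size b = size rs -> all2 leq b (marked mw)) ->
  knuth (h :: letters mw) (shift [:: h] mw).
Proof.
elim: rs mw h => [|R rs IH] mw h.
  by case: mw.
move=> /= /andP[sR srs] El U sz d best.
have dm : dec (marked mw) by move: d => /dec_consP[].
have [p [a [q [m' [E ER El' sz' hq]]]]] :=
  greedy_row (h := [:: h]) sR srs El U sz dm best.
have Emk : marked mw = a :: marked m'.
  by rewrite E -cat1s !marked_cat !marked_unmarked.
have ah : a < h by move: d => /dec_consP[_]; apply; rewrite Emk inE eqxx.
have {}hq : all (fun x => h <= x) q.
  by move: (hq d); apply: sub_all => x /=; rewrite andbT -leqNgt.
have -> : h :: letters mw = (h :: p ++ a :: q) ++ letters m'.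
  by rewrite El El' ER /= -catA.
have -> : shift [:: h] mw = (p ++ h :: q) ++ shift [:: a] m'.
  by rewrite E shift_unmarked shift_cons shift_unmarked /= -catA.
apply: (@knuth_trans ((p ++ h :: rcons q a) ++ letters m')).
  rewrite -[_ ++ letters m']cat0s -[(p ++ h :: rcons _ _) ++ _]cat0s.
  by apply: (knuth_context [::]); apply: row_slide => //; rewrite -ER.
rewrite -cats1 -!catA /= -catA.
suff km : knuth (a :: letters m') (shift [:: a] m').
  have := knuth_context (p ++ h :: q) [::] km.
  by rewrite !cats0 -!catA.
apply: IH => //.
- move: U; rewrite E -cat1s !letters_cat !letters_unmarked !cat_uniq.
  by move=> /and3P[_ _ /and3P[_ _ /and3P[]]].
- by rewrite -Emk.
move=> b sb db szb; suff : all2 leq (a :: b) (marked mw) by rewrite Emk /= leqnn.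
apply: best.
- rewrite El -El' ER -catA /=; apply: subseq_trans (suffix_subseq _ _).
  by rewrite /= eqxx; apply: subseq_trans sb _; apply: suffix_subseq.
- apply/dec_consP; split=> // y; rewrite inE => /orP[/eqP->//|yb].
  by move: db => /dec_consP[_ /(_ _ yb) ya]; apply: ltn_trans ah.
- by rewrite /= szb.
Qed.

(** The step where the tableau enters: in the reading word of a tableau the
    rightmost decreasing subword is obtained greedily, one letter per row. *)
Lemma shift_rowword T mw : tableau T -> letters mw = rowword T ->
  rightmost_mark mw -> knuth (letters mw) (shift [::] mw).
Proof.
move=> /and3P[dT sT neT] El [U d best].
have srT : all (sorted leq) (rev T) by rewrite all_rev.
have sz : size (marked mw) = size (rev T).
  apply/eqP; rewrite eqn_leq (dec_flatten_size srT _ d) -?[flatten _]El ?marked_subseq //=.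
  have [] := best (map (head 0) (rev T)); rewrite ?size_map //.
    by rewrite El; apply: heads_subseq; rewrite mem_rev.
  exact: heads_dec.
move: El sz srT; rewrite /rowword; case: (rev T) => [|R rs] El sz.
  by case: (mw) El.
move=> /= /andP[sR srs].
have [|p [a [q [m' [E ER El' sz' hq]]]]] := greedy_row (h := [::]) sR srs El U sz d.
  by move=> b sb db szb; apply: (best b sb db).2; rewrite szb sz.
(* Before the first row there is no mark to stay below, so any letter after [a] would be a better
   choice; the mark is the last letter of the bottom row. *)
have q0 : q = [::] by case: (q) (hq d).
subst q; rewrite E /= in U d best sz *.
rewrite shift_unmarked shift_cons /= letters_cat letters_unmarked /= -/(letters m').
have := @greedy_shift rs m' a srs El'.
have Emk : marked mw = a :: marked m' by rewrite E marked_cat marked_unmarked.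
rewrite -Emk => gs.
suff km : knuth (a :: letters m') (shift [:: a] m').
  by have := knuth_context p [::] km; rewrite !cats0.
apply: gs => //.
- move: U; rewrite -cat1s !letters_cat !letters_unmarked !cat_uniq.
  by move=> /and3P[_ _ /and3P[_ _]].
- by move: d; rewrite Emk marked_cat marked_unmarked.
move=> b sb db szb.
suff : all2 leq (a :: b) (marked mw) by rewrite Emk /= leqnn.
rewrite E; apply: (best (a :: b) _ _).2 => //.
- rewrite letters_cat letters_unmarked; apply: subseq_trans (suffix_subseq _ _).
  by rewrite /= eqxx.
- by rewrite /= szb marked_cat marked_unmarked /= -/(marked m') sz'.
Qed.

Lemma knuth_shift mw : rightmost_mark mw -> knuth (letters mw) (shift [::] mw).
Proof.
move=> RM; have tT := schensted_tableau (letters mw).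
have := schensted_knuth_red (letters mw).
move: (schensted _) tT (erefl (letters mw)) => T tT.
move: {1 3}(letters mw) => u Eu red; move Ev: (rowword T) red => v red.
elim: red mw RM Eu Ev => {u v} [u|u v w uv _ IH] mw RM Eu Ev.
  by apply: (shift_rowword tT) => //; rewrite Ev.
have [mw' [Emw' RM'] kn] : exists2 mw',
    letters mw' = v /\ rightmost_mark mw' & knuth (shift [::] mw) (shift [::] mw').
  case: uv Eu => l r x y z H1 H2 Eu.
    exact: rightmost_step_yzx (esym Eu) RM.
  exact: rightmost_step_xzy (esym Eu) RM.
have := IH mw' RM' (esym Emw') Ev; rewrite Emw' -Eu => kn'.
exact: knuth_trans (knuth_of_step uv) (knuth_trans kn' (knuth_sym kn)).
Qed.

(** * The length of the longest decreasing subword *)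

Lemma dec_swap_block (bm bm' u v : seq nat) :
  dec (u ++ bm ++ v) -> dec bm' ->
  (forall b, b \in bm' -> exists2 c, c \in bm & b <= c) ->
  (forall b, b \in bm' -> exists2 c, c \in bm & c <= b) ->
  dec (u ++ bm' ++ v).
Proof.
move=> /dec_catP[du /dec_catP[_ dv bv] ubv] dbm' up low.
apply/dec_catP; split=> //.
  apply/dec_catP; split=> // x y /low[c cb cx] yv.
  exact: leq_trans (bv _ _ cb yv) cx.
move=> x y xu; rewrite mem_cat => /orP[/up[c cb yc]|yv].
  by apply: leq_ltn_trans yc _; apply: ubv; rewrite // mem_cat cb.
by apply: ubv; rewrite // mem_cat yv orbT.
Qed.

Definition has_dec (v : seq nat) m := exists b, [/\ subseq b v, dec b & size b = m].

(** A block may be exchanged for one whose letters are squeezed between letters of the old block: it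
    still fits between the same neighbours. *)
Lemma has_dec_block (l r s s' : seq nat) m :
  (forall b, subseq b s -> dec b -> exists b', [/\ subseq b' s', dec b',
      size b' = size b,
      (forall x, x \in b' -> exists2 c, c \in b & x <= c) &
      (forall x, x \in b' -> exists2 c, c \in b & c <= x)]) ->
  has_dec (l ++ s ++ r) m -> has_dec (l ++ s' ++ r) m.
Proof.
move=> H [b [/subseq_cat_split[u [b1 [-> ul /subseq_cat_split[bm [v [-> sm vr]]]]]] db <-]].
have [_ /dec_catP[dbm _ _] _] := dec_catP _ _ db.
have [b' [sb' db' szb' up low]] := H bm sm dbm.
exists (u ++ b' ++ v); split; last by rewrite !size_cat szb'.
  by apply: cat_subseq => //; apply: cat_subseq.
exact: dec_swap_block db db' up low.
Qed.

Lemma mem_dominated (b b' : seq nat) : (forall x, x \in b' -> x \in b) ->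
  (forall x, x \in b' -> exists2 c, c \in b & x <= c) /\
  (forall x, x \in b' -> exists2 c, c \in b & c <= x).
Proof. by move=> H; split=> x /H; exists x. Qed.

Lemma dec_pair a b : dec [:: a; b] = (b < a).
Proof. by rewrite /dec /= !andbT. Qed.

Lemma dec_subseq3 a b c s : subseq s [:: a; b; c] -> dec s ->
  [\/ exists2 t, s = [::] \/ s = [:: t] & t \in [:: a; b; c],
      s = [:: a; b] /\ b < a, s = [:: a; c] /\ c < a |
      c < b /\ (s = [:: b; c] \/ b < a)].
Proof.
case/subseq3=> ma [mb [mc ->]]; case: ma mb mc => [] [] [] ds.
- constructor 4; move: ds; rewrite /dec /=; lia.
- by constructor 2; move: ds; rewrite dec_pair.
- by constructor 3; move: ds; rewrite dec_pair.
- by constructor 1; exists a; [right | rewrite inE eqxx].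
- by constructor 4; move: ds; rewrite dec_pair => ->; split=> //; left.
- by constructor 1; exists b; [right | rewrite !inE eqxx orbT].
- by constructor 1; exists c; [right | rewrite !inE eqxx !orbT].
- by constructor 1; exists a; [left | rewrite inE eqxx].
Qed.

Lemma has_dec_step u v m : knuth_step u v -> has_dec u m <-> has_dec v m.
Proof.
have same (s b : seq nat) : subseq b s -> dec b -> exists b', [/\ subseq b' s, dec b',
      size b' = size b,
      (forall x, x \in b' -> exists2 c, c \in b & x <= c) &
      (forall x, x \in b' -> exists2 c, c \in b & c <= x)].
  move=> sb db; exists b; have [//|H1 H2] := @mem_dominated b b; by split.
have mid (a b c : nat) : subseq [:: a; c] [:: a; b; c].
  by rewrite /= eqxx; case: ifP; rewrite //= eqxx.
have left_ (a b c : nat) : subseq [:: a; b] [:: a; b; c] by rewrite /= !eqxx.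
have small (t : nat) (s s' b : seq nat) : b = [::] \/ b = [:: t] -> t \in s ->
    (forall x, x \in s -> x \in s') -> subseq b s'.
  by case=> -> ts H; rewrite ?sub0seq // sub1seq; apply: H.
case=> l r x y z H1 H2; split; apply: has_dec_block => b sb db;
  have [[t bE t3]|[bE lt]|[bE lt]|[lt bE]] := dec_subseq3 sb db;
  try (by apply: same => //; apply: small bE t3 _ => ?; rewrite !inE orbCA orbC -?orbA);
  try (by exfalso; clear -H1 H2 lt; lia).
- by apply: same => //; rewrite bE left_.
- case: bE => [->|]; last by rewrite ltnNge H2.
  exists [:: y; x]; rewrite dec_pair H1 left_; split=> // t.
    by rewrite !inE => /orP[]/eqP->; [exists z | exists x]; rewrite ?inE ?eqxx ?orbT.
  by rewrite !inE => /orP[]/eqP->; exists x; rewrite ?inE ?eqxx ?orbT // ltnW.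
- by apply: same => //; rewrite bE mid.
- case: bE => [->|zx]; last by exfalso; clear -zx H1 H2; lia.
  by apply: same; rewrite ?mid ?dec_pair.
- rewrite bE; exists [:: z; y]; rewrite dec_pair H2 subseq_cons; split=> // t.
    by rewrite !inE => /orP[]/eqP->; exists z; rewrite ?inE ?eqxx ?orbT // ltnW.
  by rewrite !inE => /orP[]/eqP->; [exists z | exists x]; rewrite ?inE ?eqxx ?orbT.
- by apply: same => //; rewrite bE subseq_cons.
Qed.

(** With the next lemma this is Schensted's theorem for decreasing subwords: the first column of a
    tableau is decreasing in its reading word, no decreasing subword meets a row twice, and
    attainable lengths are invariant under Knuth moves. *)
Lemma has_dec_schensted v : has_dec v (size (schensted v)).
Proof.
have := schensted_knuth_red v; have /and3P[dT _ neT] := schensted_tableau v.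
move: (schensted v) dT neT => T dT neT; move Eu: (rowword T) => u red.
elim: red Eu => {v u} [v|v u w /has_dec_step vu _ IH] Eu; last exact/vu/IH.
exists (map (head 0) (rev T)); rewrite size_map size_rev; split=> //.
  by rewrite -Eu; apply: heads_subseq; rewrite mem_rev.
exact: heads_dec.
Qed.

Lemma has_dec_leq_schensted v m : has_dec v m -> m <= size (schensted v).
Proof.
have := schensted_knuth_red v; have /and3P[_ sT _] := schensted_tableau v.
move: (schensted v) sT => T sT; move Eu: (rowword T) => u red.
elim: red Eu => {v u} [v|v u w /has_dec_step vu _ IH] Eu; last by move=> /vu/(IH Eu).
case=> b [sb db <-]; rewrite -(size_rev T); apply: dec_flatten_size db.
  by rewrite all_rev.
by rewrite -/(rowword T) Eu.
Qed.

(** * Shapes of insertion tableaux and their symmetries *)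

Definition ins_shape (w : seq nat) (r : nat) := size (nth [::] (schensted w) r).

Lemma shape_run0 w : ins_shape w 0 = size (run [::] w).1.
Proof. by case: w => // x w; rewrite /ins_shape schenstedE. Qed.

Lemma shape_runS w r : ins_shape w r.+1 = ins_shape (run [::] w).2 r.
Proof. by case: w => [|x w]; rewrite /ins_shape ?nth_nil // schenstedE. Qed.

Lemma run_rcons w x : run [::] (rcons w x) =
  ((ins x (run [::] w).1).1, (run [::] w).2 ++ (ins x (run [::] w).1).2).
Proof. by rewrite -cats1 run_cat /= cats0. Qed.

Lemma size_bumped x w : size (run [::] (x :: w)).2 <= size w.
Proof.
have := size_run [::] (x :: w); have := size_run_gt0 x w [::].
by move=> /=; lia.
Qed.

(** Letters from [b] upwards form an end segment of a sorted row and never influence where smaller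
    letters go. *)
Lemma ins_filter b x R : sorted leq R ->
  filter (gtn b) (ins x R).1 =
    (if x < b then (ins x (filter (gtn b) R)).1 else filter (gtn b) R) /\
  filter (gtn b) (ins x R).2 =
    (if x < b then (ins x (filter (gtn b) R)).2 else [::]).
Proof.
elim: R => [|y R IH] sR /=; first by case: ifP.
have [IH1 IH2] := IH (path_sorted sR).
case: (ltnP x y) => xy /=.
  case: (ltnP y b) => yb /=; first by rewrite (ltn_trans xy yb) /= xy.
  have -> : filter (gtn b) R = [::].
    apply/eqP; rewrite -[_ == _]negbK -has_filter -all_predC.
    move: (order_path_min leq_trans sR); apply: sub_all => z /= yz.
    by rewrite -leqNgt (leq_trans yb).
  by case: ifP.
rewrite IH1 IH2; case: (ltnP y b) => yb /=; last by case: ltnP => // xb; lia.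
by case: ifP => //= _; rewrite ltnNge xy.
Qed.

Lemma run_filter b w R : sorted leq R ->
  run (filter (gtn b) R) (filter (gtn b) w) =
    (filter (gtn b) (run R w).1, filter (gtn b) (run R w).2).
Proof.
elim: w R => [|x w IH] R sR //=.
have [H1 H2] := ins_filter b x sR; have := IH _ (ins_sorted x sR).
by rewrite H1 filter_cat H2; case: ifP => _ /= ->.
Qed.

Lemma shape_filter_le b w r : ins_shape (filter (gtn b) w) r <= ins_shape w r.
Proof.
have [k] := ubnP (size w); elim: k w r => // k IH w r wk.
have rf := @run_filter b w [::] isT; case: r => [|r].
  by rewrite !shape_run0 rf size_filter count_size.
rewrite !shape_runS rf; case: w wk {rf} => // x w wk.
by apply: IH; exact: leq_ltn_trans (size_bumped x w) wk.
Qed.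

Lemma shape_rcons_le w x r : ins_shape w r <= ins_shape (rcons w x) r.
Proof.
have [k] := ubnP (size w); elim: k w x r => // k IH w x [|r] wk.
  by rewrite !shape_run0 run_rcons size_ins_ge.
rewrite !shape_runS run_rcons /=.
case: (ins_bumped x (run [::] w).1) => [->|[y ->]]; rewrite ?cats0 // cats1.
case: w wk => [|z w] wk; first by rewrite /ins_shape nth_nil.
by apply: IH; exact: leq_ltn_trans (size_bumped z w) wk.
Qed.

Lemma ins_max x R : all (fun y => y <= x) R -> ins x R = (rcons R x, [::]).
Proof.
elim: R => //= y R IH /andP[yx /IH->] /=.
by rewrite ltnNge yx.
Qed.

Lemma mem_run x w : x \in w ->
  (x \in (run [::] w).1) || (x \in (run [::] w).2).
Proof. by have /perm_mem/(_ x) := perm_run [::] w; rewrite mem_cat orbC => ->. Qed.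

Lemma run_sub1 x w : x \in (run [::] w).1 -> x \in w.
Proof.
by have /perm_mem/(_ x) := perm_run [::] w; rewrite mem_cat => <- ->; rewrite orbT.
Qed.

Lemma run_sub2 x w : x \in (run [::] w).2 -> x \in w.
Proof. by have /perm_mem/(_ x) := perm_run [::] w; rewrite mem_cat => <- ->. Qed.

Lemma shape_rcons_max w x r : all (fun y => y <= x) w ->
  ins_shape (rcons w x) r = ins_shape w r + (r == 0).
Proof.
move=> wx; have Rx : all (fun y => y <= x) (run [::] w).1.
  by apply/allP => y /run_sub1 /(allP wx).
case: r => [|r]; first by rewrite !shape_run0 run_rcons ins_max //= size_rcons addn1.
by rewrite !shape_runS run_rcons ins_max //= cats0 addn0.
Qed.

Lemma sorted_max b R : sorted leq R -> uniq R -> b \in R ->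
  all (fun y => y <= b) R -> R = rcons (filter (gtn b) R) b.
Proof.
elim: R => //= a R IH sR /andP[aR U]; rewrite inE => bR /andP[ab Rb].
case: (ltngtP a b) ab => [ab|//|ab] _ /=.
  by rewrite {1}IH ?(path_sorted sR) //; case/orP: bR => // /eqP ba; rewrite ba ltnn in ab.
subst a; case: R aR sR Rb {IH U bR} => //= a R; rewrite inE negb_or => /andP[ba _].
by move=> /andP[ba' _] /andP[ab _]; move: ba; rewrite eqn_leq ba' ab.
Qed.

(** Fomin's local growth rule: the word [rcons w x] has maximal letter [b] and
    last letter [x]. *)
Lemma shape_growth w x b r : uniq w -> b \in w -> all (fun y => y <= b) w -> x < b ->
  let lam := ins_shape (rcons w x) in let nu := ins_shape w in
  let mu := ins_shape (rcons (filter (gtn b) w) x) in let rho := ins_shape (filter (gtn b) w) in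
  lam r = maxn (mu r) (nu r) +
    (if r is r'.+1 then minn (mu r') (nu r') - rho r' else 0).
Proof.
rewrite /=; have [k] := ubnP (size w); elim: k w x r => // k IH w x r wk Uw bw wb xb.
have [R1b R2b] : all (fun y => y <= b) (run [::] w).1 /\ all (fun y => y <= b) (run [::] w).2.
  by split; apply/allP => y; [move=> /run_sub1 | move=> /run_sub2]; apply: (allP wb).
have rf := @run_filter b w [::] isT; rewrite [filter _ [::]]/= in rf.
have sR : sorted leq (run [::] w).1 by apply: run_sorted.
have : uniq ((run [::] w).2 ++ (run [::] w).1) by rewrite (perm_uniq (perm_run _ _)).
rewrite cat_uniq => /and3P[U2 /hasPn dis U1].
have bwk : size (run [::] w).2 < k.
  by case: (w) wk bw => // y w' wk _; exact: leq_ltn_trans (size_bumped y w') wk.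
have lamS s : ins_shape (rcons w x) s.+1 =
    ins_shape ((run [::] w).2 ++ (ins x (run [::] w).1).2) s.
  by rewrite shape_runS run_rcons.
have muS s : ins_shape (rcons (filter (gtn b) w) x) s.+1 = ins_shape (filter (gtn b) (run [::] w).2
     ++ (ins x (filter (gtn b) (run [::] w).1)).2) s.
  by rewrite shape_runS run_rcons rf.
have nuS s : ins_shape w s.+1 = ins_shape (run [::] w).2 s by rewrite shape_runS.
have rhoS s : ins_shape (filter (gtn b) w) s.+1 = ins_shape (filter (gtn b) (run [::] w).2) s.
  by rewrite shape_runS rf.
have lam0 : ins_shape (rcons w x) 0 = size (ins x (run [::] w).1).1.
  by rewrite shape_run0 run_rcons.
have mu0 : ins_shape (rcons (filter (gtn b) w) x) 0 = size (ins x (filter (gtn b) (run [::] w).1)).1.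
  by rewrite shape_run0 run_rcons rf.
have nu0 : ins_shape w 0 = size (run [::] w).1 by rewrite shape_run0.
have rho0 : ins_shape (filter (gtn b) w) 0 = size (filter (gtn b) (run [::] w).1).
  by rewrite shape_run0 rf.
move: (mem_run bw) => {}bw.
have szi := size_ins x (run [::] w).1.
have szif := size_ins x (filter (gtn b) (run [::] w).1).
have [if1 if2] := ins_filter b x sR; rewrite xb in if1 if2.
(* Either [b] ends the first row, so that the bumped word is unaffected by its removal, or [b] is
   already in the bumped word and the induction hypothesis applies there. *)
case bR : (b \in (run [::] w).1) bw => /= bC.
  have bC' : b \notin (run [::] w).2 by apply: dis.
  have fC : filter (gtn b) (run [::] w).2 = (run [::] w).2.
    apply/all_filterP/allP => y yC /=; rewrite ltn_neqAle (allP R2b) // andbT.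
    by apply: contraNneq bC' => <-.
  have ER := sorted_max sR U1 bR R1b.
  have szR : size (run [::] w).1 = (size (filter (gtn b) (run [::] w).1)).+1.
    by rewrite {1}ER size_rcons.
  have [y by_ xy] := ins_bumped_exists bR xb; rewrite by_ /= in szi if2 lamS.
  case: (ltnP y b) => yb.
    rewrite yb in if2; rewrite -if2 in szif muS.
    case: r => [|[|r]]; rewrite ?lam0 ?mu0 ?nu0 ?rho0 ?lamS ?muS ?nuS ?rhoS ?fC.
    - by move: szi szif szR; rewrite /=; clear; lia.
    - have := shape_rcons_le (run [::] w).2 y 0; rewrite cats1.
      by move: szi szif szR; rewrite /=; clear; lia.
    - have := shape_rcons_le (run [::] w).2 y r.+1; rewrite cats1.
      have := shape_rcons_le (run [::] w).2 y r.
      by move: szi szif szR; rewrite /=; clear; lia.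
  (* Now [x] bumps [b] itself, which then extends the second row: this is the case where the two
     added cells coincide and one is pushed down. *)
  have Ey : y = b.
    have [_ yR] : x < y /\ y \in (run [::] w).1 by apply: ins_bumped_gt; rewrite by_ inE.
    by apply/eqP; rewrite eqn_leq yb (allP R1b).
  rewrite Ey ltnn in if2 lamS; rewrite -if2 cats0 in muS; rewrite -if2 in szif.
  case: r => [|r]; rewrite ?lam0 ?mu0 ?nu0 ?lamS ?muS ?nuS ?rhoS ?fC.
    by move: szi szif szR; rewrite /=; clear; lia.
  rewrite cats1 shape_rcons_max //.
  case: r => [|r]; rewrite ?mu0 ?nu0 ?rho0 ?muS ?nuS ?rhoS ?fC.
    by move: szi szif szR; rewrite /=; clear; lia.
  by clear; rewrite /=; lia.
have fR : filter (gtn b) (run [::] w).1 = (run [::] w).1.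
  apply/all_filterP/allP => y yC /=; rewrite ltn_neqAle (allP R1b) // andbT.
  by apply: contraFneq bR => <-.
rewrite fR in mu0 rho0 muS.
case: (ins_bumped x (run [::] w).1) => [by_|[y by_]]; rewrite by_ ?cats0 in szi lamS muS.
  case: r => [|[|r]]; rewrite ?lam0 ?mu0 ?nu0 ?rho0 ?lamS ?muS ?nuS ?rhoS ?cats0.
  - by move: szi; rewrite /=; clear; lia.
  - have := shape_filter_le b (run [::] w).2 0.
    by move: szi; rewrite /=; clear; lia.
  - have := shape_filter_le b (run [::] w).2 r.+1.
    have := shape_filter_le b (run [::] w).2 r.
    by move: szi; rewrite /=; clear; lia.
have yb : y < b.
  have [_ yR] : x < y /\ y \in (run [::] w).1 by apply: ins_bumped_gt; rewrite by_ inE.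
  by rewrite ltn_neqAle (allP R1b) // andbT; apply: contraFneq bR => <-.
case: r => [|r]; first by rewrite lam0 mu0 nu0; move: szi; rewrite /=; clear; lia.
have := IH (run [::] w).2 y r bwk U2 bC R2b yb; rewrite lamS muS nuS !cats1 => ->.
case: r => [|r]; rewrite ?mu0 ?nu0 ?rho0 ?muS ?nuS ?rhoS ?cats1 //.
by move: szi; rewrite /=; clear; lia.
Qed.

(** * Reversing a word transposes its shape *)

Lemma run_rev_row R a s : all (fun x => x <= a) R -> sorted ltn (a :: s) ->
  run R (rev (a :: s)) = (rcons R a, rev s).
Proof.
elim: s a => [|b s IH] a Ra /=; first by rewrite ins_max.
move=> /andP[ab sb]; rewrite rev_cons -cats1 run_cat IH //; last first.
  by apply: sub_all Ra => x xa; apply: leq_trans (ltnW ab).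
by rewrite /= -[rcons R b]cats1 ins_middle //= cats1 rev_cons cats1.
Qed.

(** Stripping first columns leaves empty rows behind, which have to be skipped. *)
Definition heads (T : seq (seq nat)) := [seq head 0 R | R <- T & R != [::]].

Lemma dominates_nil_path T : path dominates [::] T -> all (pred1 [::]) T.
Proof. by elim: T => //= -[|//] T IH /IH ->. Qed.

Lemma heads_nil T : all (pred1 [::]) T -> heads T = [::].
Proof. by elim: T => //= R T IH /andP[/eqP-> /IH]. Qed.

(** Each letter of a reversed row bumps its predecessor, so only the first entry of the row stays.
    The first column thus becomes a row, and the bumped word is the one belonging to the tableau
    without that column. *)
Lemma run_rev_rows T R : sorted dominates T -> all (sorted ltn) T ->
  all (fun x => all (fun y => y <= x) R) (heads T) ->
  run R (flatten (map rev T)) = (R ++ heads T, flatten (map rev (map behead T))).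
Proof.
elim: T R => [|[|a s] T IH] R dT sT hT /=; first by rewrite cats0.
  have T0 := dominates_nil_path dT; rewrite IH ?(path_sorted dT) //.
move: sT hT => /= /andP[sa sT] /andP[Ra]; rewrite -/(heads T) => hT.
rewrite run_cat run_rev_row //= IH ?(path_sorted dT) //=; first by rewrite cat_rcons.
have ah : all (fun x => a <= x) (heads T).
  elim: T a s dT {IH Ra hT sT sa} => // -[|b s2] T IH a s /=.
    by move/dominates_nil_path => T0; rewrite -/(heads T) heads_nil.
  case/andP=> /andP[ab _] pT; rewrite (ltnW ab) /=.
  by apply: sub_all (IH b s2 pT) => x; apply: leq_trans (ltnW ab).
elim: (heads T) hT ah => //= x s' IHs /andP[Rx hs] /andP[ax as_].
by rewrite all_rcons ax Rx IHs.
Qed.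

Lemma size_heads T c : sorted dominates T ->
  (c < size (heads T)) = (0 < size (nth [::] T c)).
Proof.
elim: T c => [|R T IH] c dT; first by rewrite nth_nil.
case: R dT => [|a s] dT /=.
  have T0 := dominates_nil_path dT; rewrite heads_nil //= -[LHS]/false.
  case: c => //= c; case: (ltnP c (size T)) => cT; last by rewrite nth_default.
  by move/all_nthP: T0 => /(_ [::] c cT) /eqP ->.
by case: c => //= c; rewrite ltnS -/(heads T) IH // (path_sorted dT).
Qed.

Lemma dominates_behead R R2 : dominates R R2 -> dominates (behead R) (behead R2).
Proof. by case: R R2 => [|a R] [|b R2] //=; rewrite ?dominates0 // => /andP[]. Qed.

Lemma shape_transpose T r c : sorted dominates T -> all (sorted ltn) T ->
  (c < ins_shape (flatten (map rev T)) r) = (r < size (nth [::] T c)).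
Proof.
move=> dT sT; have [k] := ubnP (size (flatten (map rev T))).
elim: k T dT sT r c => // k IH T dT sT r c Tk.
have E : run [::] (flatten (map rev T)) = (heads T, flatten (map rev (map behead T))).
  by rewrite run_rev_rows //; apply/allP.
case: r => [|r]; first by rewrite shape_run0 E size_heads.
have nb : nth [::] (map behead T) c = behead (nth [::] T c).
  by elim: (T) c {E Tk dT sT} => [|R T' IHT] [|c] //=.
rewrite shape_runS E; have [T0|Tne] := eqVneq (flatten (map rev T)) [::].
  move: E; rewrite T0 => -[h0 <-]; rewrite /ins_shape /= nth_nil /=.
  have := size_heads c dT; rewrite -h0 /= => /esym/negbT.
  by rewrite -leqNgt leqn0 => /eqP ->.
rewrite IH ?nb ?size_behead //.
- by rewrite -subn1 ltn_subRL add1n.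
- case: (T) dT => //= R T'; elim: T' R => //= R2 T' IHT R /andP[d p].
  by rewrite dominates_behead // IHT.
- by rewrite all_map; apply: sub_all sT => -[|a s] //= /path_sorted.
- have := size_run [::] (flatten (map rev T)); rewrite E /=.
  case Ef : (flatten _) Tne Tk => [|x s] // _; have := size_run_gt0 x s [::].
  by rewrite -Ef E Ef /=; clear; lia.
Qed.

(** Reversal respects Knuth equivalence, so it is enough to treat the reading word of a tableau. *)
Lemma shape_rev w r c : uniq w -> (c < ins_shape (rev w) r) = (r < ins_shape w c).
Proof.
move=> Uw; have red := schensted_knuth_red w; have := schensted_tableau w.
rewrite [ins_shape w c]/ins_shape; move: (schensted w) red => T red /and3P[dT sT _].
have sT' : all (sorted ltn) T.
  apply/allP => R RT; rewrite ltn_sorted_uniq_leq (allP sT) // andbT.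
  have : uniq (rowword T) by rewrite -(perm_uniq (knuth_red_perm red)).
  apply: subseq_uniq; rewrite /rowword; have : R \in rev T by rewrite mem_rev.
  by case/splitPr=> T1 T2; rewrite flatten_cat /=;
    apply: subseq_trans (suffix_subseq _ _); apply: prefix_subseq.
rewrite -shape_transpose // /ins_shape.
have /schensted_knuth -> : knuth (rev w) (flatten (map rev T)) => //.
have -> : flatten (map rev T) = rev (rowword T).
  by rewrite /rowword rev_flatten map_rev revK.
exact/knuth_rev/knuth_red_knuth.
Qed.

(** * Words as sets of points, inverse words and complements *)

Section PointSets.

Variable I : finType.
Implicit Types (f g : I -> nat) (X : {set I}).

(** A word without repetition is a set of points with coordinates [f] (place) and [g] (letter).
    Exchanging the coordinates inverts it, and restricting places or letters is taking a subset. *)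
Definition enum_by f X := [seq i <- sort (relpre f leq) (enum I) | i \in X].
Definition word f g X := [seq g i | i <- enum_by f X].

Lemma mem_enum_by f X i : (i \in enum_by f X) = (i \in X).
Proof. by rewrite mem_filter mem_sort mem_enum andbT. Qed.

Lemma enum_by_uniq f X : uniq (enum_by f X).
Proof. by rewrite filter_uniq // sort_uniq enum_uniq. Qed.

Lemma size_enum_by f X : size (enum_by f X) = #|X|.
Proof. by rewrite -(card_uniqP (enum_by_uniq f X)); apply: eq_card => i; rewrite mem_enum_by. Qed.

Lemma enum_by_sorted f X : injective f -> sorted (relpre f ltn) (enum_by f X).
Proof.
move=> fI; have tr : transitive (relpre f leq) by move=> ? ? ?; apply: leq_trans.
have : sorted (relpre f leq) (enum_by f X).
  by apply: sorted_filter => //; apply: sort_sorted => i j; apply: leq_total.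
rewrite -!sorted_map ltn_sorted_uniq_leq map_inj_uniq // => ->.
by rewrite enum_by_uniq.
Qed.

Lemma enum_by_eq f X s : injective f -> sorted (relpre f ltn) s -> s =i X ->
  enum_by f X = s.
Proof.
move=> fI ss sX; apply: (@irr_sorted_eq _ (relpre f ltn)) => //.
- by move=> ? ? ?; apply: ltn_trans.
- by move=> ?; apply: ltnn.
- exact: enum_by_sorted.
by move=> i; rewrite mem_enum_by sX.
Qed.

Lemma enum_byD1 f X b : enum_by f (X :\ b) = [seq i <- enum_by f X | i != b].
Proof.
by rewrite -filter_predI; apply: eq_filter => i; rewrite /= in_setD1.
Qed.

Lemma pairwise_enum_by f X : injective f -> pairwise (relpre f ltn) (enum_by f X).
Proof.
move=> fI; rewrite -sorted_pairwise ?enum_by_sorted //.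
by move=> ? ? ?; apply: ltn_trans.
Qed.

Lemma enum_by_last f X i : injective f -> i \in X ->
  (forall j, j \in X -> f j <= f i) -> enum_by f X = rcons (enum_by f (X :\ i)) i.
Proof.
move=> fI iX mX; apply: enum_by_eq => //; last first.
  by move=> j; rewrite mem_rcons inE mem_enum_by in_setD1; case: eqP => [->|].
rewrite (sorted_pairwise (fun _ _ _ => @ltn_trans _ _ _)) pairwise_rcons pairwise_enum_by // andbT.
apply/allP => j; rewrite mem_enum_by in_setD1 => /andP[ji jX] /=.
by rewrite ltn_neqAle mX // andbT; apply: contraNneq ji => /fI ->.
Qed.

Lemma word_uniq f g X : injective g -> uniq (word f g X).
Proof. by move=> gI; rewrite map_inj_uniq // enum_by_uniq. Qed.

Lemma word_last f g X i : injective f -> i \in X ->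
  (forall j, j \in X -> f j <= f i) -> word f g X = rcons (word f g (X :\ i)) (g i).
Proof. by move=> fI iX mX; rewrite /word (enum_by_last fI iX mX) map_rcons. Qed.

Lemma word_filter_max f g X b : injective g ->
  (forall j, j \in X -> g j <= g b) ->
  filter (gtn (g b)) (word f g X) = word f g (X :\ b).
Proof.
move=> gI mX; rewrite /word filter_map enum_byD1; congr map.
apply: eq_in_filter => j; rewrite mem_enum_by => jX /=.
by rewrite ltn_neqAle mX // andbT (inj_eq gI).
Qed.

Lemma all_word f g X (p : pred nat) : (forall j, j \in X -> p (g j)) -> all p (word f g X).
Proof. by move=> H; apply/allP => x /mapP[j]; rewrite mem_enum_by => /H ? ->. Qed.

(** In this form the rule mentions only the last point [i] and the highest point [b], so it is
    symmetric in the two coordinates. *)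
Lemma word_growth f g X i b r : injective f -> injective g ->
  i \in X -> (forall j, j \in X -> f j <= f i) ->
  b \in X -> (forall j, j \in X -> g j <= g b) -> i != b ->
  ins_shape (word f g X) r =
    maxn (ins_shape (word f g (X :\ b)) r) (ins_shape (word f g (X :\ i)) r) +
    (if r is r'.+1 then
       minn (ins_shape (word f g (X :\ b)) r') (ins_shape (word f g (X :\ i)) r') -
       ins_shape (word f g (X :\ i :\ b)) r' else 0).
Proof.
move=> fI gI iX fX bX gX ib.
have bXi : b \in X :\ i by rewrite in_setD1 eq_sym ib.
have iXb : i \in X :\ b by rewrite in_setD1 ib.
have sub j c : j \in X :\ c -> j \in X by rewrite in_setD1 => /andP[].
rewrite (word_last _ fI iX fX) (shape_growth (b := g b)); last first.
- by rewrite ltn_neqAle gX // andbT; apply: contraNneq ib => /gI/eqP.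
- by apply: all_word => j /sub /gX.
- by apply: map_f; rewrite mem_enum_by.
- exact: word_uniq.
rewrite !(word_filter_max _ gI); last by move=> j /sub /gX.
rewrite (word_last _ fI iXb); last by move=> j /sub /fX.
by rewrite [X :\ b :\ i]setDDl setUC -setDDl.
Qed.

Lemma word_corner f g X i r : injective f -> injective g ->
  i \in X -> (forall j, j \in X -> f j <= f i) -> (forall j, j \in X -> g j <= g i) ->
  ins_shape (word f g X) r = ins_shape (word f g (X :\ i)) r + (r == 0).
Proof.
move=> fI gI iX fX gX; rewrite (word_last _ fI iX fX) shape_rcons_max //.
by apply: all_word => j; rewrite in_setD1 => /andP[_ /gX].
Qed.

Lemma exists_argmax f X : X != set0 ->
  exists2 i, i \in X & forall j, j \in X -> f j <= f i.
Proof.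
case/set0Pn=> i0 i0X; case: (@arg_maxnP _ i0 (mem X) f i0X) => i iX mX.
by exists i.
Qed.

(** Both sides obey the same recursion: the growth rule is symmetric, and a point that is at once
    last and highest adds a cell to the first row on either side. *)
Lemma shape_sym f g X r : injective f -> injective g ->
  ins_shape (word f g X) r = ins_shape (word g f X) r.
Proof.
move=> fI gI; have [k] := ubnP #|X|; elim: k X r => // k IH X r Xk.
have [->|Xne] := eqVneq X set0.
  have E h h' : word h h' set0 = [::].
    by apply/eqP; rewrite -size_eq0 size_map size_enum_by cards0.
  by rewrite !E.
have [i iX fX] := exists_argmax f Xne; have [b bX gX] := exists_argmax g Xne.
have lt j : j \in X -> #|X :\ j| < k by move=> jX; move: Xk; rewrite (cardsD1 j) jX.
have [ib|ib] := eqVneq i b.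
  rewrite -ib in bX gX.
  by rewrite (word_corner _ fI gI iX) // (word_corner _ gI fI iX) // IH ?lt.
rewrite (word_growth _ fI gI iX fX bX gX ib).
rewrite (word_growth _ gI fI bX gX iX fX) 1?eq_sym // !(IH (X :\ i)) ?lt // !(IH (X :\ b)) ?lt //.
rewrite maxnC; case: r => // r.
rewrite !(IH (X :\ i)) ?lt // !(IH (X :\ b)) ?lt // IH.
  by rewrite minnC [X :\ b :\ i]setDDl [_ |: _]setUC -setDDl.
by apply: leq_ltn_trans (lt _ iX); apply/subset_leq_card/subsetDl.
Qed.

(** Complementing the letters of a word reverses its inverse word, and reversal transposes the
    shape. *)
Lemma shape_neg N f g X r c : injective f -> injective g -> (forall i, g i <= N) ->
  (c < ins_shape (word f (fun i => N - g i) X) r) = (r < ins_shape (word f g X) c).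
Proof.
move=> fI gI gN.
have nI : injective (fun i => N - g i).
  by move=> i j /eqP; rewrite eqn_sub2lE // => /eqP /gI.
rewrite shape_sym // (shape_sym _ c fI gI).
suff -> : word (fun i => N - g i) f X = rev (word g f X).
  by rewrite shape_rev // word_uniq.
rewrite /word -map_rev; congr map; apply: enum_by_eq => //.
  rewrite rev_sorted; apply: sub_sorted (enum_by_sorted X gI) => i j /= ij.
  by apply: ltn_sub2l => //; apply: leq_trans (gN j).
by move=> i; rewrite mem_rev mem_enum_by.
Qed.

End PointSets.

(** * Cells of tableaux *)

Section Shapes.

Variable T : Type.
Implicit Types (t : seq (seq T)) (x b : T) (p : nat * nat).

Definition cell t (r c : nat) := onth (row t r) c.

(** Empty rows are excluded so that the number of rows can be read off from the row lengths. *)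
Definition partition_shaped t :=
  sorted geq (map size t) && all (fun s => 0 < size s) t.

(** An outer corner: a cell not yet in the diagram whose addition keeps a partition shape. *)
Definition corner t p :=
  (p.2 == size (row t p.1)) && ((p.1 == 0) || (p.2 < size (row t p.1.-1))).

Lemma row_gt0 t r : partition_shaped t -> (0 < size (row t r)) = (r < size t).
Proof.
case/andP=> _ /(all_nthP [::]) h; case: (ltnP r (size t)) => rt; first exact: h.
by rewrite /row nth_default.
Qed.

Lemma row_leS t r : partition_shaped t -> size (row t r.+1) <= size (row t r).
Proof.
case/andP=> s _; case: (ltnP r.+1 (size t)) => rt; last by rewrite {1}/row nth_default.
move/(sortedP 0): s => /(_ r); rewrite size_map => /(_ rt).
by rewrite !(nth_map [::]) // ltnW.
Qed.

Lemma row_le t r r' : partition_shaped t -> r <= r' ->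
  size (row t r') <= size (row t r).
Proof.
move=> pt /subnK <-; elim: (r' - r) => // d IH.
exact: leq_trans (row_leS _ pt) IH.
Qed.

Lemma partition_shapedP t : (forall r, size (row t r.+1) <= size (row t r)) ->
  (forall r, r < size t -> 0 < size (row t r)) -> partition_shaped t.
Proof.
move=> le pos; apply/andP; split; last exact/(all_nthP [::]).
apply/(sortedP 0) => r; rewrite size_map => rt.
by rewrite !(nth_map [::]) ?(ltnW rt) //; apply: le.
Qed.

(** [column] skips the rows that are too short; its indices are row numbers only because such rows
    all lie at the bottom. *)
Lemma onth_column t r c : partition_shaped t -> onth (column t c) r = cell t r c.
Proof.
elim: t r => [|s t IH] r pt; first by rewrite /cell /row nth_nil !onth0n.
have pt' : partition_shaped t.
  by case/andP: pt => /path_sorted ss /andP[_ ps]; apply/andP.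
have onthN (u : seq T) : onth u c = None -> size u <= c.
  by have := onthNE u c; case: (onth u c) => //= <-.
rewrite /column /=; case Es: (onth s c) => [a|] /=.
  by case: r => [|r]; rewrite /cell /=; [rewrite Es | rewrite -/(column t c) IH].
have sc := onthN _ Es; rewrite -/(column t c) IH //.
case: r => [|r]; rewrite /cell /=.
  by rewrite Es onth_default //; apply: leq_trans sc; apply: (row_leS 0 pt).
rewrite !onth_default //; apply: leq_trans sc.
  exact: (row_le pt (leq0n r.+1)).
exact: (row_le pt (leq0n r.+2)).
Qed.

Lemma size_column t r c : partition_shaped t ->
  (r < size (column t c)) = (c < size (row t r)).
Proof. by move=> pt; rewrite -!onthTE onth_column. Qed.

Lemma eq_size_column t t' c : partition_shaped t -> partition_shaped t' ->
  (forall r, size (row t r) = size (row t' r)) ->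
  size (column t c) = size (column t' c).
Proof.
move=> pt pt' H; apply/eqP; rewrite eqn_leq; apply/andP; split; rewrite leqNgt; apply/negP.
  by rewrite size_column // H -size_column // ltnn.
by rewrite size_column // -H -size_column // ltnn.
Qed.

Lemma corner_column t p : partition_shaped t -> corner t p ->
  size (column t p.2) = p.1.
Proof.
case: p => pr pc pt /andP[/= /eqP p2 p1]; apply/eqP; rewrite eqn_leq leqNgt.
rewrite size_column // {1}p2 ltnn /=; case: pr p1 {p2} => //= r.
by rewrite size_column.
Qed.

Lemma onth_set_nth (x y : T) s m c : m <= size s ->
  onth (set_nth x s m y) c = if c == m then Some y else onth s c.
Proof.
elim: s m c => [|z s IH] [|m] [|c] //=; first by case: c.
exact: IH.
Qed.

Lemma row_set_cell t p x r :
  row (set_cell t p x) r = if r == p.1 then set_nth x (row t p.1) p.2 x else row t r.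
Proof. by rewrite /row /set_cell nth_set_nth. Qed.

Lemma cell_set_cell t p x r c : p.2 <= size (row t p.1) ->
  cell (set_cell t p x) r c = if (r, c) == p then Some x else cell t r c.
Proof.
case: p => [pr pc] /= le; rewrite /cell row_set_cell /= xpair_eqE.
by case: eqP => [->|_] //=; rewrite onth_set_nth.
Qed.

Lemma size_set_cell t p x : size (set_cell t p x) = maxn p.1.+1 (size t).
Proof. exact: size_set_nth. Qed.

Lemma size_row_inside t p x r : p.2 < size (row t p.1) ->
  size (row (set_cell t p x) r) = size (row t r).
Proof.
move=> ins; rewrite row_set_cell; case: eqP => [->|//].
by rewrite size_set_nth (maxn_idPr _).
Qed.

Lemma size_row_end t p x r : p.2 = size (row t p.1) ->
  size (row (set_cell t p x) r) = size (row t r) + (r == p.1).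
Proof.
move=> e; rewrite row_set_cell; case: eqP => [->|_]; last by rewrite addn0.
by rewrite size_set_nth e (maxn_idPl _) // addn1.
Qed.

Lemma partition_shaped_inside t p x : partition_shaped t ->
  p.2 < size (row t p.1) -> partition_shaped (set_cell t p x).
Proof.
move=> pt ins; apply: partition_shapedP => r.
  by rewrite !size_row_inside // row_leS.
rewrite size_row_inside // row_gt0 // size_set_cell (maxn_idPr _) //.
by rewrite -row_gt0 //; apply: leq_ltn_trans ins.
Qed.

Lemma corner_row t p : partition_shaped t -> corner t p -> p.1 <= size t.
Proof.
move=> pt /andP[_ /orP[/eqP-> //|p1]].
by case E: p.1 p1 => [|r] //= p1; rewrite -row_gt0 //; apply: leq_ltn_trans p1.
Qed.

Lemma partition_shaped_corner t p x : partition_shaped t ->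
  corner t p -> partition_shaped (set_cell t p x).
Proof.
move=> pt cp; have pt1 := corner_row pt cp; case/andP: cp => /eqP p2 p1.
apply: partition_shapedP => r; rewrite !size_row_end //.
  have := row_leS r pt; case: (eqVneq r p.1) => [->|rp] /=.
    by case: eqP; lia.
  case: eqP => [rp1|] /=; last by lia.
  by move: p1; rewrite -rp1 /= p2 -rp1 addn1 addn0.
rewrite size_set_cell leq_max => /orP[rp|rt].
  move: rp; rewrite ltnS leq_eqVlt => /orP[->|rp]; first by rewrite addn1.
  by rewrite addn_gt0 row_gt0 // (leq_trans rp pt1).
by rewrite addn_gt0 row_gt0 // rt.
Qed.

Lemma eq_cells t t' : partition_shaped t -> partition_shaped t' ->
  (forall r c, cell t r c = cell t' r c) -> t = t'.
Proof.
move=> pt pt' H.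
have Hr r : row t r = row t' r by apply: eq_from_onth => c; apply: H.
apply: (@eq_from_nth _ [::]) => [|r _]; last exact: Hr.
apply/eqP; rewrite eqn_leq; apply/andP; split; rewrite leqNgt; apply/negP.
  by rewrite -row_gt0 // Hr row_gt0 // ltnn.
by rewrite -row_gt0 // -Hr row_gt0 // ltnn.
Qed.

Lemma column_corner t p x c : partition_shaped t -> corner t p ->
  column (set_cell t p x) c = if c == p.2 then rcons (column t c) x else column t c.
Proof.
move=> pt cp; have pt' := partition_shaped_corner x pt cp.
have /eqP p2 : p.2 == size (row t p.1) by case/andP: cp.
apply: eq_from_onth => r; rewrite onth_column // cell_set_cell; last by rewrite p2.
have := corner_column pt cp; case: p {cp pt'} p2 => pr pc /= p2 p1.
rewrite xpair_eqE; case: (eqVneq c pc) => [->|cpc]; last by rewrite andbF onth_column.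
rewrite andbT -cats1 onth_cat p1; case: (ltngtP r pr) => rp.
- by rewrite onth_column.
- rewrite /cell onth_default; last by rewrite p2 row_le // ltnW.
  by rewrite onth_default //= subn_gt0.
- by rewrite rp subnn.
Qed.

Lemma row_corner t p x r : corner t p ->
  row (set_cell t p x) r = if r == p.1 then rcons (row t r) x else row t r.
Proof.
case/andP=> /eqP p2 _; rewrite row_set_cell; case: eqP => [->|//].
rewrite p2; elim: (row t p.1) => //= y s ->.
by [].
Qed.

Lemma corner_inside t p x c : p.2 < size (row t p.1) -> corner (set_cell t p x) c = corner t c.
Proof. by move=> ins; rewrite /corner !size_row_inside. Qed.

Lemma corner_neq_row t p c : corner t p -> corner t c -> p != c -> p.1 != c.1.
Proof.
case/andP=> /eqP p2 _ /andP[/eqP c2 _]; apply: contraNneq => e.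
by case: p c p2 c2 e => [? ?] [? ?] /= -> -> ->.
Qed.

Lemma corner_add t t1 c p : corner t c -> corner t p -> p != c ->
  (forall r, size (row t1 r) = size (row t r) + (r == c.1)) -> corner t1 p.
Proof.
move=> cc cp pc sz; have rn := corner_neq_row cp cc pc.
case/andP: cp => /eqP p2 p1.
rewrite /corner !sz (negPf rn) addn0 p2 eqxx /=.
by case/orP: p1 => [->//|p1]; rewrite (leq_trans _ (leq_addr _ _)) ?orbT // -p2.
Qed.

Lemma corner_set_corner t c p b : corner t c -> corner t p -> p != c ->
  corner (set_cell t c b) p.
Proof.
move=> cc cp pc; apply: (corner_add cc cp pc) => r.
by rewrite size_row_end //; case/andP: cc => /eqP.
Qed.

Lemma set_cellC t p c x b : partition_shaped t -> corner t c -> p != c ->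
  p.2 < size (row t p.1) \/ corner t p ->
  set_cell (set_cell t c b) p x = set_cell (set_cell t p x) c b.
Proof.
move=> pt cc pc pp.
have c2 : c.2 = size (row t c.1) by case/andP: cc => /eqP.
have le1 : p.2 <= size (row t p.1).
  by case: pp => [/ltnW //|/andP[/eqP-> _]].
have sc r : size (row (set_cell t c b) r) = size (row t r) + (r == c.1).
  by rewrite size_row_end.
have rpc : corner t p -> p.1 != c.1 by move=> cp; exact: corner_neq_row cp cc pc.
have le2 : p.2 <= size (row (set_cell t c b) p.1).
  by rewrite sc; apply: leq_trans le1 (leq_addr _ _).
have le3 : c.2 <= size (row (set_cell t p x) c.1).
  case: pp => [ins|/[dup]/rpc rn /andP[/eqP p2 _]]; first by rewrite size_row_inside // c2.
  by rewrite size_row_end // c2 leq_addr.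
have c2' : c.2 = size (row (set_cell t p x) c.1).
  case: pp => [ins|/[dup]/rpc rn /andP[/eqP p2 _]]; first by rewrite size_row_inside // c2.
  by rewrite size_row_end // c2 eq_sym (negPf rn) addn0.
have ptc := partition_shaped_corner b pt cc.
have cornerC : corner t p -> corner (set_cell t c b) p.
  by move=> cp; apply: corner_set_corner.
apply: eq_cells.
- case: pp => [ins|/cornerC]; last exact: partition_shaped_corner.
  by apply: partition_shaped_inside => //; rewrite sc; apply: leq_trans ins (leq_addr _ _).
- apply: partition_shaped_corner.
    by case: pp => [|]; [apply: partition_shaped_inside | apply: partition_shaped_corner].
  case: pp => [ins|/[dup]/rpc rn /andP[/eqP p2 _]]; first by rewrite corner_inside.
  rewrite /corner -c2' eqxx /= size_row_end //.
  by case/andP: cc => _ /orP[->//|c1]; rewrite (leq_trans c1 (leq_addr _ _)) orbT.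
move=> r k; rewrite (cell_set_cell _ _ _ le2) (cell_set_cell _ _ _ le3) (cell_set_cell _ _ _ le1).
rewrite cell_set_cell; last by rewrite c2.
by case: (eqVneq (r, k) p) => [->|_] //; rewrite (negPf pc).
Qed.

Lemma set_cell_overwrite t c b x : partition_shaped t -> corner t c ->
  set_cell (set_cell t c b) c x = set_cell t c x.
Proof.
move=> pt cc; have c2 : c.2 = size (row t c.1) by case/andP: cc => /eqP.
have lt : c.2 < size (row (set_cell t c b) c.1) by rewrite size_row_end // eqxx -c2 addn1.
apply: eq_cells.
- apply: partition_shaped_inside => //; exact: partition_shaped_corner.
- exact: partition_shaped_corner.
have le : c.2 <= size (row t c.1) by rewrite c2.
move=> r k; rewrite (cell_set_cell _ _ _ (ltnW lt)) !(cell_set_cell _ _ _ le).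
by case: (_ == c).
Qed.

End Shapes.

(** * Mixed insertion and shapes *)

Section BumpPaths.

Implicit Types (t : seq (seq entry)) (x y b : entry) (p c q : nat * nat).

Definition line x t (k : nat) := if entry_barred x then column t k else row t k.
Definition line_cell (x : entry) (j k : nat) := if entry_barred x then (j, k) else (k, j).

Lemma bump_posNone x (s : seq entry) : onth s (bump_pos x s) = None ->
  bump_pos x s = size s.
Proof.
move=> e; apply/eqP; rewrite eqn_leq find_size /=.
by have := onthNE s (bump_pos x s); rewrite e.
Qed.

Lemma bump_pos_max x s : all (fun y : entry => (y < x)%O) s -> bump_pos x s = size s.
Proof.
move=> sx; apply: hasNfind; apply/hasPn => y /(allP sx) yx.
by rewrite lt_gtF.
Qed.

Lemma bump_pos_has x (s : seq entry) : has (fun z => (x < z)%O) s ->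
  has (fun y => (x < y)%O && all (fun z => (x < z)%O ==> (y <= z)%O) s) s.
Proof.
case/hasP=> z0 z0s xz0.
have : z0 \in [seq z <- s | (x < z)%O] by rewrite mem_filter xz0.
case E : [seq z <- s | (x < z)%O] => [//|a u] _.
have au : sort <=%O (a :: u) != [::].
  by rewrite -size_eq0 size_sort.
case Es : (sort <=%O (a :: u)) au => [//|m v] _.
have mem z : (z \in m :: v) = (x < z)%O && (z \in s).
  by rewrite -Es mem_sort -E mem_filter.
have /andP[xm ms] : (x < m)%O && (m \in s) by rewrite -mem inE eqxx.
apply/hasP; exists m => //; rewrite xm /=; apply/allP => z zs; apply/implyP => xz.
have : z \in m :: v by rewrite mem xz.
rewrite inE => /orP[/eqP->//|zv].
have := sort_sorted (@le_total _ _) (a :: u); rewrite Es /= => /(order_path_min le_trans).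
by move/allP/(_ z zv).
Qed.

Lemma bump_pos_rcons x s b : all (fun y : entry => (y < b)%O) s -> (x < b)%O ->
  bump_pos x (rcons s b) = bump_pos x s.
Proof.
move=> sb xb; rewrite /bump_pos -cats1 find_cat.
have E : {in s, (fun y : entry => (x < y)%O && all (fun z => (x < z)%O ==> (y <= z)%O) (s ++ [:: b])) =1
   (fun y => (x < y)%O && all (fun z => (x < z)%O ==> (y <= z)%O) s)}.
  move=> y ys; rewrite /= all_cat /= xb /= andbT (ltW (allP sb y ys)).
  by rewrite andbT.
rewrite (eq_in_has E) (eq_in_find E); case: ifP => // hN.
rewrite /= xb /= all_cat /= xb lexx /= andbT ifT ?addn0; last first.
  apply/allP => z zs; apply/implyP => xz; move/negbT/negP: hN; case.
  by apply: bump_pos_has; apply/hasP; exists z.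
by rewrite hasNfind // hN.
Qed.

(** The insertion as a relation. The index counts the bumps, to be compared with the fuel later, and
    the end condition records that the final cell is an outer corner. *)
Inductive bump_path : nat -> seq (seq entry) -> entry -> nat ->
    seq (seq entry) -> nat * nat -> Prop :=
| bump_end t x k p :
    p = line_cell x (size (line x t k)) k ->
    onth (line x t k) (bump_pos x (line x t k)) = None -> corner t p ->
    bump_path 0 t x k (set_cell t p x) p
| bump_next m t x k p y t' q :
    p = line_cell x (bump_pos x (line x t k)) k ->
    onth (line x t k) (bump_pos x (line x t k)) = Some y ->
    bump_path m (set_cell t p x) y (if entry_barred y then p.2 else p.1).+1 t' q ->
    bump_path m.+1 t x k t' q.

Lemma insert_recE fuel t x k : insert_rec fuel t x k =
  let j := bump_pos x (line x t k) in
  let p := line_cell x j k in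
  match onth (line x t k) j, fuel with
  | Some y, m.+1 =>
    insert_rec m (set_cell t p x) y (if entry_barred y then p.2 else p.1).+1
  | _, _ => (set_cell t p x, p)
  end.
Proof. by case: fuel. Qed.

Lemma insert_rec_path m fuel t x k t' q : bump_path m t x k t' q -> m <= fuel ->
  insert_rec fuel t x k = (t', q).
Proof.
move=> bp; elim: bp fuel => {m t x k t' q}.
  move=> t x k p Ep Ey cp fuel _; rewrite insert_recE /= Ey.
  by rewrite (bump_posNone Ey) -Ep.
move=> m t x k p y t' q Ep Ey _ IH [//|fuel] mf.
by rewrite insert_recE /= Ey -Ep IH.
Qed.

Definition entries_lt b t := forall (r k : nat) y, cell t r k = Some y -> (y < b :> entry)%O.

Lemma line_entries x t k j : partition_shaped t ->
  onth (line x t k) j = cell t (line_cell x j k).1 (line_cell x j k).2.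
Proof. by move=> pt; rewrite /line /line_cell; case: ifP => _ //=; rewrite onth_column. Qed.

Lemma line_entries_lt b x t k : partition_shaped t -> entries_lt b t ->
  all (fun y => (y < b)%O) (line x t k).
Proof.
move=> pt tb; apply/allP => y /onthP[j].
by rewrite line_entries //; apply: tb.
Qed.

Lemma line_corner x t k c b : partition_shaped t -> corner t c ->
  line x (set_cell t c b) k =
    if line_cell x (size (line x t k)) k == c then rcons (line x t k) b else line x t k.
Proof.
move=> pt cc; have := corner_column pt cc; have /eqP := proj1 (andP cc).
case: c cc => cr cc_ cc /= c2 c1; rewrite /line /line_cell.
case: ifP => _; rewrite ?column_corner ?row_corner //= xpair_eqE.
  by case: (eqVneq k cc_) => [->|]; rewrite ?andbF // c1 eqxx.
by case: (eqVneq k cr) => [->|] //=; rewrite -c2 eqxx.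
Qed.

Lemma entries_lt_set b t p x : p.2 <= size (row t p.1) -> entries_lt b t ->
  (x < b)%O -> entries_lt b (set_cell t p x).
Proof.
move=> le tb xb r c y; rewrite cell_set_cell //.
by case: ifP => _ => [[<-]|/tb].
Qed.

(** The cell where a maximal entry [b], bumped from the cell [p] of [t], is put. *)
Definition next_cell (b : entry) t (p : nat * nat) :=
  line_cell b (size (line b t (if entry_barred b then p.2 else p.1).+1))
    (if entry_barred b then p.2 else p.1).+1.

Lemma next_cell_corner b t t1 p : partition_shaped t1 -> partition_shaped t ->
  corner t p -> (forall r, size (row t1 r) = size (row t r) + (r == p.1)) ->
  corner t1 (next_cell b t1 p).
Proof.
move=> pt' pt cp sz; have p2 : p.2 = size (row t p.1) by case/andP: cp => /eqP.
rewrite /next_cell /line_cell /line; case: (entry_barred b); last first.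
  apply/andP; split=> //; apply/orP; right.
  change (size (row t1 p.1.+1) < size (row t1 p.1)).
  rewrite [X in _ < X]sz eqxx addn1 ltnS sz (gtn_eqF (ltnSn _)) addn0.
  exact: row_leS.
set k := p.2.+1; set h := size (column _ k).
have hp : h <= p.1.
  by rewrite leqNgt size_column // -leqNgt sz eqxx addn1 -p2.
have kle : k <= size (row t1 h).
  by apply: leq_trans (row_le pt' hp); rewrite sz eqxx addn1 -p2.
have keq : k = size (row t1 h).
  by apply/eqP; rewrite eqn_leq kle leqNgt -size_column // -/h ltnn.
rewrite /corner /= -keq eqxx /=; case Eh : h => [|h'] //=.
by rewrite -size_column // -/h Eh.
Qed.

Lemma bump_path_inside t x k y : partition_shaped t ->
  onth (line x t k) (bump_pos x (line x t k)) = Some y ->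
  let p := line_cell x (bump_pos x (line x t k)) k in
  cell t p.1 p.2 = Some y /\ p.2 < size (row t p.1).
Proof.
move=> pt /[dup] Ey; rewrite line_entries // => E; split=> //.
by rewrite -onthTE -/(cell _ _ _) E.
Qed.

Lemma bump_path_shape m t x k t1 p : bump_path m t x k t1 p ->
  partition_shaped t -> [/\ partition_shaped t1, corner t p &
      forall r, size (row t1 r) = size (row t r) + (r == p.1)].
Proof.
elim=> {m t x k t1 p} [t x k p _ _ cp|m t x k p y t1 q Ep Ey _ IH] pt.
  split=> // [|r]; first exact: partition_shaped_corner.
  by rewrite size_row_end //; case/andP: cp => /eqP.
have [_] := bump_path_inside pt Ey; rewrite -Ep => inside.
have [pt1 cq sz] := IH (partition_shaped_inside _ pt inside).
split=> // [|r]; first by rewrite -(corner_inside x q inside).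
by rewrite sz size_row_inside.
Qed.

(** A maximal entry is bumped only when its line offers no other larger entry, that is, only if the
    path would have ended in its cell. It then makes one more step, to [next_cell], where it can
    bump nothing; hence the bound [m.+1]. *)
Lemma bump_path_max m t x k t1 p b : bump_path m t x k t1 p ->
  partition_shaped t -> entries_lt b t -> (x < b)%O ->
  entries_lt b t1 /\
  forall c, corner t c ->
  exists2 m', m' <= m.+1 &
    if p == c then
      bump_path m' (set_cell t c b) x k
        (set_cell t1 (next_cell b t1 p) b) (next_cell b t1 p)
    else bump_path m' (set_cell t c b) x k (set_cell t1 c b) p.
Proof.
elim=> {m t x k t1 p} [t x k p Ep Ey cp|m t x k p y t1 q Ep Ey bp IH] pt tb xb.
  have p2 : p.2 = size (row t p.1) by case/andP: cp => /eqP.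
  have tb1 : entries_lt b (set_cell t p x) by apply: entries_lt_set; rewrite // p2.
  have pt1 : partition_shaped (set_cell t p x) by apply: partition_shaped_corner.
  split=> [//|c cc].
  have Eline := line_corner x k b pt cc; rewrite -Ep in Eline.
  have lb : all (fun z => (z < b)%O) (line x t k) by apply: line_entries_lt.
  have j0 := bump_posNone Ey.
  case: eqVneq Eline => [pc|pc] Eline.
    subst c; exists 1 => //; apply: (@bump_next 0 _ _ _ p b).
    - by rewrite Eline bump_pos_rcons // j0.
    - by rewrite Eline bump_pos_rcons // j0 -cats1 onth_cat ltnn subnn.
    rewrite set_cell_overwrite //; apply: bump_end => //.
      by rewrite bump_pos_max ?line_entries_lt // onth_default.
    by apply: (next_cell_corner b pt1 pt cp) => r; rewrite size_row_end.
  exists 0 => //; rewrite -set_cellC //; last by right.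
  have cT : corner (set_cell t c b) p by apply: corner_set_corner.
  by apply: bump_end; rewrite ?Eline.
have [Ecell] := bump_path_inside pt Ey; rewrite -Ep in Ecell * => inside.
have yb : (y < b)%O by apply: tb Ecell.
have pt' : partition_shaped (set_cell t p x) by apply: partition_shaped_inside.
have [] := IH pt' _ yb; first by apply: entries_lt_set => //; exact: ltnW.
move=> tb1 Hc; split=> // c cc.
have := Hc c; rewrite corner_inside // => /(_ cc) [m' mm' H].
have lb : all (fun z => (z < b)%O) (line x t k) by apply: line_entries_lt.
have pc : p != c.
  by apply: contraTneq inside => ->; case/andP: cc => /eqP-> _; rewrite ltnn.
have jlt : bump_pos x (line x t k) < size (line x t k) by rewrite -onthTE Ey.
have Epos : bump_pos x (line x (set_cell t c b) k) = bump_pos x (line x t k).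
  by rewrite line_corner //; case: ifP => _ //; rewrite bump_pos_rcons.
have Eonth : onth (line x (set_cell t c b) k) (bump_pos x (line x t k)) = Some y.
  by rewrite line_corner //; case: ifP => _ //; rewrite -cats1 onth_cat jlt.
exists m'.+1 => //; case: ifP H => _ H; apply: (@bump_next _ _ _ _ p y);
  rewrite ?Epos // set_cellC //; by left.
Qed.

Lemma corner_line0 t x : partition_shaped t ->
  corner t (line_cell x (size (line x t 0)) 0).
Proof.
move=> pt; rewrite /line_cell /line; case: (entry_barred x); last exact/andP.
set h := size _; have h0 : size (row t h) = 0.
  by apply/eqP; rewrite -leqn0 leqNgt -size_column // ltnn.
apply/andP; split; first by rewrite /= h0.
rewrite /=; case Eh: h => [//|h'] /=.
by rewrite -size_column // -/h Eh.
Qed.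

End BumpPaths.

Lemma size_flatten_corner (T : Type) (t : seq (seq T)) c x : partition_shaped t -> corner t c ->
  size (flatten (set_cell t c x)) = (size (flatten t)).+1.
Proof.
move=> pt cc; have c2 : c.2 = size (row t c.1) by case/andP: cc => /eqP.
have sumE (u : seq (seq T)) m : size u <= m -> size (flatten u) = \sum_(r < m) size (row u r).
  move=> um; rewrite size_flatten sumnE big_map (big_nth [::]) big_mkord.
  rewrite (big_ord_widen m (fun i => size (nth [::] u i)) um) [RHS](bigID (fun i : 'I_m => i < size u)) /=.
  rewrite [X in _ = _ + X]big1 ?addn0 // => i; rewrite -leqNgt => ui.
  by rewrite /row nth_default.
have le1 : size (set_cell t c x) <= (size t).+1.
  by rewrite size_set_cell geq_max ltnS (corner_row pt cc) /=.
rewrite (sumE _ _ le1) (sumE _ _ (leqnSn (size t))).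
under eq_bigr => i _ do rewrite (size_row_end x _ c2).
rewrite big_split /= -[RHS]addn1; congr (_ + _).
have cl : c.1 < (size t).+1 by rewrite ltnS corner_row.
by rewrite (bigD1 (Ordinal cl)) //= eqxx big1 // => i /negPf; rewrite -val_eqE /= => ->.
Qed.

Lemma corner_neq_col (T : Type) (t : seq (seq T)) p c : partition_shaped t ->
  corner t p -> corner t c -> p != c -> p.2 != c.2.
Proof.
move=> pt /(corner_column pt) p1 /(corner_column pt) c1; apply: contraNneq => e.
by case: p c p1 c1 e => [? ?] [? ?] /= <- <- ->.
Qed.

(** Fomin's rule as insertion exhibits it: two different cells are both added, and a cell reached
    twice is pushed on to the next line. *)
Lemma growth_cells (lam mu nu rho : nat -> nat) p c r :
  (forall r, mu r = rho r + (r == p)) -> (forall r, nu r = rho r + (r == c)) ->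
  (forall r, lam r = mu r + (r == if p == c then p.+1 else c)) ->
  lam r = maxn (mu r) (nu r) + (if r is r'.+1 then minn (mu r') (nu r') - rho r' else 0).
Proof.
move=> Hm Hn Hl; rewrite Hl; case: (eqVneq p c) => [pc|pc].
  by subst c; case: r => [|r]; rewrite !Hm !Hn maxnn // minnn addKn eqSS.
by case: r => [|r]; rewrite !Hm !Hn; move: pc; do !case: eqP => ? //; lia.
Qed.

Section MixedShape.

Variables (n : nat) (e : 'I_n -> entry) (y : 'I_n -> nat) (N : nat).
Hypothesis e_inj : injective e.
Hypothesis y_inj : injective y.
Hypothesis yN : forall i, y i <= N.
(** The link between entries and integer letters: in any set of places, a greatest entry has the
    greatest integer if it is unbarred and the least one if it is barred. *)
Hypothesis ey : forall i j, (e i <= e j)%O ->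
  if entry_barred (e j) then y j <= y i else y i <= y j.

Implicit Types (X : {set 'I_n}) (t : seq (seq entry)).

(** Complemented letters have the transposed shape, so columns of the mixed tableau can be treated
    like rows when the greatest entry is barred. *)
Let ny (i : 'I_n) := N - y i.

Definition mixed_tableau X :=
  foldl (fun t i => (insert t (e i)).1) [::] (enum_by (@nat_of_ord n) X).

Definition place_word X := word (@nat_of_ord n) y X.

Let ny_inj : injective ny.
Proof. by move=> i j /eqP; rewrite eqn_sub2lE // => /eqP /y_inj. Qed.

Lemma place_word_col X r c :
  (r < ins_shape (word (@nat_of_ord n) ny X) c) = (c < ins_shape (place_word X) r).
Proof. by rewrite shape_neg //; apply: ord_inj. Qed.

Definition is_last X i := i \in X /\ forall j : 'I_n, j \in X -> j <= i.
Definition is_greatest X b := b \in X /\ forall j, j \in X -> (e j <= e b)%O.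

Lemma mixed_tableau_last X i : is_last X i ->
  mixed_tableau X = (insert (mixed_tableau (X :\ i)) (e i)).1.
Proof.
case=> iX mX; rewrite /mixed_tableau (enum_by_last (@ord_inj n) iX mX).
by rewrite foldl_rcons.
Qed.

Definition has_shape (t : seq (seq entry)) X := forall r, size (row t r) = ins_shape (place_word X) r.

Lemma has_shapeP t X : (forall r c, (c < size (row t r)) = (c < ins_shape (place_word X) r)) ->
  has_shape t X.
Proof.
move=> H r; apply/eqP; rewrite eqn_leq; apply/andP; split; rewrite leqNgt; apply/negP.
  by rewrite H ltnn.
by rewrite -H ltnn.
Qed.

Lemma has_shape_col (t : seq (seq entry)) X : partition_shaped t ->
  (forall c, size (column t c) = ins_shape (word (@nat_of_ord n) ny X) c) -> has_shape t X.
Proof.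
by move=> pt H; apply: has_shapeP => r c; rewrite -size_column // H place_word_col.
Qed.

Lemma has_shape_size_column (t : seq (seq entry)) X c : partition_shaped t -> has_shape t X ->
  size (column t c) = ins_shape (word (@nat_of_ord n) ny X) c.
Proof.
move=> pt H; apply/eqP; rewrite eqn_leq; apply/andP; split; rewrite leqNgt; apply/negP.
  by rewrite size_column // H -place_word_col ltnn.
by rewrite place_word_col -H -size_column // ltnn.
Qed.

(** These facts are proved by one induction on the set: the growth step at [X] needs, for smaller
    sets, both the cell added by the last entry and the cell occupied by the greatest one, besides
    their shapes and the number of bumps. *)
Record mixed_ok X : Prop := MixedOk {
  mixed_partition : partition_shaped (mixed_tableau X);
  mixed_shape : has_shape (mixed_tableau X) X;
  mixed_entries : forall b, (forall i, i \in X -> (e i < b)%O) -> entries_lt b (mixed_tableau X);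
  mixed_size : size (flatten (mixed_tableau X)) = #|X|;
  mixed_greatest : forall b, is_greatest X b -> exists2 c,
    corner (mixed_tableau (X :\ b)) c & mixed_tableau X = set_cell (mixed_tableau (X :\ b)) c (e b);
  mixed_last : forall i, is_last X i -> exists m p,
    [/\ m < #|X|, bump_path m (mixed_tableau (X :\ i)) (e i) 0 (mixed_tableau X) p &
        insert (mixed_tableau (X :\ i)) (e i) = (mixed_tableau X, p)]
}.

Lemma exists_greatest X : X != set0 -> exists b, is_greatest X b.
Proof.
case/set0Pn=> i0 i0X; case: (@arg_maxP _ _ _ i0 (mem X) e i0X) => b bX mb.
by exists b.
Qed.

Lemma is_last_uniq X i j : is_last X i -> is_last X j -> i = j.
Proof.
case=> iX mi [jX mj]; apply: ord_inj; apply/eqP.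
by rewrite eqn_leq mi // mj.
Qed.

Lemma is_greatest_uniq X i j : is_greatest X i -> is_greatest X j -> i = j.
Proof.
case=> iX mi [jX mj]; apply: e_inj; apply/le_anti.
by rewrite mi // mj.
Qed.

Lemma mixed_okP X : mixed_ok X.
Proof.
have [k] := ubnP #|X|; elim: k X => // k IH X Xk.
have [X0|Xne] := eqVneq X set0.
  have E0 : enum_by (@nat_of_ord n) X = [::].
    by apply/eqP; rewrite -size_eq0 size_enum_by X0 cards0.
  have E : mixed_tableau X = [::] by rewrite /mixed_tableau E0.
  split; rewrite ?E //.
  - by move=> r; rewrite /place_word /word E0 /ins_shape /row !nth_nil.
  - by move=> b _ r c z; rewrite /cell /row nth_nil onth0n.
  - by rewrite X0 cards0.
  - by move=> b []; rewrite X0 inE.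
  - by move=> i []; rewrite X0 inE.
have [i iX mi] := exists_argmax (@nat_of_ord n) Xne; have il : is_last X i by [].
have [b bg] := exists_greatest Xne; have [bX mb] := bg.
have lt j : j \in X -> #|X :\ j| < k by move=> jX; move: Xk; rewrite (cardsD1 j) jX.
have [OKi OKb] := (IH _ (lt _ iX), IH _ (lt _ bX)).
have ltb j : j \in X -> j != b -> (e j < e b)%O.
  move=> jX jb; rewrite lt_neqAle mb // andbT; apply: contraNneq jb => /e_inj ->.
  by [].
have eb_lt : forall j, j \in X :\ b -> (e j < e b)%O.
  by move=> j; rewrite in_setD1 => /andP[jb jX]; apply: ltb.
have Nord := @ord_inj n.
suff [m [p [c [mX path cc sh]]]] : exists m p c,
   [/\ m <= #|X :\ i|, bump_path m (mixed_tableau (X :\ i)) (e i) 0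
         (set_cell (mixed_tableau (X :\ b)) c (e b)) p,
      corner (mixed_tableau (X :\ b)) c &
      has_shape (set_cell (mixed_tableau (X :\ b)) c (e b)) X].
  have Eins : insert (mixed_tableau (X :\ i)) (e i) =
      (set_cell (mixed_tableau (X :\ b)) c (e b), p).
    by apply: insert_rec_path path _; rewrite (mixed_size OKi).
  have E : mixed_tableau X = set_cell (mixed_tableau (X :\ b)) c (e b).
    by rewrite (mixed_tableau_last il) Eins.
  have c2 : c.2 = size (row (mixed_tableau (X :\ b)) c.1) by case/andP: cc => /eqP.
  split; rewrite ?E //.
  - exact: partition_shaped_corner (mixed_partition OKb) cc.
  - move=> d Xd; apply: entries_lt_set; rewrite ?c2 //; last exact: Xd.
    by apply: (mixed_entries OKb) => j; rewrite in_setD1 => /andP[_ /Xd].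
  - by rewrite size_flatten_corner ?(mixed_partition OKb) // (mixed_size OKb) (cardsD1 b X) bX.
  - by move=> b' b'g; rewrite -(is_greatest_uniq bg b'g); exists c.
  move=> i' i'l; rewrite -(is_last_uniq il i'l); exists m, p; split=> //.
  by rewrite (cardsD1 i X) iX.
(* A last entry that is also greatest bumps nothing and goes to the end of the first row or
   column. *)
have [ib|ib] := eqVneq i b.
  subst b; set T := mixed_tableau (X :\ i).
  have pT : partition_shaped T := mixed_partition OKi.
  have Tlt : entries_lt (e i) T by apply: (mixed_entries OKi).
  have cT := corner_line0 (e i) pT; set p := line_cell _ _ _ in cT.
  have p2 : p.2 = size (row T p.1) by case/andP: cT => /eqP.
  exists 0, p, p; split=> //.
    by apply: bump_end => //; rewrite bump_pos_max ?line_entries_lt // onth_default.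
  have eyX j : j \in X -> if entry_barred (e i) then y i <= y j else y j <= y i.
    by move=> jX; apply: ey; apply: mb.
  rewrite {}/p /line_cell /line in cT p2 *; case Eb: (entry_barred (e i)) cT p2 eyX => cT p2 eyX.
    apply: has_shape_col => [|c]; first exact: partition_shaped_corner.
    rewrite column_corner // (word_corner c Nord ny_inj iX) // => [|j jX]; last first.
      by rewrite /ny leq_sub2l // eyX.
    rewrite -(has_shape_size_column c pT (mixed_shape OKi)) /=.
    by case: eqP => _; rewrite ?size_rcons ?addn1 ?addn0.
  move=> r; rewrite /place_word (word_corner r Nord y_inj iX) //.
  by rewrite size_row_end // -/(place_word _) -(mixed_shape OKi).
have bXi : is_greatest (X :\ i) b.
  by split=> [|j]; rewrite in_setD1 ?bX ?andbT 1?eq_sym // => /andP[_ /mb].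
have iXb : is_last (X :\ b) i.
  by split=> [|j]; rewrite in_setD1 ?iX ?andbT // => /andP[_ /mi].
have Xib : X :\ b :\ i = X :\ i :\ b by rewrite setDDl setUC -setDDl.
have OKib : mixed_ok (X :\ i :\ b).
  by apply: IH; apply: leq_ltn_trans (lt _ iX); apply/subset_leq_card/subsetDl.
have [c cc Ec] := mixed_greatest OKi bXi.
have [m [p [mX path _]]] := mixed_last OKb iXb; rewrite Xib in path.
have pR := mixed_partition OKib.
have [pM cp szM] := bump_path_shape path pR.
have [] := bump_path_max path pR _ (ltb _ iX ib).
  apply: (mixed_entries OKib) => j; rewrite !in_setD1 => /and3P[jb _ jX].
  exact: ltb.
move=> _ /(_ c cc)[m' m'm]; rewrite -Ec => path'.
have m'X : m' <= #|X :\ i|.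
  apply: leq_trans m'm _; apply: leq_trans mX _.
  by move: (cardsD1 i X) (cardsD1 b X); rewrite iX bX !add1n => -> [->].
have pN := mixed_partition OKi.
have [R1 R2] : (forall r, size (row (mixed_tableau (X :\ i)) r) =
     size (row (mixed_tableau (X :\ i :\ b)) r) + (r == c.1)) /\
   (forall r, size (row (mixed_tableau (X :\ b)) r) =
     size (row (mixed_tableau (X :\ i :\ b)) r) + (r == p.1)).
  by split=> // r; rewrite Ec size_row_end //; case/andP: cc => /eqP.
(* The final cell of [b]: its old one, unless the insertion of the last entry would have ended there
   and drives [b] out. *)
pose q := if p == c then next_cell (e b) (mixed_tableau (X :\ b)) p else c.
have cq : corner (mixed_tableau (X :\ b)) q.
  rewrite /q; case: eqVneq => [pc|pc]; first exact: (next_cell_corner _ _ pR cp R2).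
  by apply: (corner_add cp cc _ R2); rewrite eq_sym.
exists m', (if p == c then q else p), q; split=> //.
  by move: path'; rewrite /q; case: (p == c).
have ptq := partition_shaped_corner (e b) (mixed_partition OKb) cq.
have eyX j : j \in X -> if entry_barred (e b) then y b <= y j else y j <= y b.
  by move=> jX; apply: ey; apply: mb.
(* A barred greatest entry is pushed to the next column, so the growth rule is checked on column
   lengths with complemented letters; the unbarred case below uses rows. *)
case Eb: (entry_barred (e b)) eyX => eyX.
  apply: has_shape_col => // k'.
  have nX j : j \in X -> ny j <= ny b by move=> jX; rewrite /ny leq_sub2l // eyX.
  have CE Z (OK : mixed_ok Z) k0 :
      ins_shape (word (@nat_of_ord n) ny Z) k0 = size (column (mixed_tableau Z) k0).
    by rewrite (has_shape_size_column _ (mixed_partition OK) (mixed_shape OK)).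
  have C0 t d x k0 : partition_shaped t -> corner t d ->
     size (column (set_cell t d x) k0) = size (column t k0) + (k0 == d.2).
    move=> pt cd; rewrite column_corner //; case: eqP => _; last by rewrite addn0.
    by rewrite size_rcons addn1.
  have C1 k0 : size (column (mixed_tableau (X :\ i)) k0) =
     size (column (mixed_tableau (X :\ i :\ b)) k0) + (k0 == c.2) by rewrite Ec C0.
  have C2 k0 : size (column (mixed_tableau (X :\ b)) k0) =
      size (column (mixed_tableau (X :\ i :\ b)) k0) + (k0 == p.2).
    rewrite -(C0 _ _ (e b) _ pR cp).
    apply: eq_size_column (mixed_partition OKb) (partition_shaped_corner _ pR cp) _ => r.
    by rewrite R2 size_row_end //; case/andP: cp => /eqP.
  have Cl k0 : size (column (set_cell (mixed_tableau (X :\ b)) q (e b)) k0) =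
     size (column (mixed_tableau (X :\ b)) k0) + (k0 == if p.2 == c.2 then p.2.+1 else c.2).
    rewrite C0 ?(mixed_partition OKb) // /q; congr (_ + (_ == _)).
    case: (eqVneq p c) => [->|pc]; last by rewrite (negPf (corner_neq_col pR cp cc pc)).
    by rewrite eqxx /next_cell /line_cell Eb.
  rewrite (growth_cells k' C2 C1 Cl) (word_growth k' Nord ny_inj iX mi bX nX ib) !CE //.
  by case: k' => [//|k']; rewrite !CE.
have RE Z (OK : mixed_ok Z) r :
    ins_shape (word (@nat_of_ord n) y Z) r = size (row (mixed_tableau Z) r).
  by rewrite (mixed_shape OK).
have Rl r : size (row (set_cell (mixed_tableau (X :\ b)) q (e b)) r) =
   size (row (mixed_tableau (X :\ b)) r) + (r == if p.1 == c.1 then p.1.+1 else c.1).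
  rewrite size_row_end; last by case/andP: cq => /eqP.
  rewrite /q; congr (_ + (_ == _)).
  case: (eqVneq p c) => [->|pc]; last by rewrite (negPf (corner_neq_row cp cc pc)).
  by rewrite eqxx /next_cell /line_cell Eb.
move=> r; rewrite (growth_cells r R2 R1 Rl) /place_word.
rewrite (word_growth r Nord y_inj iX mi bX eyX ib) !RE //.
by case: r => [//|r]; rewrite !RE.
Qed.

End MixedShape.

(** * Standardization *)

Section Ranks.

Variables (n : nat) (w : n.-tuple letter).
Implicit Types (i j : 'I_n).

Notation e := (entry_at w).

Lemma entry_at_inj : injective e.
Proof. by move=> i j [_ /ord_inj]. Qed.

Lemma std_rank_gt0 i : 0 < std_rank w i.
Proof. by rewrite card_gt0; apply/set0Pn; exists i; rewrite inE lexx. Qed.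

Lemma std_rank_le_n i : std_rank w i <= n.
Proof. by rewrite -[X in _ <= X]card_ord max_card. Qed.

Lemma std_rank_lt i j : (e i < e j)%O -> std_rank w i < std_rank w j.
Proof.
move=> ij; apply/proper_card/properP; split.
  by apply/subsetP => k; rewrite !inE => /le_trans; apply; apply: ltW.
by exists j; rewrite !inE ?lexx // -ltNge.
Qed.

Lemma std_rank_leE i j : (std_rank w i <= std_rank w j) = (e i <= e j)%O.
Proof.
case: (leP (e i) (e j)) => [ij|/std_rank_lt]; last by rewrite ltnNge => /negbTE.
by move: ij; rewrite le_eqVlt => /orP[/eqP/entry_at_inj->|/std_rank_lt/ltnW->]; rewrite ?leqnn.
Qed.

Lemma std_rank_inj : injective (std_rank w).
Proof.
move=> i j ij; apply: entry_at_inj; apply/le_anti.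
by rewrite -!std_rank_leE ij leqnn.
Qed.

Lemma exists_std_rank k : 0 < k -> k <= n -> exists i, std_rank w i = k.
Proof.
move=> k0 kn.
have lt i : (std_rank w i).-1 < n.
  by have := std_rank_le_n i; have := std_rank_gt0 i; case: (std_rank w i).
pose f i := Ordinal (lt i).
have fI : injective f.
  move=> i j /(congr1 val) /= ij; apply: std_rank_inj.
  by have := std_rank_gt0 i; have := std_rank_gt0 j; move: ij; clear; lia.
have kn' : k.-1 < n by case: (k) k0 kn.
have [g _ gK] := injF_bij fI; exists (g (Ordinal kn')).
have := congr1 val (gK (Ordinal kn')); rewrite /= => E.
have := std_rank_gt0 (g (Ordinal kn')).
by move: E k0; clear; lia.
Qed.

(** [signed_std w], shifted by [n] to be a natural number. *)
Definition key i : nat :=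
  if barred (tnth w i) then n - std_rank w i else n + std_rank w i.

Lemma key_inj : injective key.
Proof.
move=> i j E; apply: std_rank_inj; move: E; rewrite /key.
have := std_rank_gt0 i; have := std_rank_le_n i.
have := std_rank_gt0 j; have := std_rank_le_n j.
by case: (barred _); case: (barred _); clear; lia.
Qed.

Lemma key_le i : key i <= n + n.
Proof.
by rewrite /key; have := std_rank_le_n i; case: (barred _); clear; lia.
Qed.

Lemma key_signed_std i j : (key i < key j) = (signed_std w i < signed_std w j)%R.
Proof.
rewrite /key /signed_std.
have := std_rank_gt0 i; have := std_rank_le_n i.
have := std_rank_gt0 j; have := std_rank_le_n j.
by case: (barred _); case: (barred _); clear; lia.
Qed.

Lemma key_entry i j : (e i <= e j)%O ->
  if entry_barred (e j) then key j <= key i else key i <= key j.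
Proof.
rewrite -std_rank_leE /key /entry_barred /=.
have := std_rank_gt0 i; have := std_rank_le_n i.
have := std_rank_gt0 j; have := std_rank_le_n j.
by case: (barred _); case: (barred _); clear; lia.
Qed.

Definition smallest k : {set 'I_n} := [set i | std_rank w i <= k].

Lemma smallest_greatest i : is_greatest e (smallest (std_rank w i)) i.
Proof. by split=> [|j]; rewrite inE // std_rank_leE. Qed.

Lemma smallestD1 i : smallest (std_rank w i) :\ i = smallest (std_rank w i).-1.
Proof.
apply/setP => j; rewrite in_setD1 !inE -(inj_eq std_rank_inj).
by have := std_rank_gt0 i; clear; lia.
Qed.

Lemma smallest_n : smallest n = setT.
Proof. by apply/setP => i; rewrite !inE std_rank_le_n. Qed.

Lemma smallest0 : smallest 0 = set0.
Proof. by apply/setP => i; rewrite !inE leqNgt std_rank_gt0. Qed.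

Definition tableau_of := mixed_tableau e.

Lemma tableau_ok X : mixed_ok e key X.
Proof. exact: mixed_okP entry_at_inj key_inj key_le key_entry X. Qed.

Definition rs_shape X := ins_shape (word (@nat_of_ord n) key X).

Lemma tableau_partition X : partition_shaped (tableau_of X).
Proof. exact: mixed_partition (tableau_ok X). Qed.

Lemma tableau_shape X r : size (row (tableau_of X) r) = rs_shape X r.
Proof. exact: mixed_shape (tableau_ok X) r. Qed.

Lemma tableau_step i : exists2 c, corner (tableau_of (smallest (std_rank w i).-1)) c &
  tableau_of (smallest (std_rank w i)) =
    set_cell (tableau_of (smallest (std_rank w i).-1)) c (e i).
Proof.
rewrite -smallestD1; apply: mixed_greatest (tableau_ok _) _ _.
exact: smallest_greatest.
Qed.

Lemma size_tableau X : size (tableau_of X) = size (schensted (word (@nat_of_ord n) key X)).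
Proof.
have H r : (r < size (tableau_of X)) = (r < size (schensted (word (@nat_of_ord n) key X))).
  rewrite -row_gt0 ?tableau_partition // tableau_shape /rs_shape /ins_shape.
  have /and3P[_ _ neT] := schensted_tableau (word (@nat_of_ord n) key X).
  case: (ltnP r (size (schensted _))) => rs; last by rewrite nth_default.
  by rewrite lt0n size_eq0; apply: contraNneq neT => <-; apply: mem_nth.
by apply/eqP; rewrite eqn_leq; apply/andP; split; rewrite leqNgt; apply/negP; rewrite -?H ?ltnn // H ltnn.
Qed.

Lemma enum_by_setT : enum_by (@nat_of_ord n) setT = enum 'I_n.
Proof.
apply: enum_by_eq; first exact: ord_inj; last by move=> i; rewrite mem_enum in_setT.
by rewrite -sorted_map val_enum_ord iota_ltn_sorted.
Qed.

Lemma zip_entries : zip w (iota 0 n) = [seq e i | i <- enum 'I_n].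
Proof. by rewrite -{1}(map_tnth_enum w) -val_enum_ord zip_map. Qed.

Lemma mixed_insertion1 : (mixed_insertion w).1 = tableau_of setT.
Proof.
rewrite /mixed_insertion size_tuple zip_entries /tableau_of /mixed_tableau enum_by_setT.
elim/last_ind: (enum 'I_n) => //= s i IH.
rewrite map_rcons !foldl_rcons -IH; case: foldl => t q /=.
by rewrite /mixed_step /=; case: insert.
Qed.

End Ranks.

Lemma corner_uniq (T T' : Type) (t t1 : seq (seq T)) (t' t1' : seq (seq T')) c c' :
  corner t c -> corner t' c' ->
  (forall r, size (row t1 r) = size (row t r) + (r == c.1)) ->
  (forall r, size (row t1' r) = size (row t' r) + (r == c'.1)) ->
  (forall r, size (row t r) = size (row t' r)) ->
  (forall r, size (row t1 r) = size (row t1' r)) -> c = c'.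
Proof.
move=> /andP[/eqP c2 _] /andP[/eqP c2' _] H H' E E1.
have c11 : c.1 = c'.1.
  apply/eqP; move: (E1 c.1); rewrite H H' E eqxx => /eqP.
  by rewrite eqn_add2l; case: (c.1 == c'.1).
by case: c c' c2 c2' c11 {H H'} => [? ?] [? ?] /= -> -> ->; rewrite E.
Qed.

(** * Comparing the mixed tableaux of two words *)

Section TwoWords.

Variables (n : nat) (w w' : n.-tuple letter).

Definition initial k : {set 'I_n} := [set i : 'I_n | i < k].

Lemma prefix_last (i : 'I_n) : is_last (initial i.+1) i.
Proof. by split=> [|j]; rewrite inE ?ltnS. Qed.

Lemma prefixD1 (i : 'I_n) : initial i.+1 :\ i = initial i.
Proof.
apply/setP => j; rewrite in_setD1 !inE ltnS [j < i]ltn_neqAle; congr (_ && _).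
Qed.

Lemma prefix0 : initial 0 = set0.
Proof. by apply/setP => i; rewrite !inE. Qed.

Lemma tableau_insert (v : n.-tuple letter) (i : 'I_n) : exists p,
  [/\ insert (tableau_of v (initial i)) (entry_at v i) = (tableau_of v (initial i.+1), p),
      corner (tableau_of v (initial i)) p &
      forall r, size (row (tableau_of v (initial i.+1)) r) =
                size (row (tableau_of v (initial i)) r) + (r == p.1)].
Proof.
have [m [p [_ path Ep]]] := mixed_last (tableau_ok v _) (prefix_last i).
rewrite prefixD1 in path Ep; exists p.
by have [_ cp sz] := bump_path_shape path (tableau_partition v _); split.
Qed.

Lemma foldl_prefix (v : n.-tuple letter) k : k <= n ->
  (foldl mixed_step ([::], [::]) (map (entry_at v) (take k (enum 'I_n)))).1 =
    tableau_of v (initial k).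
Proof.
elim: k => [|k IH] kn.
  rewrite take0 /= /tableau_of /mixed_tableau prefix0.
  by have /size0nil-> : size (enum_by (@nat_of_ord n) set0) = 0 by rewrite size_enum_by cards0.
have -> : take k.+1 (enum 'I_n) = rcons (take k (enum 'I_n)) (Ordinal kn).
  by rewrite (take_nth (Ordinal kn)) ?size_enum_ord //;
   congr rcons; apply: val_inj; rewrite /= nth_enum_ord.
rewrite map_rcons foldl_rcons; have [p [Ep _ _]] := tableau_insert v (Ordinal kn).
case: foldl (IH (ltnW kn)) => t q /= ->.
by rewrite /mixed_step /= Ep.
Qed.

(** Each recorded cell is the difference of two consecutive prefix shapes, whatever the entries
    are. *)
Lemma Qm_eq : (forall k r, k <= n -> rs_shape w (initial k) r = rs_shape w' (initial k) r) ->
  Qm w = Qm w'.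
Proof.
move=> H; rewrite /Qm /mixed_insertion !size_tuple !zip_entries.
suff E k : k <= n ->
   (foldl mixed_step ([::], [::]) (map (entry_at w) (take k (enum 'I_n)))).2 =
   (foldl mixed_step ([::], [::]) (map (entry_at w') (take k (enum 'I_n)))).2.
  by have := E n (leqnn n); rewrite take_oversize // size_enum_ord.
elim: k => [|k IH] kn; first by rewrite take0.
have -> : take k.+1 (enum 'I_n) = rcons (take k (enum 'I_n)) (Ordinal kn).
  by rewrite (take_nth (Ordinal kn)) ?size_enum_ord //;
   congr rcons; apply: val_inj; rewrite /= nth_enum_ord.
rewrite !map_rcons !foldl_rcons.
have [p [Ep cp sp]] := tableau_insert w (Ordinal kn).
have [p' [Ep' cp' sp']] := tableau_insert w' (Ordinal kn).
have := foldl_prefix w (ltnW kn); have := foldl_prefix w' (ltnW kn).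
case: foldl (IH (ltnW kn)) => t q; case: foldl => t' q' /= -> -> ->.
rewrite /mixed_step /= Ep Ep' /=; congr set_cell.
apply: (corner_uniq cp cp' sp sp') => r; rewrite !tableau_shape H //.
exact: ltnW.
Qed.

(** Two words whose letters, taken in the order of their entries, are the same
    except at one rank [std_rank w p], and whose shapes agree. *)
Variables (s : 'I_n -> 'I_n) (p : 'I_n).
Hypothesis rank_s : forall i, std_rank w' (s i) = std_rank w i.
Hypothesis letter_s : forall i, i != p -> tnth w' (s i) = tnth w i.
Hypothesis shape_s : forall k r, k <= n ->
  rs_shape w' (smallest w' k) r = rs_shape w (smallest w k) r.

(** Places are forgotten: letters of the same rank sit at different places in the two words. *)
Definition letter_tableau (v : n.-tuple letter) k :=
  map (map (fun x : entry => x.1)) (tableau_of v (smallest v k)).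

Lemma cell_map (T1 T2 : Type) (f : T1 -> T2) (t : seq (seq T1)) r c :
  cell (map (map f) t) r c = omap f (cell t r c).
Proof.
rewrite /cell -onth_map; congr onth; rewrite /row.
case: (ltnP r (size t)) => rt; first by rewrite (nth_map [::]).
by rewrite !nth_default ?size_map.
Qed.

Lemma size_row_map (T1 T2 : Type) (f : T1 -> T2) (t : seq (seq T1)) r :
  size (row (map (map f) t) r) = size (row t r).
Proof.
rewrite /row; case: (ltnP r (size t)) => rt; first by rewrite (nth_map [::]) ?size_map.
by rewrite !nth_default ?size_map.
Qed.

Lemma partition_shaped_map (T1 T2 : Type) (f : T1 -> T2) (t : seq (seq T1)) :
  partition_shaped t -> partition_shaped (map (map f) t).
Proof.
move=> pt; apply: partition_shapedP => r; rewrite !size_row_map ?row_leS //.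
by rewrite size_map row_gt0.
Qed.

Lemma corner_map (T1 T2 : Type) (f : T1 -> T2) (t : seq (seq T1)) c :
  corner (map (map f) t) c = corner t c.
Proof. by rewrite /corner !size_row_map. Qed.

Lemma map_set_cell (T1 T2 : Type) (f : T1 -> T2) (t : seq (seq T1)) c x :
  partition_shaped t -> corner t c ->
  map (map f) (set_cell t c x) = set_cell (map (map f) t) c (f x).
Proof.
move=> pt cc; apply: eq_cells.
- exact/partition_shaped_map/partition_shaped_corner.
- by apply: partition_shaped_corner; rewrite ?corner_map //; apply: partition_shaped_map.
have /eqP c2 : c.2 == size (row t c.1) by case/andP: cc.
move=> r k; rewrite cell_map !cell_set_cell ?size_row_map ?c2 //.
by rewrite cell_map; case: (_ == c).
Qed.

Lemma letter_step (v : n.-tuple letter) i : exists c,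
  [/\ corner (tableau_of v (smallest v (std_rank v i).-1)) c,
      forall r, size (row (tableau_of v (smallest v (std_rank v i))) r) =
        size (row (tableau_of v (smallest v (std_rank v i).-1)) r) + (r == c.1) &
      letter_tableau v (std_rank v i) =
        set_cell (letter_tableau v (std_rank v i).-1) c (tnth v i)].
Proof.
have [c cc E] := tableau_step v i; exists c; split=> // [r|].
  by rewrite E size_row_end //; case/andP: cc => /eqP.
by rewrite /letter_tableau E map_set_cell //; apply: tableau_partition.
Qed.

Lemma letter_partition (v : n.-tuple letter) k : partition_shaped (letter_tableau v k).
Proof. exact/partition_shaped_map/tableau_partition. Qed.

Lemma letter_step2 i : exists c,
  [/\ corner (letter_tableau w (std_rank w i).-1) c,
      corner (letter_tableau w' (std_rank w i).-1) c,
      letter_tableau w (std_rank w i) =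
        set_cell (letter_tableau w (std_rank w i).-1) c (tnth w i) &
      letter_tableau w' (std_rank w i) =
        set_cell (letter_tableau w' (std_rank w i).-1) c (tnth w' (s i))].
Proof.
have [c [cc sz E]] := letter_step w i.
have [c' [cc' sz' E']] := letter_step w' (s i); rewrite rank_s in cc' sz' E'.
have le1 := std_rank_le_n w i; have le2 := leq_trans (leq_pred _) le1.
have cE : c' = c.
  by apply: (corner_uniq cc' cc sz' sz) => r; rewrite !tableau_shape shape_s.
by subst c'; exists c; rewrite !corner_map.
Qed.

Lemma letter_tableau_n (v : n.-tuple letter) : letter_tableau v n = Pm v.
Proof. by rewrite /letter_tableau smallest_n /Pm mixed_insertion1. Qed.

Lemma letter_tableau_before k : k < std_rank w p ->
  letter_tableau w' k = letter_tableau w k.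
Proof.
elim: k => [|k IH] kp.
  rewrite /letter_tableau /tableau_of /mixed_tableau !smallest0.
  by have /size0nil-> : size (enum_by (@nat_of_ord n) set0) = 0 by rewrite size_enum_by cards0.
have [i Ei] := exists_std_rank w (ltn0Sn k) (leq_trans (ltnW kp) (std_rank_le_n w p)).
have [c [_ _ E E']] := letter_step2 i; rewrite Ei /= in E E'.
rewrite E E' IH ?(ltnW kp) // letter_s //.
by apply: contraTneq kp => ip; rewrite -Ei ip ltnn.
Qed.

(** Later letters, being greater, are added in other cells and leave [c] alone, so the tableaux keep
    differing there only. If [c] opened a new row it is the foot of the first column. Recovering
    either tableau from the other serves both directions of the theorem. *)
Lemma letter_tableau_after : exists c, forall k, std_rank w p <= k -> k <= n ->
  [/\ c.2 < size (row (letter_tableau w k) c.1),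
     letter_tableau w' k = set_cell (letter_tableau w k) c (tnth w' (s p)),
     letter_tableau w k = set_cell (letter_tableau w' k) c (tnth w p) &
     size (letter_tableau w (std_rank w p).-1) < size (letter_tableau w (std_rank w p)) ->
     c = ((size (letter_tableau w (std_rank w p))).-1, 0)].
Proof.
have [c [cc cc' E E']] := letter_step2 p; exists c.
have before : letter_tableau w' (std_rank w p).-1 = letter_tableau w (std_rank w p).-1.
  by apply: letter_tableau_before; have := std_rank_gt0 w p; case: std_rank.
have c2 : c.2 = size (row (letter_tableau w (std_rank w p).-1) c.1) by case/andP: cc => /eqP.
have corner_eq : size (letter_tableau w (std_rank w p).-1) < size (letter_tableau w (std_rank w p)) ->
     c = ((size (letter_tableau w (std_rank w p))).-1, 0).
  rewrite E size_set_cell leq_max ltnn orbF ltnS => le.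
  have c1 : c.1 = size (letter_tableau w (std_rank w p).-1).
    by apply/eqP; rewrite eqn_leq le andbT; apply: corner_row cc; apply: letter_partition.
  case: c c1 c2 {E' cc' cc E le} => c1_ c2_ /= c1 ->.
  by rewrite c1 /row nth_default // (maxn_idPl _).
elim=> [|k IH]; first by rewrite leqn0; have := std_rank_gt0 w p; case: std_rank.
rewrite leq_eqVlt => /orP[/eqP<-|kp] kn.
  split=> //.
  - by rewrite E size_row_end // eqxx -c2 addn1.
  - by rewrite E E' before set_cell_overwrite //; apply: letter_partition.
  - by rewrite E E' before set_cell_overwrite //; apply: letter_partition.
have [ins Ek Ek' _] := IH kp (ltnW kn).
have [i Ei] := exists_std_rank w (ltn0Sn k) kn.
have [d [cd cd' F F']] := letter_step2 i; rewrite Ei /= in F F' cd cd'.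
have ip : i != p by apply: contraTneq kp => ip; rewrite -ip Ei ltnn.
rewrite letter_s // in F'.
have dc : c != d.
  by apply: contraTneq ins => ->; case/andP: cd => /eqP-> _; rewrite ltnn.
have d2 : d.2 = size (row (letter_tableau w k) d.1) by case/andP: cd => /eqP.
have ins' : c.2 < size (row (letter_tableau w' k) c.1) by rewrite Ek size_row_inside.
split=> //.
- by rewrite F size_row_end // (leq_trans ins) // leq_addr.
- by rewrite F F' Ek -set_cellC //; [apply: letter_partition | left].
- by rewrite F F' {1}Ek' -set_cellC //; [apply: letter_partition | left].
Qed.

Lemma SW_entryE (T : Type) (t : seq (seq T)) : partition_shaped t ->
  SW_entry t = cell t (size t).-1 0 /\ SW_cell t = ((size t).-1, 0).
Proof.
move=> pt; have hc : size (column t 0) = size t.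
  have H r : (r < size (column t 0)) = (r < size t) by rewrite size_column // row_gt0.
  by apply/eqP; rewrite eqn_leq; apply/andP; split; rewrite leqNgt; apply/negP; rewrite ?H ?ltnn // -H ltnn.
split; last by rewrite /SW_cell hc.
rewrite -onth_column // /SW_entry -hc.
case/lastP: (column t 0) => [|u x] //; rewrite rev_rcons size_rcons /=.
by rewrite -cats1 onth_cat ltnn subnn.
Qed.

Lemma Pm_eq :
  size (letter_tableau w (std_rank w p).-1) < size (letter_tableau w (std_rank w p)) ->
  size (letter_tableau w (std_rank w p)) = size (Pm w) ->
  [/\ SW_entry (Pm w) = Some (tnth w p), SW_entry (Pm w') = Some (tnth w' (s p)),
      Pm w' = set_cell (Pm w) (SW_cell (Pm w)) (tnth w' (s p)) &
      Pm w = set_cell (Pm w') (SW_cell (Pm w')) (tnth w p)].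
Proof.
move=> lt szE; have [c Hc] := letter_tableau_after.
have [] := Hc n (std_rank_le_n w p) (leqnn n); rewrite !letter_tableau_n.
move=> ins E E' /(_ lt); rewrite szE => cE.
have pw : partition_shaped (Pm w) by rewrite -letter_tableau_n; apply: letter_partition.
have pw' : partition_shaped (Pm w') by rewrite -letter_tableau_n; apply: letter_partition.
have sz : size (Pm w') = size (Pm w).
  rewrite {1}E size_set_cell (maxn_idPr _) // -row_gt0 //.
  exact: leq_ltn_trans ins.
have [S1 S2] := SW_entryE pw; have [S1' S2'] := SW_entryE pw'.
rewrite S1 S2 S1' S2' sz -cE; split=> //.
  by rewrite [X in cell X _ _]E' cell_set_cell ?cE ?eqxx // -?cE E size_row_inside // ltnW.
by rewrite [X in cell X _ _]E cell_set_cell ?cE ?eqxx // -?cE ltnW.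
Qed.

End TwoWords.

(** * Longest decreasing subwords as chains of places *)

Section Chains.

Variable I : finType.
Implicit Types (f g : I -> nat) (X Y : {set I}) (a c : seq I).

(** Decreasing subwords, as lists of places in the order of [f], of the word
    whose letters are given by [g]. *)
Definition dec_rel f g : rel I := fun i j => (f i < f j) && (g j < g i).

Definition chain f g X c := sorted (dec_rel f g) c && all (mem X) c.

Lemma dec_rel_trans f g : transitive (dec_rel f g).
Proof.
move=> j i k /andP[fij gij] /andP[fjk gjk].
by rewrite /dec_rel (ltn_trans fij fjk) (ltn_trans gjk gij).
Qed.

Lemma chain_pairwise f g X c :
  chain f g X c = pairwise (dec_rel f g) c && all (mem X) c.
Proof. by rewrite /chain (sorted_pairwise (@dec_rel_trans f g)). Qed.

Lemma chain_catP f g X u v : reflect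
  [/\ chain f g X u, chain f g X v &
      forall i j, i \in u -> j \in v -> (f i < f j) && (g j < g i)]
  (chain f g X (u ++ v)).
Proof.
rewrite !chain_pairwise pairwise_cat all_cat.
apply: (iffP andP) => [[/and3P[/allrelP uv -> ->] /andP[-> ->]]|]; first by split.
case=> /andP[-> ->] /andP[-> ->] uv; rewrite !andbT; split=> //.
exact/allrelP.
Qed.

Lemma chain1 f g X i : chain f g X [:: i] = (i \in X).
Proof. by rewrite /chain /= andbT. Qed.

Lemma chain_rev f g X c : chain g f X (rev c) = chain f g X c.
Proof.
rewrite /chain rev_sorted all_rev; congr (_ && _).
by apply: eq_sorted => i j; rewrite /dec_rel andbC.
Qed.

Lemma chain_uniq f g X c : chain f g X c -> uniq c.
Proof.
rewrite chain_pairwise => /andP[pw _]; apply: pairwise_uniq pw => i.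
by rewrite /dec_rel ltnn.
Qed.

Lemma chain_size f g X c : chain f g X c -> size c <= #|X|.
Proof.
move=> cc; rewrite -(card_uniqP (chain_uniq cc)); apply/subset_leq_card/subsetP.
by case/andP: cc => _ /allP cX i /cX.
Qed.

Lemma chain_subset f g X Y c : X \subset Y -> chain f g X c -> chain f g Y c.
Proof.
move=> /subsetP XY /andP[s /allP cX]; rewrite /chain s; apply/allP => i /cX.
exact: XY.
Qed.

Lemma subseq_map (T1 : eqType) (T2 : eqType) (h : T1 -> T2) s b : subseq b (map h s) ->
  exists2 c, subseq c s & b = map h c.
Proof.
case/subseqP=> m _ ->; exists (mask m s); first exact: mask_subseq.
by rewrite map_mask.
Qed.

Lemma chain_enum_by f g X c : injective f -> chain f g X c ->
  [seq i <- enum_by f X | i \in c] = c.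
Proof.
move=> fI cc; apply: (@irr_sorted_eq _ (relpre f ltn)).
- by move=> ? ? ?; apply: ltn_trans.
- by move=> ?; apply: ltnn.
- apply: sorted_filter; last exact: enum_by_sorted.
  by move=> ? ? ?; apply: ltn_trans.
- by case/andP: cc => s _; apply: sub_sorted s => i j /andP[].
move=> i; rewrite mem_filter mem_enum_by; case ic: (i \in c) => //=.
by case/andP: cc => _ /allP/(_ i ic).
Qed.

(** Comparing both coordinates makes the notion symmetric, so it passes to the inverse word by
    reversing the list. *)
Definition rightmost_chain f g X a := chain f g X a /\
  forall c, chain f g X c -> size c <= size a /\
    (size c = size a -> all2 (fun i j => (f i <= f j) && (g i <= g j)) c a).

Lemma all2_rev (T1 T2 : Type) (r : T1 -> T2 -> bool) s t : size s = size t ->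
  all2 r (rev s) (rev t) = all2 r s t.
Proof.
elim: s t => [|x s IH] [|y t] //= [st]; rewrite !rev_cons -!cats1.
by rewrite all2_cat_eqsize ?size_rev //= andbT IH // andbC.
Qed.

Lemma rightmost_chain_sym f g X a : rightmost_chain f g X a ->
  rightmost_chain g f X (rev a).
Proof.
case=> ca H; split=> [|c]; first by rewrite chain_rev.
rewrite -[c]revK chain_rev => /H; rewrite !size_rev => -[le e]; split=> // sz.
rewrite all2_rev ?size_rev //; have := e sz.
by congr is_true; elim: (rev c) (a) => [|x s IH] [|z t] //=; rewrite IH [(_ <= _) && _]andbC.
Qed.

Lemma shift_points g (m : pred I) (h : I) (mv : I -> I) s :
  path (fun i j => mv j == i) h (filter m s) ->
  {in s, forall i, ~~ m i -> mv i = i} ->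
  shift [:: g h] [seq (g i, m i) | i <- s] =
    [seq g (mv i) | i <- s] ++ [:: g (last h (filter m s))].
Proof.
elim: s h => [|i s IH] h //= pm fixm; have fixs : {in s, forall i, ~~ m i -> mv i = i}.
  by move=> j js; apply: fixm; rewrite inE js orbT.
case mi: (m i) pm => pm.
  have /andP[/eqP th pm'] : (mv i == h) && path (fun i j => mv j == i) i (filter m s) := pm.
  by rewrite shift_cons IH // th.
rewrite -/(unmarked [:: g i] ++ _) -[_ :: map _ _]/(unmarked [:: g i] ++ _) shift_unmarked IH //=.
by rewrite fixm ?mi // inE eqxx.
Qed.

(** Here [mv] points backwards: a place receives the letter of the place [mv] sends it to. The first
    marked place [h] receives nothing and is dropped, and the last marked letter goes to the end. *)
Lemma shift_points0 g (m : pred I) (h : I) (mv : I -> I) a s : uniq s ->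
  filter m s = h :: a -> path (fun i j => mv j == i) h a ->
  {in s, forall i, ~~ m i -> mv i = i} ->
  shift [::] [seq (g i, m i) | i <- s] =
    [seq g (mv i) | i <- s & i != h] ++ [:: g (last h a)].
Proof.
elim: s => [|i s IH] //= /andP[is_ Us]; have fixs : {in i :: s, forall i, ~~ m i -> mv i = i} ->
   {in s, forall i, ~~ m i -> mv i = i}.
  by move=> H j js; apply: H; rewrite inE js orbT.
case mi: (m i) => Ea pa fixm.
  case: Ea => ih Ea; subst i; rewrite shift_cons eqxx /= (shift_points g (mv := mv)) ?Ea //; last exact: fixs.
  congr (_ ++ _); congr map; apply/esym/all_filterP/allP => j js.
  by apply: contraNneq is_ => <-.
have ih : i != h.
  apply: contraFneq mi => ->; have : h \in filter m s by rewrite Ea inE eqxx.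
  by rewrite mem_filter => /andP[].
rewrite ih -[_ :: map _ _]/(unmarked [:: g i] ++ _) shift_unmarked IH //; last exact: fixs.
by rewrite /= fixm ?mi // inE eqxx.
Qed.

Lemma knuth_rightmost f g X h a (mv : I -> I) : injective f -> injective g ->
  rightmost_chain f g X (h :: a) ->
  path (fun i j => mv j == i) h a -> (forall i, i \notin h :: a -> mv i = i) ->
  knuth (word f g X)
    ([seq g (mv i) | i <- enum_by f X & i != h] ++ [:: g (last h a)]).
Proof.
move=> fI gI [ca best] pa fixa.
pose mw : mword := [seq (g i, i \in h :: a) | i <- enum_by f X].
have lmw : letters mw = word f g X by rewrite /letters /mw -map_comp.
have fE := chain_enum_by fI ca.
have mmw : marked mw = map g (h :: a).
  by rewrite /marked /mw filter_map -map_comp -[in RHS]fE.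
have chain_dec c : chain f g X c -> dec (map g c).
  rewrite chain_pairwise /dec pairwise_map => /andP[pw _].
  by apply: sub_pairwise pw => i j /andP[].
have RM : rightmost_mark mw.
  split; rewrite ?lmw ?mmw; first exact: word_uniq.
    exact: chain_dec.
  move=> b /subseq_map[c cs ->] db.
  have cc : chain f g X c.
    rewrite chain_pairwise; apply/andP; split; last first.
      by apply/allP => i /(mem_subseq cs); rewrite mem_enum_by.
    have := subseq_pairwise cs (pairwise_enum_by X fI).
    move: db; rewrite /dec pairwise_map => dg df.
    by have := pairwise_relI (relpre f ltn) (relpre g gtn) c; rewrite df dg.
  have [le e] := best c cc; rewrite !size_map; split=> // /e.
  by elim: (c) (h :: a) => [|x s IH] [|z t] //= /andP[/andP[_ ->] /IH].
have := knuth_shift RM; rewrite lmw /mw (shift_points0 _ (h := h) (a := a) (mv := mv)) //.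
  exact: enum_by_uniq.
by move=> i _; apply: fixa.
Qed.

End Chains.

(** * Existence and tie-freeness of rightmost chains *)

Section Rightmost.

Variables (I : finType) (f g : I -> nat) (X : {set I}).
Hypotheses (f_inj : injective f) (g_inj : injective g).
Implicit Types (a b c : seq I) (i j : I).

Lemma chain_subseq b a : subseq b a -> chain f g X a -> chain f g X b.
Proof.
move=> ba /andP[s /allP aX]; apply/andP; split.
  exact: subseq_sorted (@dec_rel_trans I f g) _ _ ba s.
by apply/allP => i /(mem_subseq ba)/aX.
Qed.

Lemma chain_nth i0 a k l : chain f g X a -> k < l -> l < size a ->
  f (nth i0 a k) < f (nth i0 a l) /\ g (nth i0 a l) < g (nth i0 a k).
Proof.
rewrite chain_pairwise => /andP[/(pairwiseP i0) pw _] kl la.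
by have /andP[] := pw k l (ltn_trans kl la) la kl.
Qed.

Lemma chain_nth_le i0 a k l : chain f g X a -> k <= l -> l < size a ->
  f (nth i0 a k) <= f (nth i0 a l) /\ g (nth i0 a l) <= g (nth i0 a k).
Proof.
move=> ca; rewrite leq_eqVlt => /orP[/eqP->//|kl] la.
by have [/ltnW ? /ltnW] := chain_nth i0 ca kl la.
Qed.

Lemma chain_splice i0 a b k : chain f g X a -> chain f g X b ->
  k < size a -> k < size b ->
  f (nth i0 a k) < f (nth i0 b k) -> g (nth i0 b k) < g (nth i0 a k) ->
  chain f g X (take k.+1 a ++ drop k b).
Proof.
move=> ca cb ka kb fk gk; apply/chain_catP; split.
- exact: chain_subseq (take_subseq _ _) ca.
- exact: chain_subseq (drop_subseq _ _) cb.
move=> i j /(nthP i0)[l]; rewrite size_take_min ltn_min => /andP[lk la] <-.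
move=> /(nthP i0)[m]; rewrite size_drop => mb <-; rewrite nth_take // nth_drop.
rewrite ltnS in lk; have [fa ga] := chain_nth_le i0 ca lk ka.
have kmb : k + m < size b by rewrite -ltn_subRL.
have [fb gb] := chain_nth_le i0 cb (leq_addr m k) kmb.
apply/andP; split; first exact: leq_ltn_trans fa (leq_trans fk fb).
exact: leq_ltn_trans gb (leq_trans gk ga).
Qed.

Definition longest a := chain f g X a /\ forall c, chain f g X c -> size c <= size a.

(** Otherwise [a] up to index [k], followed by [b] from index [k] on, would be a chain with one more
    point. *)
Lemma longest_agree i0 a b k : longest a -> longest b -> k < size a ->
  f (nth i0 a k) < f (nth i0 b k) -> g (nth i0 a k) < g (nth i0 b k).
Proof.
move=> [ca ma] [cb mb] ka fk.
have sab : size a = size b by apply/eqP; rewrite eqn_leq ma // mb.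
have kb : k < size b by rewrite -sab.
case: (ltngtP (g (nth i0 a k)) (g (nth i0 b k))) => // [gk|/g_inj E]; last first.
  by rewrite E ltnn in fk.
have := ma _ (chain_splice ca cb ka kb fk gk).
by rewrite size_cat size_takel // size_drop -sab; move: ka; clear; lia.
Qed.

Lemma longest_agree_le i0 a b k : longest a -> longest b -> k < size a ->
  f (nth i0 a k) <= f (nth i0 b k) -> g (nth i0 a k) <= g (nth i0 b k).
Proof.
move=> la lb ka; rewrite leq_eqVlt => /orP[/eqP/f_inj->//|fk].
exact/ltnW/longest_agree.
Qed.

(** The join in the lattice of longest chains. Comparing [f] is enough, as both coordinates order
    corresponding points in the same way. *)
Definition join_chain a b := [seq if f x.1 < f x.2 then x.2 else x.1 | x <- zip a b].

Lemma join_chainP a b : longest a -> longest b -> chain f g X (join_chain a b).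
Proof.
move=> la lb; have [[ca ma] [cb mb]] := (la, lb).
have sab : size a = size b by apply/eqP; rewrite eqn_leq ma // mb.
have sj : size (join_chain a b) = size a by rewrite size_map size1_zip // sab.
case Ea : a => [|i0 a']; first by rewrite /join_chain; case: (b).
rewrite -Ea; have nthj k : k < size a -> nth i0 (join_chain a b) k =
    if f (nth i0 a k) < f (nth i0 b k) then nth i0 b k else nth i0 a k.
  move=> ka; have kz : k < size (zip a b) by rewrite size1_zip // sab.
  by rewrite (nth_map (i0, i0)) // nth_zip.
apply/andP; split.
  apply/(sortedP i0) => k; rewrite sj => ka.
  rewrite !nthj // ?(ltnW ka) // /dec_rel.
  have kb : k.+1 < size b by rewrite -sab.
  have [fa ga] := chain_nth i0 ca (ltnSn k) ka.
  have [fb gb] := chain_nth i0 cb (ltnSn k) kb.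
  case: (ltnP (f (nth i0 a k)) (f (nth i0 b k))) => f1;
    case: (ltnP (f (nth i0 a k.+1)) (f (nth i0 b k.+1))) => f2.
  - by rewrite fb gb.
  - rewrite (leq_trans fb f2) /=; apply: (ltn_trans ga).
    exact: longest_agree (ltnW ka) f1.
  - rewrite (ltn_trans fa f2) /=; apply: (leq_trans gb).
    by apply: longest_agree_le; rewrite // ltnW.
  - by rewrite fa ga.
apply/allP => i /(nthP i0)[k]; rewrite sj => ka <-; rewrite nthj //.
case: ca cb => /andP[_ /allP aX] /andP[_ /allP bX].
by case: ifP => _; [apply: bX | apply: aX]; rewrite mem_nth // -sab.
Qed.

(** Take a longest chain with the greatest sum of [f]. Its join with any other longest chain cannot
    have a greater sum, so it already dominates the other one. *)
Lemma exists_rightmost_chain a0 : longest a0 ->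
  exists2 a, rightmost_chain f g X a & size a = size a0.
Proof.
move=> [ca0 m0]; pose F (u : (size a0).-tuple I) := \sum_(i <- u) f i.
case: (@arg_maxnP _ (in_tuple a0) (fun u : (size a0).-tuple I => chain f g X u) F ca0) => a ca ma.
have la : longest a by split=> // c /m0; rewrite size_tuple.
exists a; last by rewrite size_tuple.
split=> // b cb; have sb := m0 b cb; rewrite size_tuple; split=> // sbE.
have lb : longest b by split=> // c /m0; rewrite sbE.
have cj := join_chainP la lb.
have sj : size (join_chain a b) == size a0 by rewrite size_map size1_zip ?size_tuple // sbE.
have := ma (Tuple sj) cj; rewrite /F /=.
case Ea : (tval a) (size_tuple a) => [|i0 a'] sa.
  by move: sbE; rewrite -sa /=; case: (b).
rewrite -Ea in sa *; rewrite /join_chain big_map.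
have -> : \sum_(i <- a) f i = \sum_(x <- zip a b) f x.1.
  by rewrite -(big_map fst xpredT f) -/(unzip1 _) unzip1_zip // sa sbE.
move=> le; have fle k : k < size a -> f (nth i0 b k) <= f (nth i0 a k).
  move=> ka; rewrite leqNgt; apply/negP => fk; move: le; rewrite leqNgt => /negP[].
  have kz : (nth i0 a k, nth i0 b k) \in zip a b.
    rewrite -nth_zip ?mem_nth // ?size1_zip ?sa ?sbE //.
    by rewrite -sa.
  rewrite (big_rem _ kz) [ltnRHS](big_rem _ kz) /= fk -addSn leq_add //.
  by apply: leq_sum => x _; case: ifP => // /ltnW.
rewrite all2E sbE sa eqxx /=; apply/(all_nthP (i0, i0)) => k.
rewrite size2_zip sa ?sbE // => ka; rewrite nth_zip ?sa ?sbE //= .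
have ka' : k < size a by rewrite sa.
rewrite fle //=; apply: longest_agree_le => //; last exact: fle.
by rewrite sbE.
Qed.

(** Places in a rightmost chain move past no place of the same letter: [cl]
    stands for the places of that letter, on which the orders [f] and [g] either
    agree (unbarred letter) or are opposite (barred letter). *)
Lemma rightmost_no_tie (cl : pred I) a1 x y a2 j :
  rightmost_chain f g X (a1 ++ x :: y :: a2) -> j \in X ->
  f x < f j -> f j < f y -> cl x -> cl j ->
  (forall u v z, u \in X -> v \in X -> z \in X -> cl u -> cl v ->
     g u <= g z -> g z <= g v -> cl z) ->
  (forall u v, u \in X -> v \in X -> cl u -> cl v -> f u < f v -> g u < g v) \/
  (forall u v, u \in X -> v \in X -> cl u -> cl v -> f u < f v -> g v < g u) ->
  False.
Proof.
move=> [ca best] jX fxj fjy cx cj conv orders.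
have [c1 c2 c12] := chain_catP _ _ _ _ _ ca.
have [cx_ c3 xy_] := chain_catP f g X [:: x] (y :: a2) c2.
have xX : x \in X by rewrite -(chain1 f g).
have a1X i : i \in a1 -> i \in X by case/andP: c1 => _ /allP/(_ i).
have yX : y \in X by case/andP: c3 => _ /= /andP[].
have /andP[fxy gyx] : (f x < f y) && (g y < g x) by apply: xy_; rewrite inE eqxx.
have rest i : i \in a2 -> (f y < f i) && (g i < g y).
  have [_ _ ya2] := chain_catP f g X [:: y] a2 c3.
  by move=> ia; apply: ya2; rewrite ?inE ?eqxx.
(* For an unbarred letter, [j] could replace [x] and is higher, against extremality; for a barred
   one, [j] could be added between [x] and [y], against maximal length. *)
case: orders => [conc|disc].
  have gxj := conc x j xX jX cx cj fxj.
  have cc : chain f g X (a1 ++ j :: y :: a2).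
    apply/chain_catP; split=> //.
      apply/(chain_catP f g X [:: j]); split=> //; first by rewrite chain1.
      move=> i k; rewrite inE => /eqP->; rewrite inE => /orP[/eqP->|/rest/andP[fk gk]].
        by rewrite fjy (ltn_trans gyx gxj).
      by rewrite (ltn_trans fjy fk) (ltn_trans gk (ltn_trans gyx gxj)).
    move=> i k ia; have ka0 : k = j -> (f i < f k) && (g k < g i).
      move=> ->; have /andP[fi gi] : (f i < f x) && (g x < g i).
        by apply: c12; rewrite // inE eqxx.
      rewrite (ltn_trans fi fxj) /= ltnNge; apply/negP => gij.
      have ci : cl i := (conv x j i xX jX (a1X _ ia) cx cj (ltnW gi) gij).
      by have := conc i x (a1X _ ia) xX ci cx fi; rewrite ltnNge (ltnW gi).
    rewrite inE => /orP[/eqP/ka0//|ky]; apply: c12 => //.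
    by rewrite inE ky orbT.
  have [_] := best _ cc; rewrite !size_cat /= => /(_ erefl).
  by rewrite all2_cat_eqsize //= => /and3P[_ /andP[_]]; rewrite leqNgt gxj.
have gjx := disc x j xX jX cx cj fxj.
have gyj : g y < g j.
  rewrite ltnNge; apply/negP => gjy.
  have cy : cl y := (conv j x y jX xX yX cj cx gjy (ltnW gyx)).
  by have := disc j y jX yX cj cy fjy; rewrite ltnNge gjy.
have cc : chain f g X (a1 ++ [:: x] ++ j :: y :: a2).
  apply/chain_catP; split=> //.
    apply/chain_catP; split; rewrite ?chain1 //.
      apply/(chain_catP f g X [:: j]); split=> //; first by rewrite chain1.
      move=> i k; rewrite inE => /eqP->; rewrite inE => /orP[/eqP->|/rest/andP[fk gk]].
        by rewrite fjy gyj.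
      by rewrite (ltn_trans fjy fk) (ltn_trans gk gyj).
    move=> i k; rewrite inE => /eqP->; rewrite inE => /orP[/eqP->|ky].
      by rewrite fxj gjx.
    by apply: xy_ => //; rewrite inE eqxx.
  move=> i k ia; have /andP[fi gi] : (f i < f x) && (g x < g i).
    by apply: c12; rewrite // inE eqxx.
  rewrite inE => /orP[/eqP->|]; first by rewrite fi gi.
  rewrite inE => /orP[/eqP->|ky].
    by rewrite (ltn_trans fi fxj) (ltn_trans gjx gi).
  by apply: c12; rewrite // inE ky orbT.
have [le _] := best _ cc; move: le; rewrite !size_cat /= leq_add2l.
by rewrite ltnn.
Qed.

End Rightmost.

(** * Leftmost chains, obtained by complementing both coordinates *)

Section Leftmost.

Variable I : finType.
Implicit Types (f g : I -> nat) (X Y : {set I}) (a c : seq I).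

Definition leftmost_chain f g X a := chain f g X a /\
  forall c, chain f g X c -> size c <= size a /\
    (size c = size a -> all2 (fun i j => (f i <= f j) && (g i <= g j)) a c).

Lemma leftmost_chain_subset f g X Y a : Y \subset X -> {subset a <= Y} ->
  leftmost_chain f g X a -> leftmost_chain f g Y a.
Proof.
move=> YX aY [/andP[sa _] best]; split=> [|c /(chain_subset YX)/best //].
by rewrite /chain sa; apply/allP.
Qed.

Lemma leftmost_chain_sym f g X a : leftmost_chain f g X a ->
  leftmost_chain g f X (rev a).
Proof.
case=> ca H; split=> [|c]; first by rewrite chain_rev.
rewrite -[c]revK chain_rev => /H; rewrite !size_rev => -[le e]; split=> // sz.
rewrite all2_rev ?size_rev //; have := e sz.
by congr is_true; elim: (a) (rev c) => [|x s IH] [|z t] //=; rewrite IH [(_ <= _) && _]andbC.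
Qed.

Variables (f g : I -> nat) (N : nat).
Hypotheses (f_inj : injective f) (g_inj : injective g).
Hypotheses (f_le : forall i, f i <= N) (g_le : forall i, g i <= N).
Notation opp h := (fun i : I => N - h i).

Lemma opp_inj (h : I -> nat) : injective h -> (forall i, h i <= N) -> injective (opp h).
Proof.
move=> hI hN i j E; apply: hI; have := hN i; have := hN j; move: E; clear; lia.
Qed.

Lemma opp_lt (h : I -> nat) i j : (forall i, h i <= N) -> (N - h i < N - h j) = (h j < h i).
Proof. by move=> hN; have := hN i; have := hN j; clear; lia. Qed.

Lemma opp_le (h : I -> nat) i j : (forall i, h i <= N) -> (N - h i <= N - h j) = (h j <= h i).
Proof. by move=> hN; have := hN i; have := hN j; clear; lia. Qed.

Lemma chain_opp X c : chain (opp f) (opp g) X c = chain f g X (rev c).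
Proof.
rewrite /chain rev_sorted all_rev; congr (_ && _).
by apply: eq_sorted => i j; rewrite /dec_rel !opp_lt.
Qed.

Lemma all2_opp a c : all2 (fun i j => (opp f i <= opp f j) && (opp g i <= opp g j)) a c =
  all2 (fun i j => (f i <= f j) && (g i <= g j)) c a.
Proof. by elim: a c => [|x a IH] [|y c] //=; rewrite IH !opp_le. Qed.

Lemma leftmost_chain_opp X a :
  leftmost_chain f g X a <-> rightmost_chain (opp f) (opp g) X (rev a).
Proof.
split=> -[ca H]; (split=> [|c cc]; first by move: ca; rewrite chain_opp revK).
  have [|le e] := H (rev c); first by rewrite -chain_opp.
  rewrite !size_rev in le e *; split=> // sz.
  by rewrite -[c]revK all2_rev ?size_rev // all2_opp e.
have [|le e] := H (rev c); first by rewrite chain_opp revK.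
rewrite !size_rev in le e *; split=> // sz.
by rewrite -all2_opp -all2_rev ?e.
Qed.

Lemma exists_leftmost_chain X a0 : longest f g X a0 ->
  exists2 a, leftmost_chain f g X a & size a = size a0.
Proof.
move=> [ca m].
have [|a ra sa] := @exists_rightmost_chain _ (opp f) (opp g) X
    (opp_inj f_inj f_le) (opp_inj g_inj g_le) (rev a0).
  split=> [|c]; first by rewrite chain_opp revK.
  by rewrite chain_opp => /m; rewrite !size_rev.
exists (rev a); first by apply/leftmost_chain_opp; rewrite revK.
by rewrite size_rev sa size_rev.
Qed.

Lemma leftmost_no_tie X (cl : pred I) a1 x y a2 j :
  leftmost_chain f g X (a1 ++ x :: y :: a2) -> j \in X ->
  f x < f j -> f j < f y -> cl y -> cl j ->
  (forall u v z, u \in X -> v \in X -> z \in X -> cl u -> cl v ->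
     g u <= g z -> g z <= g v -> cl z) ->
  (forall u v, u \in X -> v \in X -> cl u -> cl v -> f u < f v -> g u < g v) \/
  (forall u v, u \in X -> v \in X -> cl u -> cl v -> f u < f v -> g v < g u) ->
  False.
Proof.
move=> /leftmost_chain_opp; rewrite rev_cat !rev_cons -!cats1 -!catA /=.
move=> ra jX xj jy cy cj conv orders.
apply: (rightmost_no_tie ra jX _ _ cy cj);
  rewrite ?opp_lt //.
  move=> u v z uX vX zX cu cv; rewrite !opp_le // => zu vz.
  exact: (conv v u z).
by case: orders => H; [left|right] => u v uX vX cu cv; rewrite !opp_lt //; apply: H.
Qed.

Lemma enum_by_opp X : enum_by (opp f) X = rev (enum_by f X).
Proof.
apply: enum_by_eq; first exact: opp_inj.
  rewrite rev_sorted; have := enum_by_sorted X f_inj; apply: sub_sorted => i j /=.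
  by rewrite opp_lt.
by move=> i; rewrite mem_rev mem_enum_by.
Qed.

(** This is [knuth_rightmost] for the complemented coordinates; reading backwards with complemented
    letters is undone by [knuth_revneg]. *)
Lemma knuth_leftmost X h a (mv : I -> I) : leftmost_chain f g X (h :: a) ->
  path (fun i j => mv i == j) h a -> (forall i, i \notin h :: a -> mv i = i) ->
  knuth (word f g X)
    (g h :: [seq g (mv i) | i <- enum_by f X & i != last h a]).
Proof.
move=> /leftmost_chain_opp ra pa fixa.
have Er : rev (h :: a) = last h a :: behead (rev (h :: a)).
  by rewrite lastI rev_rcons.
have Eb : behead (rev (h :: a)) = rev (belast h a) by rewrite lastI rev_rcons.
rewrite Er in ra.
have := knuth_rightmost (mv := mv) (opp_inj f_inj f_le) (opp_inj g_inj g_le) ra.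
rewrite Eb rev_path => /(_ pa) H.
have : forall i, i \notin last h a :: rev (belast h a) -> mv i = i.
  by move=> i; rewrite -Eb -Er mem_rev; apply: fixa.
move=> /H/(@knuth_revneg N); rewrite all_map.
have -> : last (last h a) (rev (belast h a)) = h.
  by case: (a) => [|y s] //=; rewrite rev_cons last_rcons.
have oppK (s : seq I) (m : I -> I) :
    map (subn N) [seq N - g (m i) | i <- s] = [seq g (m i) | i <- s].
  by rewrite -map_comp; apply: eq_map => i /=; rewrite subKn.
rewrite /word enum_by_opp map_cat rev_cat !oppK /= subKn // filter_rev !map_rev !revK.
apply; apply/allP => i _ /=; exact: leq_subr.
Qed.

End Leftmost.

#[local] Arguments next : simpl never.
#[local] Arguments prev : simpl never.

Lemma word_setE (I : finType) (f g : I -> nat) (X Y : {set I}) (P : pred nat) :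
  (forall i, (i \in Y) = (i \in X) && P (g i)) ->
  word f g Y = filter P (word f g X).
Proof.
move=> H; rewrite /word filter_map -filter_predI; congr map.
by apply: eq_filter => i; rewrite H /= andbC.
Qed.

Lemma enum_by_cat (I : finType) (f : I -> nat) (X Y Z : {set I}) : injective f ->
  (forall i, (i \in Z) = (i \in X) || (i \in Y)) ->
  (forall i j, i \in X -> j \in Y -> f i < f j) ->
  enum_by f Z = enum_by f X ++ enum_by f Y.
Proof.
move=> fI ZE XY; apply: enum_by_eq => // [|i]; last by rewrite mem_cat !mem_enum_by ZE.
have tr : transitive (relpre f ltn) by move=> ? ? ?; apply: ltn_trans.
rewrite (sorted_pairwise tr) pairwise_cat !pairwise_enum_by // !andbT.
by apply/allrelP => i j; rewrite !mem_enum_by; apply: XY.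
Qed.

Lemma eq_enum_by (I : finType) (f f' : I -> nat) (X : {set I}) :
  injective f -> injective f' -> {in X, f =1 f'} -> enum_by f X = enum_by f' X.
Proof.
move=> fI fI' E; apply: enum_by_eq => // [|i]; last by rewrite mem_enum_by.
have := enum_by_sorted X fI'; rewrite -!sorted_map.
suff -> : map f (enum_by f' X) = map f' (enum_by f' X) by [].
by apply/eq_in_map => i; rewrite mem_enum_by => /E.
Qed.

Lemma entry_ltE n (w : n.-tuple letter) (i j : 'I_n) :
  (entry_at w i < entry_at w j)%O =
    (tnth w i < tnth w j)%O || ((tnth w i == tnth w j) && (i < j)).
Proof.
rewrite ltEprodlexi /= ltEnat /=; case: ltgtP => //=.
Qed.

(** The barred and the unbarred form of a letter are neighbours in the natural order, so removing
    the bar moves a letter past no other. *)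
Lemma letter_gap (a b : letter) : barred a -> (a < b)%O = (remove_bar a <= b)%O.
Proof.
case: a b => x [] [y []] //= _; rewrite ltEprodlexi leEprodlexi /=; case: ltgtP.
Qed.

Lemma barred_lt_remove_bar (a : letter) : barred a -> (a < remove_bar a)%O.
Proof. by move=> ba; rewrite letter_gap. Qed.

Lemma path_next_split (T : eqType) (f : T -> T) a s i :
  path (fun i j => f i == j) a s -> i \in a :: s -> i != last a s ->
  exists u v, a :: s = u ++ i :: f i :: v.
Proof.
elim: s a => [|b s IH] a /=; first by rewrite inE => _ /eqP->; rewrite eqxx.
move=> /andP[/eqP ab pb]; rewrite inE => /orP[/eqP-> _|ib il].
  by exists [::], s; rewrite /= ab.
by have [u [v E]] := IH b pb ib il; exists (a :: u), v; rewrite /= -E.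
Qed.

(** * Rotation along an extremal hook subword *)

Section Rotation.

Variables (n : nat) (w w' : n.-tuple letter) (k1 : 'I_n) (k0 : seq 'I_n).
Let k := k1 :: k0.
Let p := last k1 k0.
Let q := std_rank w p.
Notation sigma := (next k).

Hypothesis k_sorted : sorted (relpre (@nat_of_ord n) ltn) k.
Hypothesis w'E : w' = pi_places w k.
Hypothesis wp_barred : barred (tnth w p).
(** This and the next two hypotheses ensure that rotation respects standardization. A letter moving
    right passes no equal letter outside the subword; [p] is the last occurrence of its letter,
    which it outgrows on losing the bar; and at [k1] it precedes all occurrences of the unbarred
    letter that it joins. *)
Hypothesis no_tie : forall i j, i \in k -> i != p -> j \notin k ->
  tnth w i = tnth w j -> i < j -> sigma i < j.
Hypothesis below_p : forall j, tnth w j = tnth w p -> j <= p.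
Hypothesis above_k1 : forall j, tnth w j = remove_bar (tnth w p) ->
  j \notin k /\ k1 < j.

Let tr : transitive (relpre (@nat_of_ord n) ltn).
Proof. by move=> ? ? ?; apply: ltn_trans. Qed.

Let k_uniq : uniq k.
Proof. by apply: sorted_uniq k_sorted => // i; apply: ltnn. Qed.

Lemma cycle_sigma : path (fun i j => sigma i == j) k1 k0 /\ sigma p = k1.
Proof.
have := cycle_next k_uniq; rewrite /k /= rcons_path => /andP[? /eqP ?].
by split.
Qed.

Lemma p_in_k : p \in k.
Proof. exact: mem_last. Qed.

Lemma sigma_inj : injective sigma.
Proof. exact: can_inj (prev_next k_uniq). Qed.

Lemma sigma_fix i : i \notin k -> sigma i = i.
Proof. by move=> ik; rewrite next_nth (negPf ik). Qed.

Lemma sigma_p i : (sigma i == k1) = (i == p).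
Proof. by have [_ <-] := cycle_sigma; rewrite (inj_eq sigma_inj). Qed.

Lemma sigma_split i : i \in k -> i != p -> exists u v,
  k = u ++ i :: sigma i :: v.
Proof.
have [pk _] := cycle_sigma; exact: path_next_split.
Qed.

Lemma sigma_gt i : i \in k -> i != p -> i < sigma i.
Proof.
move=> ik ip; have [u [v E]] := sigma_split ik ip.
have := k_sorted; rewrite {1}E (sorted_pairwise tr) pairwise_cat.
by case/and3P=> _ _ /andP[/andP[]].
Qed.

Lemma sigma_le i j : i \in k -> i != p -> j \in k -> i < j -> sigma i <= j.
Proof.
move=> ik ip jk ij; have [u [v E]] := sigma_split ik ip.
have := k_sorted; rewrite {1}E (sorted_pairwise tr) pairwise_cat.
case/and3P=> /allrelP ui _ /andP[_ /andP[/allP sv _]].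
move: jk; rewrite {1}E mem_cat !inE => /orP[ju|/or3P[/eqP ji|/eqP->//|/sv/ltnW//]].
  by have /= := ui j i ju; rewrite inE eqxx ltnNge (ltnW ij) => /(_ isT).
by rewrite ji ltnn in ij.
Qed.

Lemma letter_sigma i : i != p -> tnth w' (sigma i) = tnth w i.
Proof.
move=> ip; rewrite w'E tnth_mktuple /= prev_next //.
by case: eqP => // -[/esym/eqP]; rewrite sigma_p (negPf ip).
Qed.

Lemma letter_k1 : tnth w' k1 = remove_bar (tnth w p).
Proof.
have [_ sp] := cycle_sigma; rewrite w'E tnth_mktuple /= eqxx -sp prev_next //.
by move: wp_barred; rewrite /toggle_bar /remove_bar /barred => ->.
Qed.

(** [sigma] sends a place to the place where its letter goes. Only the letter at [p] changes, to its
    neighbour in the order, so apart from ties no comparison can be affected. *)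
Lemma entry_sigma i j : (entry_at w i < entry_at w j)%O ->
  (entry_at w' (sigma i) < entry_at w' (sigma j))%O.
Proof.
have [_ sp] := cycle_sigma; rewrite !entry_ltE.
have [->|ip] := eqVneq i p; last have [->|jp] := eqVneq j p.
- have [->|jp] := eqVneq j p; first by rewrite ltxx ltnn andbF.
  rewrite sp letter_k1 letter_sigma // => /orP[lt|/andP[/eqP e pj]]; last first.
    by have := below_p (esym e); rewrite leqNgt pj.
  have := lt; rewrite letter_gap // le_eqVlt => /orP[/eqP e|-> //].
  have [jk kj] := above_k1 (esym e).
  by rewrite -e eqxx sigma_fix // kj orbT.
- rewrite sp letter_k1 letter_sigma // => H.
  suff -> : (tnth w i < remove_bar (tnth w p))%O by [].
  apply: le_lt_trans (barred_lt_remove_bar wp_barred).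
  by case/orP: H => [/ltW|/andP[/eqP->]].
rewrite !letter_sigma // => /orP[-> //|/andP[/eqP e ij]].
rewrite e eqxx /=; apply/orP; right.
have [ik|ik] := boolP (i \in k); have [jk|jk] := boolP (j \in k).
- exact: leq_ltn_trans (sigma_le ik ip jk ij) (sigma_gt jk jp).
- by rewrite (sigma_fix jk); apply: no_tie.
- by rewrite (sigma_fix ik); apply: ltn_trans ij (sigma_gt jk jp).
by rewrite !sigma_fix.
Qed.

Lemma entry_sigma_le i j :
  (entry_at w' (sigma i) <= entry_at w' (sigma j))%O = (entry_at w i <= entry_at w j)%O.
Proof.
case: (leP (entry_at w i)) => [|/entry_sigma]; last by rewrite ltNge => /negPf.
rewrite le_eqVlt => /orP[/eqP/(@entry_at_inj n w)->|/entry_sigma/ltW //].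
exact: lexx.
Qed.

Lemma rank_sigma i : std_rank w' (sigma i) = std_rank w i.
Proof.
rewrite /std_rank -[RHS](card_imset _ sigma_inj); apply: eq_card => j.
rewrite inE; apply/idP/imsetP => [le|[j0 + ->]].
  exists (prev k j); last by rewrite next_prev.
  by rewrite inE -entry_sigma_le next_prev.
by rewrite inE entry_sigma_le.
Qed.

Lemma rank_k1 : std_rank w' k1 = q.
Proof. by have [_ <-] := cycle_sigma; apply: rank_sigma. Qed.

Lemma key_sigma i : i != p -> key w' (sigma i) = key w i.
Proof. by move=> ip; rewrite /key letter_sigma // rank_sigma. Qed.

Lemma key_k1 : key w' k1 = n + q.
Proof.
by rewrite /key letter_k1 rank_k1 /barred /=.
Qed.

Lemma key_p : key w p = n - q.
Proof. by rewrite /key wp_barred. Qed.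

Hypothesis k_small : {subset k <= smallest w q}.

Lemma smallest_sigma j : (j \in smallest w' q) = (j \in smallest w q).
Proof.
rewrite -[j](next_prev k_uniq) inE rank_sigma next_prev //.
have [jk|jk] := boolP (j \in k); last first.
  by rewrite inE prev_nth (negPf jk).
by rewrite (k_small jk); have := k_small (etrans (mem_prev _ _) jk); rewrite inE.
Qed.

Lemma smallest_sigma_eq : smallest w' q = smallest w q.
Proof. by apply/setP => j; rewrite smallest_sigma. Qed.

Lemma rank_gt_sigma j : q < std_rank w j -> sigma j = j.
Proof.
move=> qj; apply: sigma_fix; apply: contraL qj => /k_small.
by rewrite inE -leqNgt.
Qed.

Lemma key_large j : q < std_rank w j -> key w' j = key w j /\ std_rank w' j = std_rank w j.
Proof.
move=> qj; have jp : j != p by apply: contraTneq qj => ->; rewrite ltnn.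
by rewrite -{1 3}(rank_gt_sigma qj) key_sigma // rank_sigma.
Qed.

Lemma rank_large j : (q < std_rank w' j) = (q < std_rank w j).
Proof. by have := smallest_sigma j; rewrite !inE !ltnNge => ->. Qed.

(** The integers of rank at most [m] are those between -m and m (shifted by [n]), an interval; this
    makes Knuth equivalence inherit to fewer letters. *)
Lemma word_smallest (v : n.-tuple letter) m m' : m <= m' ->
  word (@nat_of_ord n) (key v) (smallest v m) =
  filter (fun x => n - m <= x <= n + m) (word (@nat_of_ord n) (key v) (smallest v m')).
Proof.
move=> mm'; apply: word_setE => i; rewrite !inE /key.
have := std_rank_gt0 v i; have := std_rank_le_n v i.
by case: (barred _); move: mm'; clear; lia.
Qed.

(** Lowering knows its subword to be rightmost in the word before rotation, raising knows it to be
    leftmost in the word after rotation. The arguments below run through both alternatives. *)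
Hypothesis extremal : rightmost_chain (@nat_of_ord n) (key w) (smallest w q) k \/
  leftmost_chain (@nat_of_ord n) (key w') (smallest w' q) k.

Lemma path_sigma : path (fun i j => sigma i == j) k1 k0.
Proof. by have [] := cycle_sigma. Qed.

Lemma path_prev : path (fun i j => prev k j == i) k1 k0.
Proof. by apply: sub_path path_sigma => i j /eqP<-; rewrite prev_next. Qed.

Lemma prev_fix i : i \notin k -> prev k i = i.
Proof. by move=> ik; rewrite prev_nth (negPf ik). Qed.

Lemma rev_k : rev k = p :: rev (belast k1 k0).
Proof. by rewrite /k lastI rev_rcons. Qed.

Lemma last_rev_k : last p (rev (belast k1 k0)) = k1.
Proof. by rewrite /p; case: (k0) => [|y s] //=; rewrite rev_cons last_rcons. Qed.

Lemma key_prev i : i != k1 -> key w (prev k i) = key w' i.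
Proof.
move=> ik; rewrite -{2}[i](next_prev k_uniq) key_sigma //.
by rewrite -sigma_p next_prev.
Qed.

Lemma word_sigma : word (@nat_of_ord n) (key w) (smallest w q.-1) =
  [seq key w' (sigma i) | i <- enum_by (@nat_of_ord n) (smallest w q) & i != p].
Proof.
rewrite -enum_byD1 smallestD1; apply/eq_in_map => i; rewrite mem_enum_by -smallestD1.
by rewrite in_setD1 => /andP[ip _]; rewrite key_sigma.
Qed.

Lemma word_prev : word (@nat_of_ord n) (key w') (smallest w' q.-1) =
  [seq key w (prev k i) | i <- enum_by (@nat_of_ord n) (smallest w q) & i != k1].
Proof.
rewrite -smallest_sigma_eq -rank_k1 -enum_byD1 smallestD1; apply/eq_in_map => i; rewrite mem_enum_by -smallestD1.
by rewrite in_setD1 => /andP[ip _]; rewrite key_prev.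
Qed.

(** The Knuth move keeps the extreme letter, of integer -q at the end or q at the front, whereas the
    rotation changes its sign. Both values lie outside the interval of the [q.-1] smallest letters,
    where the discrepancy disappears. *)
Lemma knuth_word :
  knuth (word (@nat_of_ord n) (key w) (smallest w q.-1))
        (word (@nat_of_ord n) (key w') (smallest w' q.-1)).
Proof.
have q0 : 0 < q := std_rank_gt0 w p.
have qn : q <= n := std_rank_le_n w p.
have conv x y z : x <= y <= z -> n - q.-1 <= x <= n + q.-1 -> n - q.-1 <= z <= n + q.-1 ->
    n - q.-1 <= y <= n + q.-1.
  by clear; lia.
have out x : x = n - q \/ x = n + q -> (n - q.-1 <= x <= n + q.-1) = false.
  by move: q0 qn; clear; lia.
rewrite (word_smallest w (leq_pred q)) (word_smallest w' (leq_pred q)).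
case: extremal => ext.
  have := knuth_rightmost (@ord_inj n) (@key_inj n w) ext path_prev prev_fix.
  move/(knuth_filter conv); rewrite filter_cat /= -/p key_p out; last by left.
  by rewrite cats0 -word_prev -(word_smallest w' (leqnn q.-1)) -(word_smallest w' (leq_pred q)).
have le_ord (i : 'I_n) : i <= n + n by rewrite (leq_trans (ltnW (ltn_ord i))) ?leq_addr.
have := knuth_leftmost (@ord_inj n) (@key_inj n w') le_ord (@key_le n w') ext
  path_sigma sigma_fix.
move/(knuth_filter conv) => /=; rewrite key_k1 out; last by right.
rewrite -/p {2}smallest_sigma_eq -word_sigma => H; apply: knuth_sym.
by move: H; rewrite -(word_smallest w (leqnn q.-1)) -(word_smallest w (leq_pred q)).
Qed.

(** By increasing integers [p] came first with -q; the place [k1] of the rotated letter comes last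
    with q, and the remaining letters keep their order. *)
Lemma enum_by_key' : enum_by (key w') (smallest w' q) =
  rcons [seq sigma i | i <- enum_by (key w) (smallest w q) & i != p] k1.
Proof.
apply: enum_by_eq; first exact: key_inj.
  rewrite -sorted_map map_rcons -map_comp.
  have -> : [seq (key w' \o sigma) i | i <- enum_by (key w) (smallest w q) & i != p] =
      [seq key w i | i <- enum_by (key w) (smallest w q) & i != p].
    by apply/eq_in_map => i; rewrite mem_filter => /andP[ip _]; rewrite /= key_sigma.
  rewrite (sorted_pairwise ltn_trans) pairwise_rcons -(sorted_pairwise ltn_trans).
  rewrite key_k1 -enum_byD1 sorted_map enum_by_sorted; last exact: key_inj.
  rewrite andbT; apply/allP => _ /mapP[i + ->]; rewrite mem_enum_by smallestD1 inE /key /=.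
  have := std_rank_gt0 w i; have := std_rank_gt0 w p.
  by case: (barred _); rewrite -/q; clear; lia.
move=> j; rewrite mem_rcons inE smallest_sigma_eq.
have [->|jk] := eqVneq j k1; first by rewrite k_small ?inE ?eqxx.
rewrite /= -[j in LHS](next_prev k_uniq) (mem_map sigma_inj).
rewrite mem_filter mem_enum_by -sigma_p next_prev // jk /= -(smallest_sigma j).
by rewrite inE -rank_sigma next_prev // inE.
Qed.

Lemma enum_by_key : enum_by (key w) (smallest w q) =
  p :: [seq prev k i | i <- enum_by (key w') (smallest w' q) & i != k1].
Proof.
rewrite enum_by_key' filter_rcons eqxx /= filter_map -map_comp.
have -> : [seq i <- [seq i <- enum_by (key w) (smallest w q) | i != p] |
     preim sigma (fun i => i != k1) i] = [seq i <- enum_by (key w) (smallest w q) | i != p].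
  by apply/all_filterP/allP => i; rewrite mem_filter /= sigma_p => /andP[].
have -> : [seq (prev k \o sigma) i | i <- enum_by (key w) (smallest w q) & i != p] =
    [seq i <- enum_by (key w) (smallest w q) | i != p].
  by rewrite -[RHS]map_id; apply: eq_map => i; rewrite /= prev_next.
apply: enum_by_eq; first exact: key_inj.
  rewrite -enum_byD1 /= (path_sortedE (leT := relpre (key w) ltn)); last first.
    by move=> ? ? ?; apply: ltn_trans.
  rewrite enum_by_sorted ?andbT; last exact: key_inj.
  apply/allP => i; rewrite mem_enum_by smallestD1 inE /= key_p /key.
  have := std_rank_gt0 w i; have := std_rank_gt0 w p; have := std_rank_le_n w p.
  by case: (barred _); rewrite -/q; clear; lia.
move=> j; rewrite inE mem_filter mem_enum_by.
by have [->|] := eqVneq j p; rewrite //= k_small ?p_in_k.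
Qed.

(** In the inverse word the subword is read backwards and starts with the very first letter [p], so
    the move coincides with the rotation and nothing has to be discarded. *)
Lemma knuth_inverse :
  knuth (word (key w) (@nat_of_ord n) (smallest w q))
        (word (key w') (@nat_of_ord n) (smallest w' q)).
Proof.
case: extremal => ext.
  have := rightmost_chain_sym ext; rewrite rev_k.
  move/(knuth_rightmost (mv := sigma) (@key_inj n w) (@ord_inj n)).
  rewrite last_rev_k rev_path => /(_ path_sigma) H.
  rewrite {2}/word enum_by_key' map_rcons -cats1 -map_comp; apply: H => i.
  by rewrite -rev_k mem_rev; apply: sigma_fix.
have := leftmost_chain_sym ext; rewrite rev_k => ext'.
have le_ord (i : 'I_n) : i <= n + n by rewrite (leq_trans (ltnW (ltn_ord i))) ?leq_addr.
have := knuth_leftmost (mv := prev k) (@key_inj n w') (@ord_inj n) (@key_le n w') le_ord ext'.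
rewrite last_rev_k rev_path => /(_ path_prev) H; apply: knuth_sym.
rewrite {2}/word enum_by_key /= -map_comp; apply: H => i.
by rewrite -rev_k mem_rev; apply: prev_fix.
Qed.

Lemma shape_small m r : m < q -> rs_shape w' (smallest w' m) r = rs_shape w (smallest w m) r.
Proof.
move=> mq; have mq' : m <= q.-1 by case: q mq.
rewrite /rs_shape !(word_smallest _ mq') /ins_shape.
congr (size (nth _ _ _)); apply: schensted_knuth.
apply: knuth_filter (knuth_sym knuth_word) => x y z; clear; lia.
Qed.

(** The letters of rank above [q], barred ones in [low] and unbarred ones in [high]. In the inverse
    word they surround the first [q] letters as two blocks that the rotation does not touch. *)
Definition low (v : n.-tuple letter) m : {set 'I_n} :=
  [set i | (std_rank v i <= m) && (key v i < n - q)].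
Definition high (v : n.-tuple letter) m : {set 'I_n} :=
  [set i | (std_rank v i <= m) && (n + q < key v i)].

Lemma word_inverse_split (v : n.-tuple letter) m : q <= m ->
  word (key v) (@nat_of_ord n) (smallest v m) =
    word (key v) (@nat_of_ord n) (low v m) ++
    word (key v) (@nat_of_ord n) (smallest v q) ++
    word (key v) (@nat_of_ord n) (high v m).
Proof.
move=> qm; rewrite /word -!map_cat; congr map.
have qn : q <= n := std_rank_le_n w p.
have rk i : (std_rank v i <= q) = (n - q <= key v i <= n + q).
  have := std_rank_gt0 v i; have := std_rank_le_n v i; rewrite /key.
  by case: (barred _); move: qn; clear; lia.
rewrite -(@enum_by_cat _ _ (smallest v q) (high v m) (smallest v q :|: high v m)).
- apply: enum_by_cat; first exact: key_inj.
    move=> i; rewrite !inE rk; have := std_rank_gt0 v i; have := std_rank_le_n v i.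
    by rewrite /key; case: (barred _); move: qm qn; clear; lia.
  move=> i j; rewrite !inE rk; move=> /andP[_]; by clear; lia.
- exact: key_inj.
- by move=> i; rewrite in_setU.
move=> i j; rewrite !inE rk => /andP[_ H1] /andP[_]; exact: leq_ltn_trans.
Qed.

Lemma low_high_eq m : low w' m = low w m /\ high w' m = high w m /\
  {in low w m :|: high w m, key w =1 key w'}.
Proof.
have qn : q <= n := std_rank_le_n w p.
have out (v : n.-tuple letter) i : (key v i < n - q) || (n + q < key v i) -> q < std_rank v i.
  have := std_rank_gt0 v i; have := std_rank_le_n v i; rewrite /key.
  by case: (barred _); move: qn; clear; lia.
split; [|split].
- apply/setP => i; rewrite !inE; apply/idP/idP => /andP[rm lt].
    have qi : q < std_rank w i by rewrite -rank_large; apply: out; rewrite lt.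
    by have [<- <-] := key_large qi; rewrite rm.
  have qi : q < std_rank w i by apply: out; rewrite lt.
  by have [-> ->] := key_large qi; rewrite rm.
- apply/setP => i; rewrite !inE; apply/idP/idP => /andP[rm lt].
    have qi : q < std_rank w i by rewrite -rank_large; apply: out; rewrite lt orbT.
    by have [<- <-] := key_large qi; rewrite rm.
  have qi : q < std_rank w i by apply: out; rewrite lt orbT.
  by have [-> ->] := key_large qi; rewrite rm.
move=> i; rewrite !inE => /orP[] /andP[_ lt].
  by have /key_large[-> _] : q < std_rank w i by apply: out; rewrite lt.
by have /key_large[-> _] : q < std_rank w i by apply: out; rewrite lt orbT.
Qed.

Lemma knuth_inverse_large m : q <= m ->
  knuth (word (key w) (@nat_of_ord n) (smallest w m))
        (word (key w') (@nat_of_ord n) (smallest w' m)).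
Proof.
move=> qm; rewrite (word_inverse_split w qm) (word_inverse_split w' qm); have [-> [-> keyE]] := low_high_eq m.
have E (Y : {set 'I_n}) : Y \subset low w m :|: high w m ->
    word (key w') (@nat_of_ord n) Y = word (key w) (@nat_of_ord n) Y.
  move=> /subsetP sY; rewrite /word (eq_enum_by (f := key w') (f' := key w)) //;
    try exact: key_inj.
  by move=> i /sY/keyE.
rewrite (E (low w m)) ?subsetUl // (E (high w m)) ?subsetUr //.
exact: knuth_context knuth_inverse.
Qed.

Lemma rs_shape_inverse (v : n.-tuple letter) X r :
  rs_shape v X r = ins_shape (word (key v) (@nat_of_ord n) X) r.
Proof. by rewrite /rs_shape shape_sym //; [apply: ord_inj | apply: key_inj]. Qed.

Lemma shape_rotation m r : rs_shape w' (smallest w' m) r = rs_shape w (smallest w m) r.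
Proof.
have [mq|qm] := ltnP m q; first exact: shape_small.
by rewrite !rs_shape_inverse /ins_shape (schensted_knuth (knuth_inverse_large qm)).
Qed.

(** A prefix of places is an initial interval of letters of the inverse word. *)
Lemma shape_prefix m r : rs_shape w (initial n m) r = rs_shape w' (initial n m) r.
Proof.
rewrite !rs_shape_inverse /ins_shape; congr (size (nth _ _ _)); apply: schensted_knuth.
have E (v : n.-tuple letter) : word (key v) (@nat_of_ord n) (initial n m) =
    filter (fun x => x < m) (word (key v) (@nat_of_ord n) (smallest v n)).
  by apply: word_setE => i; rewrite smallest_n !inE.
rewrite !E; apply: knuth_filter (knuth_inverse_large (std_rank_le_n w p)).
by move=> x y z; clear; lia.
Qed.

Lemma Qm_rotation : Qm w' = Qm w.
Proof. by apply/esym/Qm_eq => m r _; apply: shape_prefix. Qed.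

Lemma size_tableau_rotation m :
  size (tableau_of w' (smallest w' m)) = size (tableau_of w (smallest w m)).
Proof.
have H r : (r < size (tableau_of w' (smallest w' m))) = (r < size (tableau_of w (smallest w m))).
  by rewrite -!row_gt0 ?tableau_partition // !tableau_shape shape_rotation.
by apply/eqP; rewrite eqn_leq; apply/andP; split; rewrite leqNgt; apply/negP;
  rewrite ?H ?ltnn // -H ltnn.
Qed.

Lemma Pm_rotation :
  size (tableau_of w (smallest w q.-1)) < size (tableau_of w (smallest w q)) ->
  size (tableau_of w (smallest w q)) = size (tableau_of w (smallest w n)) ->
  Pm w' = C_minus (Pm w) /\ Pm w = C_plus (Pm w').
Proof.
move=> lt eq; have [_ sp] := cycle_sigma.
have [||S S' E E'] := Pm_eq rank_sigma letter_sigma (fun m r _ => shape_rotation m r).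
- by rewrite /letter_tableau !size_map.
- by rewrite -letter_tableau_n /letter_tableau !size_map.
have rb : add_bar (remove_bar (tnth w p)) = tnth w p.
  by move: wp_barred; case: (tnth w p) => x [].
rewrite sp letter_k1 in S' E.
by split; [rewrite /C_minus S -E | rewrite /C_plus S' rb -E'].
Qed.

End Rotation.

Lemma has_dec_chain (I : finType) (f g : I -> nat) X m : injective f ->
  has_dec (word f g X) m <-> exists2 c, chain f g X c & size c = m.
Proof.
move=> fI; split=> [[b [/subseq_map[c sc ->] db <-]]|[c cc <-]].
  exists c; last by rewrite size_map.
  rewrite chain_pairwise; apply/andP; split; last first.
    by apply/allP => i /(mem_subseq sc); rewrite mem_enum_by.
  have := subseq_pairwise sc (pairwise_enum_by X fI).
  move: db; rewrite /dec pairwise_map => dg df.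
  by have := pairwise_relI (relpre f ltn) (relpre g gtn) c; rewrite df dg.
exists (map g c); split; last by rewrite size_map.
  by rewrite /word -{1}(chain_enum_by fI cc) map_subseq ?filter_subseq.
move: cc; rewrite chain_pairwise /dec pairwise_map => /andP[pw _].
by apply: sub_pairwise pw => i j /andP[].
Qed.

Lemma chain_antichain (I : finType) (f g : I -> nat) X c i j : chain f g X c ->
  i \in c -> j \in c -> f i <= f j -> g i <= g j -> i = j.
Proof.
move=> /andP[/(sorted_ltn_index (@dec_rel_trans I f g)) sc _] ic jc fij gij.
case: (ltngtP (index i c) (index j c)) => [/sc|/sc|/index_inj->//].
  by case/(_ ic jc)/andP => _; rewrite ltnNge gij.
by case/(_ jc ic)/andP; rewrite ltnNge fij.
Qed.

Lemma all2_mem (T U : eqType) (r : T -> U -> bool) s t x : all2 r s t -> x \in s ->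
  exists2 y, y \in t & r x y.
Proof.
elim: s t => [|x0 s IH] [|y t] //= /andP[xy st].
rewrite inE => /orP[/eqP->|/(IH _ st)[z zt xz]]; first by exists y; rewrite ?inE ?eqxx.
by exists z; rewrite // inE zt orbT.
Qed.

Lemma ohead_sort d (T : orderType d) (s : seq T) x :
  x \in s -> {in s, forall y, (x <= y)%O} -> ohead (sort <=%O s) = Some x.
Proof.
move=> xs le; have := sort_le_sorted s; have := mem_sort <=%O s.
case: (sort _ _) => [|y t] E; first by have := E x; rewrite xs.
move=> /(order_path_min le_trans)/allP yt; congr Some; apply/le_anti.
rewrite [(x <= y)%O]le // ?andbT -?E ?inE ?eqxx //.
by have := E x; rewrite xs inE => /orP[/eqP->|/yt].
Qed.

(** * Special subwords and the southwest entry *)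

Section Hooks.

Variables (n : nat) (w : n.-tuple letter).
Implicit Types (i j : 'I_n) (A B X : {set 'I_n}) (c : seq 'I_n).
Notation wchain := (chain (@nat_of_ord n) (key w)).

Lemma enum_sorted A : sorted (relpre (@nat_of_ord n) ltn) (enum A).
Proof.
rewrite /enum_mem -enumT; apply: sorted_filter.
  by move=> ? ? ?; apply: ltn_trans.
by rewrite -sorted_map val_enum_ord iota_ltn_sorted.
Qed.

Lemma wchain_enum X A : wchain X (enum A) = decreasing_hook w A && (A \subset X).
Proof.
rewrite /chain /decreasing_hook; congr (_ && _).
  rewrite (sorted_relI (relpre (@nat_of_ord n) ltn)) enum_sorted.
  by apply: eq_sorted => i j /=; rewrite key_signed_std.
apply/allP/subsetP => H i; first by move=> iA; apply: H; rewrite mem_enum.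
by rewrite mem_enum; apply: H.
Qed.

Lemma enum_chain X c : wchain X c -> enum [set i in c] = c.
Proof.
move=> /andP[s _]; apply: (@irr_sorted_eq _ (relpre (@nat_of_ord n) ltn)).
- by move=> ? ? ?; apply: ltn_trans.
- by move=> ?; apply: ltnn.
- exact: enum_sorted.
- by apply: sub_sorted s => i j /andP[].
by move=> i; rewrite mem_enum inE.
Qed.

Lemma wchain_le X c : wchain X c -> size c <= size (tableau_of w X).
Proof.
move=> cc; rewrite size_tableau; apply: has_dec_leq_schensted.
by apply/has_dec_chain; [apply: ord_inj | exists c].
Qed.

Lemma exists_wchain X : exists2 c, wchain X c & size c = size (tableau_of w X).
Proof.
have := has_dec_schensted (word (@nat_of_ord n) (key w) X).
by rewrite -size_tableau => /(has_dec_chain _ _ _ (@ord_inj n)).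
Qed.

Lemma tauE : tau w = size (tableau_of w (smallest w n)).
Proof.
rewrite smallest_n; apply/eqP; rewrite eqn_leq; apply/andP; split.
  apply/bigmax_leqP => A hA; rewrite cardE; apply: wchain_le.
  by rewrite wchain_enum hA subsetT.
have [c cc <-] := exists_wchain setT; have E := enum_chain cc.
rewrite -{1}E -cardE; apply: (leq_bigmax_cond (F := fun A => #|A|)).
by have := cc; rewrite -{1}E wchain_enum => /andP[].
Qed.

Lemma wchain_tau X c : wchain X c -> size c <= tau w.
Proof.
by rewrite tauE smallest_n => cc; apply: wchain_le (chain_subset (subsetT X) cc).
Qed.

(** Take the least number of smallest letters that already give all the rows. The last of them sits
    at [p] and will be the southwest letter. *)
Lemma exists_jump : 0 < n -> exists p,
  size (tableau_of w (smallest w (std_rank w p).-1)) <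
    size (tableau_of w (smallest w (std_rank w p))) /\
  size (tableau_of w (smallest w (std_rank w p))) =
    size (tableau_of w (smallest w n)).
Proof.
move=> n0; pose P k := size (tableau_of w (smallest w k)) == size (tableau_of w (smallest w n)).
have exP : exists k, P k by exists n; rewrite /P.
case: (ex_minnP exP) => k /eqP Pk minP.
have kn : k <= n by apply: minP; rewrite /P.
have k0 : 0 < k.
  have /wchain_le : wchain setT [:: Ordinal n0] by rewrite chain1.
  rewrite -(smallest_n w) -Pk; case: (k) => // /=.
  have [c /chain_size + <-] := exists_wchain (smallest w 0).
  by rewrite smallest0 cards0 leqn0 => /eqP->.
have [p rp] := exists_std_rank w k0 kn; exists p; rewrite rp; split=> //.
rewrite ltn_neqAle; apply/andP; split.
  rewrite Pk; by apply/negP => /minP; case: (k) k0 => //= m _; rewrite ltnn.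
have [c cc <-] := exists_wchain (smallest w k.-1); apply: wchain_le.
apply: chain_subset cc; apply/subsetP => i; rewrite !inE => /leq_trans; apply.
exact: leq_pred.
Qed.

Lemma entry_le_letter i j : (entry_at w i <= entry_at w j)%O -> (tnth w i <= tnth w j)%O.
Proof. by rewrite leEprodlexi => /andP[]. Qed.

Lemma letter_lt_rank i j : (tnth w i < tnth w j)%O -> std_rank w i < std_rank w j.
Proof. by rewrite ltnNge ltNge std_rank_leE; apply: contra => /entry_le_letter. Qed.

Lemma same_letter_rank i j : tnth w i = tnth w j ->
  (std_rank w i <= std_rank w j) = (i <= j).
Proof. by move=> e; rewrite std_rank_leE leEprodlexi /= e lexx /= leEnat. Qed.

Lemma below_key i j : (i == j) || below w i j = (i <= j) && (key w i <= key w j).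
Proof.
have [->|ij] := eqVneq i j; first by rewrite !leqnn.
by rewrite /below ltn_neqAle val_eqE ij /= (leqNgt (key w i)) key_signed_std Order.TotalTheory.leNgt.
Qed.

(** Going from [a] up to [B] and back up to [A] returns to [a], because two comparable places of one
    hook subword coincide. *)
Lemma special_le_anti A B : decreasing_hook w A -> decreasing_hook w B ->
  special_le w A B -> special_le w B A -> A \subset B.
Proof.
move=> hA hB /forallP AB /forallP BA; apply/subsetP => a aA.
have := AB a; rewrite aA => /existsP[b /andP[bB]]; rewrite below_key => /andP[ab kab].
have := BA b; rewrite bB => /existsP[c /andP[cA]]; rewrite below_key => /andP[bc kbc].
have ca : wchain setT (enum A) by rewrite wchain_enum hA subsetT.
have ac : a = c.
  apply: (chain_antichain ca); rewrite ?mem_enum //; first exact: leq_trans ab bc.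
  exact: leq_trans kab kbc.
suff -> : a = b by [].
by apply/ord_inj/eqP; rewrite eqn_leq ab ac bc.
Qed.

Variable p : 'I_n.
Hypothesis jump : size (tableau_of w (smallest w (std_rank w p).-1)) <
    size (tableau_of w (smallest w (std_rank w p))).
Hypothesis full : size (tableau_of w (smallest w (std_rank w p))) =
    size (tableau_of w (smallest w n)).
Let q := std_rank w p.

(** This can be larger than [smallest w q]: occurrences of the letter of [p] to the right of [p]
    also belong to it. *)
Definition letters_upto : {set 'I_n} := [set i | (tnth w i <= tnth w p)%O].

Lemma smallest_letters : smallest w q \subset letters_upto.
Proof. by apply/subsetP => i; rewrite !inE std_rank_leE => /entry_le_letter. Qed.

Lemma SW_jump : SW w = Some (tnth w p).
Proof.
have [||S _ _ _] := @Pm_eq n w w id p (fun i => erefl) (fun i _ => erefl) (fun k r _ => erefl).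
- by rewrite /letter_tableau !size_map.
- by rewrite -letter_tableau_n /letter_tableau !size_map.
exact: S.
Qed.

Lemma exists_longest : exists2 c, wchain (smallest w q) c & size c = tau w.
Proof. by have [c cc sc] := exists_wchain (smallest w q); exists c; rewrite // sc full tauE. Qed.

(** Without [p] the chain would lie among the letters of smaller rank, whose tableau has fewer
    rows. *)
Lemma longest_mem c : wchain (smallest w q) c -> size c = tau w -> p \in c.
Proof.
move=> cc sc; apply/negPn/negP => pc; move: jump; rewrite full -tauE -sc ltnNge => /negP[].
apply: wchain_le; case/andP: cc => s /allP cX; rewrite /chain s -smallestD1.
apply/allP => i ic; have iX : i \in smallest w q := cX i ic; rewrite /= in_setD1 iX andbT.
by apply: contraNneq pc => <-.
Qed.

Lemma longest_upto_special a A : longest_hook_upto w a A =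
  wchain [set i | (tnth w i <= a)%O] (enum A) && (#|A| == tau w).
Proof.
rewrite wchain_enum /longest_hook_upto -andbA; congr (_ && _); rewrite andbC; congr (_ && _).
apply/forall_inP/subsetP => H i; first by move=> iA; rewrite inE H.
by move/H; rewrite inE.
Qed.

Lemma eta_jump : eta w = Some (tnth w p).
Proof.
apply: ohead_sort => [|a]; rewrite mem_filter.
  apply/andP; split; last exact: mem_tnth.
  have [c cc sc] := exists_longest; apply/existsP; exists [set i in c].
  rewrite longest_upto_special cardE (enum_chain cc) sc eqxx andbT.
  exact: chain_subset smallest_letters cc.
case/andP=> /existsP[A]; rewrite longest_upto_special => /andP[cA /eqP sA] /tnthP[i ai].
rewrite leNgt; apply/negP => ap.
have Aa i0 : i0 \in enum A -> (tnth w i0 <= a)%O.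
  by case/andP: cA => _ /allP H /H; rewrite /= inE.
have cq : wchain (smallest w q) (enum A).
  case/andP: cA => s _; rewrite /chain s; apply/allP => i0 /Aa le.
  by rewrite /= inE; apply/ltnW/letter_lt_rank/(le_lt_trans le).
have := longest_mem cq; rewrite -cardE => /(_ sA)/Aa.
by rewrite leNgt ap.
Qed.

Lemma specialE A : special w A = wchain letters_upto (enum A) && (#|A| == tau w).
Proof. by rewrite /special eta_jump longest_upto_special. Qed.

Lemma longest_letters : exists2 c, longest (@nat_of_ord n) (key w) letters_upto c & size c = tau w.
Proof.
have [c cc sc] := exists_longest; exists c => //; split.
  exact: chain_subset smallest_letters cc.
by move=> d /wchain_tau; rewrite sc.
Qed.

Lemma all2_special_le A B :
  all2 (fun i j => (i <= j) && (key w i <= key w j)) (enum A) (enum B) -> special_le w A B.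
Proof.
move=> H; apply/forall_inP => i; rewrite -mem_enum => /(all2_mem H)[j].
rewrite mem_enum => jB ij; apply/exists_inP; exists j => //.
by rewrite below_key.
Qed.

Lemma rightmostE a : rightmost_chain (@nat_of_ord n) (key w) letters_upto a ->
  size a = tau w -> rightmost w = a.
Proof.
move=> [ca best] sa; rewrite /rightmost.
have E := enum_chain ca; set A0 := [set i in a] in E.
have spA0 : special w A0 by rewrite specialE cardE E ca sa /=.
have leA0 B : special w B -> special_le w B A0.
  rewrite specialE cardE => /andP[cB /eqP sB]; apply: all2_special_le; rewrite E.
  by have [_] := best _ cB; rewrite sB sa; apply.
have hook A : special w A -> decreasing_hook w A.
  by rewrite specialE wchain_enum => /andP[/andP[]].
case: pickP => [A /= /andP[spA /forall_inP leA]|/(_ A0)]; last first.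
  by rewrite /is_rightmost spA0 /=; move/forall_inP; case=> B; apply: leA0.
suff -> : A = A0 by [].
apply/eqP; rewrite eqEsubset !special_le_anti ?leA ?leA0 ?hook //.
Qed.

Lemma leftmostE a : leftmost_chain (@nat_of_ord n) (key w) letters_upto a ->
  size a = tau w -> leftmost w = a.
Proof.
move=> [ca best] sa; rewrite /leftmost.
have E := enum_chain ca; set A0 := [set i in a] in E.
have spA0 : special w A0 by rewrite specialE cardE E ca sa /=.
have leA0 B : special w B -> special_le w A0 B.
  rewrite specialE cardE => /andP[cB /eqP sB]; apply: all2_special_le; rewrite E.
  by have [_] := best _ cB; rewrite sB sa; apply.
have hook A : special w A -> decreasing_hook w A.
  by rewrite specialE wchain_enum => /andP[/andP[]].
case: pickP => [A /= /andP[spA /forall_inP leA]|/(_ A0)]; last first.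
  by rewrite /is_leftmost spA0 /=; move/forall_inP; case=> B; apply: leA0.
suff -> : A = A0 by [].
by apply/eqP; rewrite eqEsubset !special_le_anti ?leA ?leA0 ?hook.
Qed.

End Hooks.

Section Letters.

Variables (n : nat) (w : n.-tuple letter).
Implicit Types (i j : 'I_n) (X : {set 'I_n}) (a : letter).

(** The occurrences of one letter have consecutive ranks and a common sign, so their integers form
    an interval. *)
Lemma same_letter_conv a i j l : tnth w i = a -> tnth w j = a ->
  key w i <= key w l -> key w l <= key w j -> tnth w l = a.
Proof.
move=> ia ja il lj; have ri := std_rank_gt0 w i; have rn := std_rank_le_n w j.
have rl := std_rank_gt0 w l; have rln := std_rank_le_n w l.
have rj := std_rank_gt0 w j; have rin := std_rank_le_n w i.
suff [[/entry_le_letter H1 /entry_le_letter H2]|[/entry_le_letter H1 /entry_le_letter H2]] :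
    ((entry_at w i <= entry_at w l)%O /\ (entry_at w l <= entry_at w j)%O) \/
    ((entry_at w j <= entry_at w l)%O /\ (entry_at w l <= entry_at w i)%O).
- by apply/le_anti; rewrite -{1}ja H2 -ia H1.
- by apply/le_anti; rewrite -{1}ia H2 -ja H1.
rewrite -!std_rank_leE; move: il lj; rewrite /key ia ja.
by case: (barred a); case: (barred _); move: ri rn rl rln rj rin; clear; lia.
Qed.

Lemma same_letter_order a :
  (forall i j, tnth w i = a -> tnth w j = a -> i < j -> key w i < key w j) \/
  (forall i j, tnth w i = a -> tnth w j = a -> i < j -> key w j < key w i).
Proof.
have lt i j : tnth w i = a -> tnth w j = a -> i < j -> std_rank w i < std_rank w j.
  by move=> ia ja ij; rewrite ltnNge same_letter_rank ?ia // -ltnNge.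
case: (boolP (barred a)) => ba; [right|left] => i j ia ja ij;
  have := lt i j ia ja ij; have := std_rank_le_n w j;
  by rewrite /key ia ja ?ba ?(negPf ba); clear; lia.
Qed.

Lemma rightmost_same_letter X u i j v l :
  rightmost_chain (@nat_of_ord n) (key w) X (u ++ i :: j :: v) -> l \in X ->
  tnth w l = tnth w i -> i < l -> j <= l.
Proof.
move=> rk lX li il; rewrite leqNgt; apply/negP => lj.
apply: (rightmost_no_tie (cl := fun z => tnth w z == tnth w i) rk lX il lj).
- by [].
- exact/eqP.
- move=> x y z _ _ _ /eqP xa /eqP ya xz zy; apply/eqP.
  exact: same_letter_conv xa ya xz zy.
by case: (same_letter_order (tnth w i)) => H; [left|right] => x y _ _ /eqP xa /eqP ya;
  apply: H.
Qed.

Lemma leftmost_same_letter X u i j v l :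
  leftmost_chain (@nat_of_ord n) (key w) X (u ++ i :: j :: v) -> l \in X ->
  tnth w l = tnth w j -> l < j -> l <= i.
Proof.
move=> rk lX li lj; rewrite leqNgt; apply/negP => il.
have le_ord (i0 : 'I_n) : i0 <= n + n by rewrite (leq_trans (ltnW (ltn_ord i0))) ?leq_addr.
apply: (leftmost_no_tie (cl := fun z => tnth w z == tnth w j) 
   le_ord (@key_le n w) rk lX il lj).
- by [].
- exact/eqP.
- move=> x y z _ _ _ /eqP xa /eqP ya xz zy; apply/eqP.
  exact: same_letter_conv xa ya xz zy.
by case: (same_letter_order (tnth w j)) => H; [left|right] => x y _ _ /eqP xa /eqP ya;
  apply: H.
Qed.

End Letters.

(** * Lowering and raising: verifying the hypotheses of the rotation *)

Lemma chain_min_last (I : finType) (f g : I -> nat) X c x : chain f g X c -> x \in c ->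
  (forall y, y \in c -> g x <= g y) -> exists d, c = rcons d x.
Proof.
move=> cc xc; case/splitPr: xc cc => d e cc min; exists d.
rewrite -cats1; case: e cc min => [|y e] // cc min.
have [_ ce _] := chain_catP _ _ _ _ _ cc.
have [_ _ H] := chain_catP f g X [:: x] (y :: e) ce.
have /andP[_] := H x y (mem_head _ _) (mem_head _ _).
by rewrite ltnNge min // mem_cat !inE eqxx !orbT.
Qed.

Lemma chain_max_head (I : finType) (f g : I -> nat) X c x : chain f g X c -> x \in c ->
  (forall y, y \in c -> g y <= g x) -> exists d, c = x :: d.
Proof.
move=> cc xc; case/splitPr: xc cc => d e cc max; exists e.
case: d cc max => [|y d] // /chain_catP[_ _ H] max.
have /andP[_] := H y x (mem_head _ _) (mem_head _ _).
by rewrite ltnNge max // mem_head.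
Qed.

Lemma chain_sorted (I : finType) (f g : I -> nat) X c : chain f g X c ->
  sorted (relpre f ltn) c.
Proof. by case/andP=> s _; apply: sub_sorted s => i j /andP[]. Qed.

Lemma chain_rcons (I : finType) (f g : I -> nat) X c i j : chain f g X (rcons c i) ->
  f i < f j -> g j < g i -> j \in X -> chain f g X (rcons (rcons c i) j).
Proof.
move=> /andP[s cX] fij gij jX; rewrite /chain all_rcons cX /= jX !andbT.
case: c s {cX} => [|x c] /= s; first by rewrite /dec_rel fij gij.
by rewrite rcons_path s last_rcons /dec_rel fij gij.
Qed.

Lemma chain_cons (I : finType) (f g : I -> nat) X c i j : chain f g X (i :: c) ->
  f j < f i -> g i < g j -> j \in X -> chain f g X (j :: i :: c).
Proof.
move=> /andP[s cX] fij gij jX; apply/andP; split; last by apply/andP.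
by rewrite /= /dec_rel fij gij.
Qed.

Lemma pi_minus_lowers n (w : n.-tuple letter) : color_lowerable w ->
  Pm (pi_minus w) = C_minus (Pm w) /\ Qm (pi_minus w) = Qm w.
Proof.
case: n w => [|n'] w; first by rewrite tuple0.
move: (n'.+1) (ltn0Sn n') w => n n0 w {n'}.
have [p [jump full]] := exists_jump w n0; set q := std_rank w p in jump full *.
rewrite /color_lowerable (SW_jump jump full) => bp.
have kp : key w p = n - q by rewrite /key bp.
have kp_min i : i \in smallest w q -> key w p <= key w i.
  rewrite inE kp /key => iq; have := std_rank_le_n w i.
  by case: (barred _); move: iq; clear; lia.
have last_p c : chain (@nat_of_ord n) (key w) (smallest w q) c -> size c = tau w ->
    exists d, c = rcons d p.
  move=> cc sc; apply: (chain_min_last cc); first exact: longest_mem sc.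
  by move=> i ic; apply: kp_min; case/andP: cc => _ /allP/(_ i ic).
(* A later occurrence of the barred letter of [p] would have a still smaller integer and prolong a
   longest chain, which ends in [p]. *)
have XLq : letters_upto w p = smallest w q.
  apply/eqP; rewrite eqEsubset smallest_letters andbT; apply/subsetP => i.
  rewrite !inE => ip; rewrite leqNgt; apply/negP => qi.
  have e : tnth w i = tnth w p.
    by apply/le_anti; rewrite ip entry_le_letter // -std_rank_leE ltnW.
  have lpi : p < i by rewrite ltnNge -(same_letter_rank e) -ltnNge.
  have [c cc sc] := exists_longest full; have [d dE] := last_p c cc sc.
  have ccT := chain_subset (subsetT _) cc; rewrite dE in ccT.
  have /wchain_tau : chain (@nat_of_ord n) (key w) setT (rcons (rcons d p) i).
    apply: chain_rcons; rewrite ?inE //= kp /key e bp.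
    by have := std_rank_le_n w i; move: qi; clear; lia.
  by rewrite -dE size_rcons sc ltnn.
have [c0 lc0 sc0] := longest_letters full.
have [a ra sa] := exists_rightmost_chain (@ord_inj n) (@key_inj n w) lc0.
rewrite sc0 in sa; rewrite /pi_minus (rightmostE jump full ra sa).
rewrite XLq in ra; have ca := ra.1; have [d dE] := last_p a ca sa.
case: a ra sa ca dE => [|k1 k0] ra sa ca dE; first by case: d dE.
have pE : last k1 k0 = p by rewrite -(last_rcons k1 d p) -dE.
have k_sorted := chain_sorted ca.
have aq : {subset k1 :: k0 <= smallest w q} by move=> i; case/andP: ca => _ /allP; apply.
have no_tie i j : i \in k1 :: k0 -> i != last k1 k0 -> j \notin k1 :: k0 ->
    tnth w i = tnth w j -> i < j -> next (k1 :: k0) i < j.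
  move=> ik ip jk e ij; have [u [v E]] := sigma_split k_sorted ik ip.
  have jq : j \in smallest w q.
    rewrite -XLq inE -e; have := aq i ik; rewrite inE std_rank_leE.
    exact: entry_le_letter.
  rewrite ltn_neqAle; apply/andP; split.
    by apply: contraNneq jk => /ord_inj <-; rewrite mem_next.
  by move: ra; rewrite {1}E => /rightmost_same_letter; apply.
have below_p j : tnth w j = tnth w (last k1 k0) -> j <= last k1 k0.
  rewrite pE => e; rewrite -(same_letter_rank e).
  have : j \in letters_upto w p by rewrite inE e.
  by rewrite XLq inE.
(* An occurrence of the unbarred letter left of [k1] has an integer above the whole chain and would
   prolong it at the front. *)
have above_k1 j : tnth w j = remove_bar (tnth w (last k1 k0)) ->
    j \notin k1 :: k0 /\ k1 < j.
  rewrite pE => e; have pj : (tnth w p < tnth w j)%O by rewrite e barred_lt_remove_bar.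
  have jk : j \notin k1 :: k0.
    by apply/negP => /aq; rewrite -XLq inE leNgt pj.
  split=> //; rewrite ltnNge; apply/negP => jk1.
  have ljk : j < k1.
    rewrite ltn_neqAle jk1 andbT; apply: contraNneq jk => /ord_inj->; exact: mem_head.
  have /wchain_tau : chain (@nat_of_ord n) (key w) setT [:: j, k1 & k0].
    apply: chain_cons (chain_subset (subsetT _) ca) ljk _ _; last by rewrite inE.
    have := letter_lt_rank pj; have := aq k1 (mem_head _ _); rewrite inE.
    by rewrite /key e /barred /=; case: (~~ _); rewrite -/q; clear; lia.
  by rewrite [size _]/= -[(size k0).+1]/(size (k1 :: k0)) sa ltnn.
subst p; have ext := or_introl (B := leftmost_chain (@nat_of_ord n)
  (key (pi_places w (k1 :: k0))) (smallest (pi_places w (k1 :: k0)) q) (k1 :: k0)) ra.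
split; last exact: (Qm_rotation k_sorted erefl bp no_tie below_p above_k1 aq ext).
by have [] := Pm_rotation k_sorted erefl bp no_tie below_p above_k1 aq ext jump full.
Qed.

Lemma pi_plus_raises n (v : n.-tuple letter) : color_raisable v ->
  Pm (pi_plus v) = C_plus (Pm v) /\ Qm (pi_plus v) = Qm v.
Proof.
case: n v => [|n'] v; first by rewrite tuple0.
move: (n'.+1) (ltn0Sn n') v => n n0 v {n'}.
have [h [jump full]] := exists_jump v n0; set q := std_rank v h in jump full *.
rewrite /color_raisable (SW_jump jump full) => bh.
have kh : key v h = n + q by rewrite /key (negPf bh).
have qn : q <= n := std_rank_le_n v h.
have kh_max i : i \in smallest v q -> key v i <= key v h.
  rewrite inE kh /key => iq.
  by case: (barred _); move: iq; clear; lia.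
have head_h c : chain (@nat_of_ord n) (key v) (smallest v q) c -> size c = tau v ->
    exists d, c = h :: d.
  move=> cc sc; apply: (chain_max_head cc); first exact: longest_mem sc.
  by move=> i ic; apply: kh_max; case/andP: cc => _ /allP/(_ i ic).
have [c0 lc0 sc0] := longest_letters full.
have le_ord (i : 'I_n) : i <= n + n by rewrite (leq_trans (ltnW (ltn_ord i))) ?leq_addr.
have [a ra sa] := exists_leftmost_chain (@ord_inj n) (@key_inj n v) le_ord (@key_le n v) lc0.
rewrite sc0 in sa; rewrite /pi_plus (leftmostE jump full ra sa).
have ca := ra.1.
have [c cc sc] := exists_longest full; have [d dE] := head_h c cc sc.
(* Later occurrences of the letter of [h] are allowed in special subwords but have integers above
   that of [h]. The leftmost chain lies below a longest chain that starts in [h], which keeps them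
   out. *)
have aq : {subset a <= smallest v q}.
  have [_ le_ac] := ra.2 c (chain_subset (smallest_letters v h) cc).
  move: ca le_ac; rewrite sc sa dE; case: (a) => [|k1 k0] ca => [/(_ erefl)//|].
  case/(_ erefl)/andP => /andP[k1h kk1h] _ i ik.
  have il : (tnth v i <= tnth v h)%O.
    by case/andP: ca => _ /allP/(_ i ik); rewrite /= inE.
  rewrite inE leqNgt; apply/negP => qi.
  have e : tnth v i = tnth v h.
    by apply/le_anti; rewrite il entry_le_letter // -std_rank_leE ltnW.
  have hi : h < i by rewrite ltnNge -(same_letter_rank e) -ltnNge.
  move: ik; rewrite inE => /orP[/eqP ik|ik]; first by move: hi; rewrite ik ltnNge k1h.
  have [_ _ H] := chain_catP (@nat_of_ord n) (key v) (letters_upto v h) [:: k1] k0 ca.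
  have /andP[_] := H k1 i (mem_head _ _) ik; rewrite ltnNge (leq_trans kk1h) //.
  by rewrite kh /key e (negPf bh) leq_add2l ltnW.
have rq := leftmost_chain_subset (smallest_letters v h) aq ra.
have cq := rq.1; have [k0 aE] := head_h a cq sa; subst a.
have k_sorted := chain_sorted ca; have k_uniq := chain_uniq ca.
have [_ _ after_h] := chain_catP (@nat_of_ord n) (key v) _ [:: h] k0 cq.
have k0_letter i : i \in k0 -> (tnth v i < tnth v h)%O.
  move=> ik; have /andP[hi _] := after_h h i (mem_head _ _) ik.
  have : i \in smallest v q by apply: aq; rewrite inE ik orbT.
  rewrite inE => iq; rewrite lt_neqAle entry_le_letter -?std_rank_leE // andbT.
  apply: contraL hi => /eqP e; rewrite -leqNgt -(same_letter_rank e) //.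
(* An earlier occurrence [j] could replace [h], giving a longest chain that avoids [h]. *)
have first_h j : tnth v j = tnth v h -> h <= j.
  move=> e; rewrite leqNgt; apply/negP => jh.
  have rj : std_rank v j < q by rewrite ltnNge same_letter_rank ?e // -ltnNge.
  have cj : chain (@nat_of_ord n) (key v) (smallest v q) (j :: k0).
    apply/(chain_catP _ _ _ [:: j] k0); split.
    - by rewrite chain1 inE ltnW.
    - by have [] := chain_catP (@nat_of_ord n) (key v) _ [:: h] k0 cq.
    move=> x i; rewrite inE => /eqP-> ik.
    have /andP[hi _] := after_h h i (mem_head _ _) ik; rewrite (ltn_trans jh hi) /=.
    have := k0_letter i ik; rewrite -e => /letter_lt_rank.
    rewrite /key e (negPf bh); case: (barred _); move: qn rj; clear; lia.
  have := longest_mem jump full cj; rewrite [size _]/= -[(size k0).+1]/(size (h :: k0)).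
  move/(_ sa); rewrite inE => /orP[/eqP hj|hk]; first by rewrite hj ltnn in jh.
  by have := k0_letter h hk; rewrite ltxx.
set w := pi_places_inv v (h :: k0); set p := last h k0.
(* From here on the rotation results are applied to the lowered word [w], with the given word [v] as
   its rotation. *)
have vE : v = pi_places w (h :: k0) by rewrite pi_places_invK.
have [_ next_p] := cycle_sigma k_sorted; rewrite -/p in next_p.
have wp : tnth w p = add_bar (tnth v h).
  rewrite tnth_mktuple next_p eqxx /toggle_bar /add_bar.
  by move: bh; rewrite /barred negbK => ->.
have bp : barred (tnth w p) by rewrite wp.
have rbp : remove_bar (tnth w p) = tnth v h by rewrite -(letter_k1 k_sorted vE bp).
have wk i : i != p -> tnth w i = tnth v (next (h :: k0) i).
  by move=> ip; rewrite -(letter_sigma k_sorted vE).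
have wnk i : i \notin h :: k0 -> tnth w i = tnth v i.
  move=> ik; rewrite wk ?sigma_fix //.
  by apply: contraNneq ik => ->; apply: mem_last.
have no_tie i j : i \in h :: k0 -> i != p -> j \notin h :: k0 ->
    tnth w i = tnth w j -> i < j -> next (h :: k0) i < j.
  move=> ik ip jk; rewrite wk // wnk // => e ij.
  have [x [y E]] := sigma_split k_sorted ik ip.
  rewrite ltnNge; apply/negP => js.
  have js' : j < next (h :: k0) i.
    rewrite ltn_neqAle js andbT; apply: contraNneq jk => /ord_inj->.
    by rewrite mem_next.
  have jX : j \in letters_upto v h.
    rewrite inE -e; have : next (h :: k0) i \in h :: k0 by rewrite mem_next.
    by case/andP: ca => _ /allP H /H; rewrite /= inE.
  move: ra; rewrite {1}E => /leftmost_same_letter/(_ jX (esym e) js').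
  by rewrite leqNgt ij.
(* Such a [j] beyond [p] would carry in [v] the barred form of the letter of [h]; its integer is
   below that of [p], so it would prolong the chain at the end. *)
have below_p j : tnth w j = tnth w p -> j <= p.
  move=> e; rewrite leqNgt; apply/negP => pj.
  have jk : j \notin h :: k0.
    apply: contraL pj; rewrite -leqNgt; move: k_sorted.
    rewrite lastI (sorted_pairwise (fun _ _ _ => @ltn_trans _ _ _)) pairwise_rcons.
    move=> /andP[/allP H _]; rewrite mem_rcons inE => /orP[/eqP->//|/H/ltnW//].
  move: e; rewrite wnk // wp => e.
  have /wchain_tau : chain (@nat_of_ord n) (key v) setT (rcons (h :: k0) j).
    rewrite lastI; apply: chain_rcons; rewrite -?lastI.
    - exact: chain_subset (subsetT _) ca.
    - exact: pj.
    - have : (p == h) || (tnth v p < tnth v h)%O.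
        have : p \in h :: k0 := mem_last h k0.
        by rewrite inE => /orP[->//|/k0_letter->]; rewrite orbT.
      have rjn := std_rank_le_n v j; have rp0 := std_rank_gt0 v p.
      have rpn := std_rank_le_n v p; have rj0 := std_rank_gt0 v j.
      rewrite -/p; case/orP => [/eqP->|lt].
        by rewrite kh /key e /=; move: rj0 rjn; clear; lia.
      have rpj : std_rank v p < std_rank v j.
        apply: std_rank_lt; rewrite entry_ltE orbC pj andbT -le_eqVlt e leNgt.
        by rewrite letter_gap // -ltNge -wp rbp.
      by rewrite {1}/key e /= /key; case: (barred _); move: rpj rjn; clear; lia.
    - by [].
  by rewrite size_rcons sa ltnn.
(* The letters of [v] on the subword after [h] are smaller than that of [h], so in [w] the unbarred
   letter occurs only off the subword, where both words agree. *)
have above_h j : tnth w j = remove_bar (tnth w p) -> j \notin h :: k0 /\ h < j.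
  rewrite rbp => e.
  have jp : j != p by apply: contraTneq bp => <-; rewrite e.
  have jk : j \notin h :: k0.
    apply/negP => jk; have : next (h :: k0) j \in h :: k0 by rewrite mem_next.
    rewrite inE => /orP[/eqP nj|/k0_letter]; last by rewrite -wk // e ltxx.
    by move: jp; rewrite -(sigma_p k_sorted) nj eqxx.
  split=> //; rewrite ltn_neqAle; apply/andP; split.
    by apply: contraNneq jk => /ord_inj<-; apply: mem_head.
  by apply: first_h; rewrite -wnk.
have qE : std_rank w p = q by rewrite -(rank_k1 k_sorted vE bp no_tie below_p above_h).
have kq : {subset h :: k0 <= smallest w (std_rank w p)}.
  move=> i ik; rewrite inE qE -(rank_sigma k_sorted vE bp no_tie below_p above_h i).
  have : next (h :: k0) i \in smallest v q by apply: aq; rewrite mem_next.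
  by rewrite inE.
have ext : rightmost_chain (@nat_of_ord n) (key w) (smallest w (std_rank w p)) (h :: k0) \/
    leftmost_chain (@nat_of_ord n) (key v) (smallest v (std_rank w p)) (h :: k0).
  by right; rewrite qE.
have sz := size_tableau_rotation k_sorted vE bp no_tie below_p above_h kq ext.
split; last by rewrite (Qm_rotation k_sorted vE bp no_tie below_p above_h kq ext).
have [||_ ->//] := Pm_rotation k_sorted vE bp no_tie below_p above_h kq ext.
- by rewrite -!sz qE.
- by rewrite -!sz qE.
Qed.

Theorem theorem4p8 :
  (forall (n : nat) (w : n.-tuple letter), color_lowerable w ->
     Pm (pi_minus w) = C_minus (Pm w) /\ Qm (pi_minus w) = Qm w) /\
  (forall (n : nat) (v : n.-tuple letter), color_raisable v ->
     Pm (pi_plus v) = C_plus (Pm v) /\ Qm (pi_plus v) = Qm v).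
Proof. by split=> n w; [apply: pi_minus_lowers | apply: pi_plus_raises]. Qed.
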